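(* Let $n\ge1$ be an integer and let $f\colon\mathbb{C}\to\mathbb{P}^n$ be a transcendental linearly non-degenerate holomorphic curve of order zero. Then $$\limsup_{r\to\infty}\frac{N_1(r,f)}{T(r,f)}\ge 1.$$
   Context: $\mathbb{P^n}$ is complex projective space of dimension $n$. A reduced homogeneous representation of a holomorphic curve $f\colon\mathbb{C}\to\mathbb{P}^n$ is a vector $\boldsymbol f=(f_0,\ldots,f_n)$ of entire functions with no common zeros such that $f=[\boldsymbol f]$. The curve is linearly non-degenerate if $f_0,\ldots,f_n$ are linearly independent over $\mathbb{C}$. It is rational if it extends holomorphically to $\mathbb{P}^1$ (equivalently, has a representation with polynomial coordinates), and transcendental otherwise. The characteristic is $T(r,f)=\frac1{2\pi}\int_{-\pi}^{\pi}\log\|\boldsymbol f(re^{it})\|\,dt-\log\|\boldsymbol f(0)\|$ with $\|\cdot\|$ the Euclidean norm; it does not depend on the reduced representation. The order of $f$ is $\limsup_{r\to\infty}\frac{\log T(r,f)}{\log r}$. The Wronskian is $W_{\boldsymbol f}=\det\bigl(f_j^{(i)}\bigr)_{0\le i,j\le n}$. If $n_1(r)$ is the number of zeros of $W_{\boldsymbol f}$ in $|z|\le r$, with multiplicity, then $N_1(r,f)=\int_0^r\bigl(n_1(t)-n_1(0)\bigr)\frac{dt}{t}+n_1(0)\log r$; it does not depend on the reduced representation. *)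

(* Defs.v *)
From HB Require Import structures.
From mathcomp Require Import all_boot all_order all_algebra.
From mathcomp Require Import complex.
From mathcomp Require Import all_classical all_reals all_analysis.

Set Implicit Arguments.
Unset Strict Implicit.
Unset Printing Implicit Defensive.

Import Order.TTheory GRing.Theory Num.Theory.
Import numFieldNormedType.Exports.

Local Open Scope classical_set_scope.
Local Open Scope ring_scope.

(* R[i] viewed through its numClosedFieldType structure, which is what carries
   the norm topology; derivatives over this field are complex derivatives. *)
Definition C (R : realType) : numClosedFieldType := R[i].

(* Points of P^n are the lines of C^(n+1); [v] is <[v]>%VS for v != 0. *)
Definition projective_space (R : realType) (n : nat) : Type :=
  {L : {vspace 'rV[C R]_n.+1} | \dim L == 1%N}.

Section Definitions.
Variables (R : realType) (n : nat).
Local Notation C := (C R).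
Implicit Types (F G : C -> 'rV[C]_n.+1) (f g : C -> projective_space R n).
Implicit Types (W : C -> C) (r : R).

Definition coord_fun F (j : 'I_n.+1) : C -> C := fun z => F z 0 j.

(* A map to P^n is holomorphic near z0 when it lifts, near z0, to a holomorphic
   map to C^(n+1) without zeros. *)
Definition holomorphic_at f (z0 : C) : Prop :=
  exists G, \forall z \near z0,
    [/\ forall j, derivable (coord_fun G j) z 1, G z != 0
      & val (f z) = <[G z]>%VS].

Definition holomorphic_curve f : Prop := forall z, holomorphic_at f z.

Definition entire W : Prop := forall z, derivable W z 1.

Definition reduced_representation F f : Prop :=
  [/\ forall j, entire (coord_fun F j), forall z, F z != 0
    & forall z, val (f z) = <[F z]>%VS].

(* g is the extension of f to P^1 read in the chart w = 1/z at infinity. *)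
Definition rational_curve f : Prop :=
  holomorphic_curve f /\
  exists g, holomorphic_at g 0 /\ forall w, w != 0 -> g w = f w^-1.

Definition transcendental_curve f : Prop := ~ rational_curve f.

Definition linearly_nondegenerate F : Prop :=
  forall c : 'I_n.+1 -> C,
    (forall z, \sum_(j < n.+1) c j * coord_fun F j z = 0) ->
    forall j, c j = 0.

Definition euclidean_norm (v : 'rV[C]_n.+1) : R :=
  Num.sqrt (\sum_(j < n.+1) ComplexField.Normc.normc (v 0 j) ^+ 2).

Definition circle_point r (t : R) : C := Complex (r * cos t) (r * sin t).

Definition characteristic F r : R :=
  (2 * pi)^-1 *
    (\int[@lebesgue_measure R]_(t in `[- pi, pi])
       ln (euclidean_norm (F (circle_point r t))))
  - ln (euclidean_norm (F 0)).

Definition curve_order F : \bar R :=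
  limf_esup (fun r => (ln (characteristic F r) / ln r)%:E) (pinfty_nbhs R).

Definition wronskian F : C -> C := fun z =>
  \det (\matrix_(i < n.+1, j < n.+1) derive1n i (coord_fun F j) z).

(* Order of vanishing of W at z: the least k with W^(k)(z) != 0 (and 0, by
   convention, if there is none). *)
Definition zero_multiplicity W (z : C) : nat :=
  xget 0%N [set k | derive1n k W z != 0 /\
                    forall i, (i < k)%N -> derive1n i W z = 0].

(* Points that are not zeros contribute 0.  The sum has finite support when W
   is entire and not identically zero. *)
Definition zero_count W r : R :=
  \sum_(z \in [set z : C | ComplexField.Normc.normc z <= r])
    ((zero_multiplicity W z)%:R : R).

Definition integrated_zero_count W r : R :=
  (\int[@lebesgue_measure R]_(t in `[0, r])
     ((zero_count W t - zero_count W 0) / t))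
  + zero_count W 0 * ln r.

Definition N1 F r : R := integrated_zero_count (wronskian F) r.

End Definitions.

(* Main.v *)
Require Import Defs.
From HB Require Import structures.
From mathcomp Require Import all_boot all_order all_algebra.
From mathcomp Require Import perm complex.
From mathcomp Require Import all_classical all_reals all_analysis.
From mathcomp Require Import measurable_realfun.
From mathcomp Require Import ring lra zify.

(** The proof bounds the maximum of a Wronskian on a circle from both sides and
    compares.  Write T for the characteristic of F and u = log |F|, and
    suppose that N_1(r) <= (1 - d) T(r) for all large r.

    Normalization.  On the circle |z| = 2^J the function u is within 2 of
    T(2^J) + Re k_J for some polynomial k_J with k_J(0) = u(0)
    (circle_approx, normalizer_exists), because a continuous function on a
    circle is uniformly close to real parts of polynomials.  Division of F by
    exp(k_J) makes its logarithm constant on that circle up to a bounded error,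
    and changes the Wronskian W(F) by the factor exp(-(n+1) k_J)
    (wronskian_scale).  Since T grows more slowly than (3/2)^J,
    the Borel-Caratheodory inequality shows that k_J(z) converges for every z
    (normalizer_cauchy).  If moreover exp T(2^J) had polynomial growth, the
    normalized coordinates would converge to polynomials and the curve would be
    rational (rational_of_slow_growth).  Hence T(2^j)/j is unbounded, while
    order zero forbids doubling at every stage: for any fixed b and M
    there are arbitrarily large j with T(2^J) <= 2 T(2^j), where J = j + n + b,
    and T(2^j) >= M j (doubling_pause).  Only such radii r = 2^j are used.

    Lower bound.  For polynomials p_0, ..., p_n of degree at most d, the norm
    of the Wronskian controls, up to a factor A^d, the product of the norms of
    the p_m corrected by suitable combinations of the previous ones
    (wronskian_lower).  For n = 1 this is obtained by integrating
    (y/p)' = W(p, y)/p^2 along a circle on which p is not small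
    (poly_min_modulus, wronskian2_lower); Frobenius' identity reduces the order
    (wronskian_reduce).  Linear non-degeneracy, tested at finitely many points
    (nondegenerate_points), keeps the corrections under control
    (wronskian_dominates).  At a radius r as above, Taylor polynomials of degree
    O(T(r)/b) approximate the normalized coordinates well enough, and the result
    is T(r) <= O(T(r)/b) + O(j) + log(M + 1), where M is the maximum of the
    normalized Wronskian on |z| = r (characteristic_upper).

    Upper bound.  Dividing W by its zeros in |z| <= s = 2^a r leaves a function
    without zeros in that disc, whose logarithm has, by Borel-Caratheodory,
    variation O(2^-a T(r)) on |z| <= r (zerofree_growth).  The zeros contribute
    N_1(r), and a bounded amount for each zero in |z| <= s; there are at most
    O(T(r)/a) of these since each one contributes at least a log 2 to
    N_1(2^a s) (wronskian_growth, count_le_integrated).  So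
    log M <= N_1(r) + O(T(r)/a) + O(1)  (normalized_wronskian_upper).

    With b = 2a + 2, the two bounds give d T(r) <= O(T(r)/a) + O(j); a large a
    and then j with T(2^j) >= M j for a large M make this impossible.

    The function theory needed (Goursat, Cauchy, Taylor expansion, factorization
    of zeros, minimum principle, Borel-Caratheodory) is developed from squares
    and circles, with integrals of continuous functions taken as increments of
    antiderivatives. *)

Set Implicit Arguments.
Unset Strict Implicit.
Unset Printing Implicit Defensive.

Import Order.TTheory GRing.Theory Num.Theory.
Import numFieldNormedType.Exports.

Local Open Scope classical_set_scope.
Local Open Scope ring_scope.

(** * The modulus and the real and imaginary parts *)

Section Basics.
Variable R : realType.
Local Notation K := (C R).
Implicit Types (z w h d : K) (x y r : R) (f g : K -> K).

(** The real-valued modulus: the norm of [C R] takes its values in [C R] itself. *)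
Definition cabs z : R := ComplexField.Normc.normc z.
Definition toC x : K := Complex x 0.
Definition cre z : R := complex.Re z.
Definition cim z : R := complex.Im z.

Lemma normE z : `|z| = toC (cabs z).
Proof. by []. Qed.
Lemma cabs0 : cabs 0 = 0. Proof. exact: ComplexField.Normc.normc0. Qed.
Lemma cabs1 : cabs 1 = 1. Proof. exact: ComplexField.Normc.normc1. Qed.
Lemma cabsM z w : cabs (z * w) = cabs z * cabs w.
Proof. exact: ComplexField.Normc.normcM. Qed.
Lemma cabsV z : cabs z^-1 = (cabs z)^-1.
Proof. exact: ComplexField.Normc.normcV. Qed.
Lemma cabsD z w : cabs (z + w) <= cabs z + cabs w.
Proof. exact: le_normcD. Qed.
Lemma cabsN z : cabs (- z) = cabs z. Proof. exact: normcN. Qed.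
Lemma cabs_ge0 z : 0 <= cabs z.
Proof. by case: z => a b; exact: sqrtr_ge0. Qed.
Lemma cabs_eq0 z : (cabs z == 0) = (z == 0).
Proof.
apply/eqP/eqP => [|->]; last exact: cabs0.
exact: ComplexField.Normc.eq0_normc.
Qed.
Lemma cabs_gt0 z : (0 < cabs z) = (z != 0).
Proof. by rewrite lt_neqAle cabs_ge0 andbT eq_sym cabs_eq0. Qed.
Lemma cabsX z n : cabs (z ^+ n) = cabs z ^+ n.
Proof. by elim: n => [|n IH]; rewrite ?expr0 ?cabs1// !exprS cabsM IH. Qed.
Lemma cabs_div z w : cabs (z / w) = cabs z / cabs w.
Proof. by rewrite cabsM cabsV. Qed.
Lemma cabsC z w : cabs (z - w) = cabs (w - z).
Proof. by rewrite -cabsN opprB. Qed.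
Lemma cabsB z w : cabs (z - w) <= cabs z + cabs w.
Proof. by rewrite -(cabsN w) cabsD. Qed.
Lemma cabs_subr z w : cabs z - cabs w <= cabs (z - w).
Proof. by rewrite lerBlDr -{1}(subrK w z) cabsD. Qed.
Lemma cabs_sum (I : Type) (s : seq I) (P : pred I) (F : I -> K) :
  cabs (\sum_(i <- s | P i) F i) <= \sum_(i <- s | P i) cabs (F i).
Proof.
elim/big_ind2: _ => [|z x w y zx wy|//]; first by rewrite cabs0.
by apply: le_trans (cabsD _ _) _; apply: lerD.
Qed.
Lemma cabs_prod (I : Type) (s : seq I) (P : pred I) (F : I -> K) :
  cabs (\prod_(i <- s | P i) F i) = \prod_(i <- s | P i) cabs (F i).
Proof.
by elim/big_ind2: _ => [|z x w y <- <-|//]; rewrite ?cabs1 ?cabsM.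
Qed.
Lemma cabs_toC x : cabs (toC x) = `|x|.
Proof. by rewrite /cabs /= expr0n addr0 sqrtr_sqr. Qed.
Lemma toC0 : toC 0 = 0. Proof. by []. Qed.
Lemma toC1 : toC 1 = 1. Proof. by []. Qed.
Lemma toCD x y : toC (x + y) = toC x + toC y. Proof. exact: (rmorphD (real_complex R)). Qed.
Lemma toCM x y : toC (x * y) = toC x * toC y. Proof. exact: (rmorphM (real_complex R)). Qed.
Lemma toCN x : toC (- x) = - toC x. Proof. exact: (rmorphN (real_complex R)). Qed.
Lemma toC_nat n : toC n%:R = n%:R. Proof. exact: (rmorph_nat (real_complex R)). Qed.
Lemma cabs_nat n : cabs n%:R = n%:R.
Proof. by rewrite -toC_nat cabs_toC ger0_norm. Qed.
Lemma toC_inj : injective toC. Proof. by move=> x y []. Qed.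
Lemma cre_toC x : cre (toC x) = x. Proof. by []. Qed.
Lemma creD z w : cre (z + w) = cre z + cre w.
Proof. by case: z w => [a b] [c d]. Qed.
Lemma cimD z w : cim (z + w) = cim z + cim w.
Proof. by case: z w => [a b] [c d]. Qed.
Lemma creN z : cre (- z) = - cre z. Proof. by case: z. Qed.
Lemma cimN z : cim (- z) = - cim z. Proof. by case: z. Qed.
Lemma creB z w : cre (z - w) = cre z - cre w. Proof. by rewrite creD creN. Qed.
Lemma cimB z w : cim (z - w) = cim z - cim w. Proof. by rewrite cimD cimN. Qed.
Lemma creM z w : cre (z * w) = cre z * cre w - cim z * cim w.
Proof. by case: z w => [a b] [c d]. Qed.
Lemma cimM z w : cim (z * w) = cre z * cim w + cim z * cre w.
Proof. by case: z w => [a b] [c d]. Qed.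
Lemma cre_sum (I : Type) (s : seq I) (P : pred I) (F : I -> K) :
  cre (\sum_(i <- s | P i) F i) = \sum_(i <- s | P i) cre (F i).
Proof. by elim/big_ind2: _ => [//|z x w y <- <-|//]; rewrite creD. Qed.
Lemma creim_eq z w : cre z = cre w -> cim z = cim w -> z = w.
Proof. by case: z w => [a b] [c d] /= -> ->. Qed.
Lemma cabs_sqr z : cabs z ^+ 2 = cre z ^+ 2 + cim z ^+ 2.
Proof. by case: z => a b; rewrite sqr_sqrtr// addr_ge0// sqr_ge0. Qed.
Lemma cre_le z : `|cre z| <= cabs z.
Proof.
rewrite -[leRHS](ger0_norm (cabs_ge0 z)) -ler_sqr ?nnegrE// !real_normK ?num_real//.
by rewrite cabs_sqr lerDl sqr_ge0.
Qed.
Lemma cim_le z : `|cim z| <= cabs z.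
Proof.
rewrite -[leRHS](ger0_norm (cabs_ge0 z)) -ler_sqr ?nnegrE// !real_normK ?num_real//.
by rewrite cabs_sqr lerDr sqr_ge0.
Qed.
Lemma creimE z : z = toC (cre z) + Complex 0 (cim z).
Proof. by apply: creim_eq; rewrite ?creD ?cimD /= ?addr0 ?add0r. Qed.
Lemma cabs_le_creim z : cabs z <= `|cre z| + `|cim z|.
Proof.
rewrite {1}(creimE z); apply: le_trans (cabsD _ _) _.
by rewrite cabs_toC lerD2l /cabs /= expr0n add0r sqrtr_sqr.
Qed.
Lemma toC_gt0 x : (0 < toC x) = (0 < x).
Proof. exact: (ltcR 0 x). Qed.
Lemma toC_le x y : (toC x <= toC y) = (x <= y). Proof. exact: lecR. Qed.
Lemma toC_lt x y : (toC x < toC y) = (x < y). Proof. exact: ltcR. Qed.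
Lemma gt0_toC z : 0 < z -> exists2 x, 0 < x & z = toC x.
Proof.
case: z => a b; rewrite ltcE /= => /andP[/eqP -> a0]; exists a => //.
Qed.
End Basics.

Section IsDerive.
Variable (K : numFieldType).
Implicit Types (f : K -> K) (x d h : K).

Lemma is_derive_epsP f x d :
  is_derive x 1 f d <->
  (forall e, 0 < e -> exists2 dl, 0 < dl &
     forall h, `|h| < dl -> `|f (x + h) - f x - d * h| <= e * `|h|).
Proof.
split.
- case=> df dE e e0.
  move: df; rewrite /derivable -/(derive f x 1) => /cvg_ex[l].
  move=> fl; have ld : l = d.
    by rewrite -dE; apply/esym/cvg_lim.
  rewrite {}ld in fl.
  have /cvgrPdist_le/(_ e e0) := fl.
  rewrite near_withinE => /nbhs_ballP[dl /= dl0 H].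
  exists dl => // h hdl.
  have [->|h0] := eqVneq h 0.
    by rewrite addr0 mulr0 subrr subr0 normr0 mulr0.
  have /= := H h; rewrite -ball_normE /= sub0r normrN => /(_ hdl h0).
  rewrite -[_ *: 1]/(h * 1) mulr1 (addrC h) => H1.
  rewrite -ler_pdivrMr ?normr_gt0// -normfV -normrM.
  rewrite distrC in H1; move: H1; congr (_ <= _); congr (`| _ |).
  by rewrite -[_ *: _]/(h^-1 * _) [h^-1 * _]mulrC [in RHS]mulrBl mulfK.
- move=> H.
  have fd : (fun h => h^-1 *: ((f \o shift x) (h *: 1) - f x)) @ 0^' --> d.
    apply/cvgrPdist_le => e e0.
    have [dl dl0 Hdl] := H e e0.
    rewrite near_withinE; apply/nbhs_ballP; exists dl => //= h.
    rewrite -ball_normE /= sub0r normrN => hdl h0.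
    rewrite -[_ *: 1]/(h * 1) mulr1 (addrC h).
    have := Hdl h hdl.
    rewrite -ler_pdivrMr ?normr_gt0// -normfV -normrM.
    rewrite distrC; congr (_ <= _); congr (`| _ |).
    by rewrite -[_ *: _]/(h^-1 * _) [h^-1 * _]mulrC [in LHS]mulrBl mulfK.
  have dv : derivable f x 1 by rewrite /derivable; apply/cvg_ex; exists d.
  by apply: DeriveDef => //; apply: cvg_lim fd.
Qed.
End IsDerive.

Lemma is_derive_epsR (R : realType) (f : R -> R) (x d : R) :
  is_derive x 1 f d <->
  (forall e : R, 0 < e -> exists2 dl : R, 0 < dl &
     forall h : R, `|h| < dl -> `|f (x + h) - f x - d * h| <= e * `|h|).
Proof. exact: is_derive_epsP. Qed.

(** * Complex differentiability and the exponential *)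

Section Calculus.
Variable R : realType.
Local Notation K := (C R).
Implicit Types (z w h d c : K) (x y r e : R) (f g : K -> K) (p : R -> K).

(** Complex differentiability with real epsilons and deltas; derivatives are
    computed in this form and transferred to [derive1] by [cdiff_derive1]. *)
Definition cdiff f z d := forall e, 0 < e -> exists2 dl : R, 0 < dl &
  forall h, cabs h < dl -> cabs (f (z + h) - f z - d * h) <= e * cabs h.

(** The same notion for a path, whose parameter is real. *)
Definition pdiff p (t : R) c := forall e, 0 < e -> exists2 dl : R, 0 < dl &
  forall h : R, `|h| < dl -> cabs (p (t + h) - p t - c * toC h) <= e * `|h|.

Lemma cdiffP f z d : is_derive z 1 f d <-> cdiff f z d.
Proof.
split => [/is_derive_epsP H e e0|H].
- have [dl /gt0_toC[x x0 ->] Hx] := H (toC e) (etrans (toC_gt0 _) e0).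
  exists x => // h hx; have := Hx h.
  by rewrite !normE toC_lt -toCM toC_le; apply.
- apply/is_derive_epsP => e /gt0_toC[x x0 ->].
  have [y y0 Hy] := H x x0; exists (toC y); first by rewrite toC_gt0.
  by move=> h; rewrite !normE toC_lt -toCM toC_le; exact: Hy.
Qed.

Lemma cdiff_derive1 f z d : cdiff f z d -> derive1 f z = d.
Proof. by move/cdiffP => [_]; rewrite derive1E. Qed.

Lemma derivable_cdiff f z : derivable f z 1 -> cdiff f z (derive1 f z).
Proof. by move=> H; apply/cdiffP; rewrite derive1E; apply: DeriveDef. Qed.

Lemma cdiff_derivable f z d : cdiff f z d -> derivable f z 1.
Proof. by move/cdiffP => []. Qed.

Lemma cdiff_ext f g z d : f =1 g -> cdiff f z d -> cdiff g z d.
Proof. by move=> /funext ->. Qed.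

Lemma cdiff_cst c z : cdiff (fun=> c) z 0.
Proof. by apply/cdiffP; exact: is_derive_cst. Qed.
Lemma cdiff_id z : cdiff id z 1.
Proof. by apply/cdiffP; exact: is_derive_id. Qed.
Lemma cdiffD f g z a b : cdiff f z a -> cdiff g z b ->
  cdiff (fun w => f w + g w) z (a + b).
Proof. by move=> /cdiffP ? /cdiffP ?; apply/cdiffP; exact: is_deriveD. Qed.
Lemma cdiffN f z a : cdiff f z a -> cdiff (fun w => - f w) z (- a).
Proof. by move=> /cdiffP ?; apply/cdiffP; exact: is_deriveN. Qed.
Lemma cdiffB f g z a b : cdiff f z a -> cdiff g z b ->
  cdiff (fun w => f w - g w) z (a - b).
Proof. by move=> ? ?; apply: cdiffD => //; apply: cdiffN. Qed.
Lemma cdiffM f g z a b : cdiff f z a -> cdiff g z b ->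
  cdiff (fun w => f w * g w) z (a * g z + f z * b).
Proof.
move=> /cdiffP fa /cdiffP gb; apply/cdiffP.
have -> : a * g z + f z * b = f z * b + g z * a by ring.
exact: (@is_deriveM K K^o f g z 1 a b fa gb).
Qed.
Lemma cdiffMl f z a c : cdiff f z a -> cdiff (fun w => c * f w) z (c * a).
Proof.
move=> fa; have := cdiffM (cdiff_cst c z) fa; by rewrite mul0r add0r.
Qed.
Lemma cdiffV f z a : f z != 0 -> cdiff f z a ->
  cdiff (fun w => (f w)^-1) z (- a / f z ^+ 2).
Proof.
move=> fz /cdiffP[fa <-]; apply/cdiffP.
apply: DeriveDef; first exact: (@derivableV K K^o f z 1 fz fa).
by rewrite (@deriveV K K^o f z 1 fz fa) mulNr mulrC -mulNr.
Qed.
Lemma cdiff_horner (p : {poly K}) z : cdiff (horner p) z p^`().[z].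
Proof.
elim/poly_ind: p => [|p c IH].
  apply: (@cdiff_ext (fun=> 0)); first by move=> w; rewrite horner0.
  by rewrite deriv0 horner0; exact: cdiff_cst.
apply: (@cdiff_ext (fun w => p.[w] * w + c)).
  by move=> w; rewrite !hornerE.
have := cdiffD (cdiffM IH (cdiff_id z)) (cdiff_cst c z).
by rewrite derivD derivM derivX derivC !hornerE.
Qed.

Lemma cdiff_cont f z d : cdiff f z d -> forall e, 0 < e ->
  exists2 dl : R, 0 < dl & forall w, cabs (w - z) < dl -> cabs (f w - f z) < e.
Proof.
move=> fd e e0.
have [dl dl0 H] := fd 1 ltr01.
have D0 : 0 < cabs d + 1 by rewrite ltr_wpDl// cabs_ge0.
exists (Num.min dl (e / (cabs d + 1))) => [|w].
  by rewrite lt_min dl0 divr_gt0.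
rewrite lt_min => /andP[w1]; rewrite ltr_pdivlMr// => w2.
have := H _ w1; rewrite [z + _]addrC subrK mul1r => w3.
rewrite -(subrK (d * (w - z)) (f w - f z)).
apply: le_lt_trans (cabsD _ _) _; apply: le_lt_trans w2.
by rewrite [leRHS]mulrDr mulr1 addrC [cabs (d * _)]cabsM mulrC lerD2l.
Qed.

Lemma cdiff_lipschitz f z d c : cdiff f z d -> forall e, 0 < e ->
  exists2 dl : R, 0 < dl & forall (k ch : K) (t : R), 0 <= t -> t < dl ->
    cabs ch <= cabs c * t ->
    cabs (k - ch) <= dl * t -> cabs (f (z + k) - f z - d * ch) <= e * t.
Proof.
move=> fd e e0.
have C0 : 0 < cabs c + 1 by rewrite ltr_wpDl// cabs_ge0.
have D0 : 0 < cabs d + 1 by rewrite ltr_wpDl// cabs_ge0.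
have [dl dl0 H] := fd (e / 2 / (cabs c + 1)) (divr_gt0 (divr_gt0 e0 (ltr0n _ 2)) C0).
exists (Num.min (Num.min 1 (dl / (cabs c + 1))) (e / 2 / (cabs d + 1))).
  by rewrite !lt_min ltr01 !divr_gt0.
move=> k ch t t0; rewrite !lt_min -andbA => /and3P[_ t1 _] Hch kch.
have kc1 : cabs (k - ch) <= t.
  apply: le_trans kch _; rewrite -[leRHS]mul1r ler_wpM2r//.
  by rewrite !ge_min lexx.
have kc2 : (cabs d + 1) * cabs (k - ch) <= e / 2 * t.
  rewrite mulrC -ler_pdivlMr//; apply: le_trans kch _.
  rewrite [leRHS]mulrAC ler_wpM2r//.
  by rewrite ge_min lexx orbT.
have kt : cabs k <= (cabs c + 1) * t.
  rewrite -(subrK ch k); apply: le_trans (cabsD _ _) _.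
  by rewrite mulrDl mul1r addrC lerD.
have kdl : cabs k < dl.
  by apply: le_lt_trans kt _; rewrite mulrC -ltr_pdivlMr.
have -> : f (z + k) - f z - d * ch = (f (z + k) - f z - d * k) + d * (k - ch).
  by ring.
apply: le_trans (cabsD _ _) _.
rewrite [e in leRHS]splitr mulrDl lerD//.
- apply: le_trans (H _ kdl) _.
  rewrite -[leLHS]mulrA ler_wpM2l//; first by rewrite divr_ge0 ?ltW.
  by rewrite mulrC ler_pdivrMr// mulrC.
- rewrite cabsM; apply: le_trans kc2; apply: ler_wpM2r; first exact: cabs_ge0.
  by rewrite lerDl.
Qed.

Lemma cdiff_comp f g z c d : cdiff g z c -> cdiff f (g z) d ->
  cdiff (fun w => f (g w)) z (d * c).
Proof.
move=> gc fd e e0.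
have [dl dl0 H] := cdiff_lipschitz c fd e0.
have [dl' dl'0 H'] := gc dl dl0.
exists (Num.min dl dl'); first by rewrite lt_min dl0.
move=> h; rewrite lt_min => /andP[h1 h2].
rewrite -mulrA.
have := H (g (z + h) - g z) (c * h) _ (cabs_ge0 h) h1 _ (H' _ h2).
by rewrite [g z + _]addrC subrK; apply; rewrite cabsM.
Qed.

Lemma pdiff_comp f p t c d : pdiff p t c -> cdiff f (p t) d ->
  pdiff (fun s => f (p s)) t (d * c).
Proof.
move=> gc fd e e0.
have [dl dl0 H] := cdiff_lipschitz c fd e0.
have [dl' dl'0 H'] := gc dl dl0.
exists (Num.min dl dl'); first by rewrite lt_min dl0.
move=> h; rewrite lt_min => /andP[h1 h2].
rewrite -mulrA.
have := H (p (t + h) - p t) (c * toC h) _ (normr_ge0 h) h1 _ (H' _ h2).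
by rewrite [p t + _]addrC subrK; apply; rewrite cabsM cabs_toC.
Qed.

Lemma pdiff_cre p t c : pdiff p t c -> is_derive t 1 (fun s => cre (p s)) (cre c).
Proof.
move=> H; apply/is_derive_epsR => e e0.
have [dl dl0 Hd] := H e e0; exists dl => // h hd.
apply: le_trans (Hd h hd); apply: le_trans (cre_le _).
by rewrite !creB creM /= mulr0 subr0.
Qed.

Lemma pdiff_cim p t c : pdiff p t c -> is_derive t 1 (fun s => cim (p s)) (cim c).
Proof.
move=> H; apply/is_derive_epsR => e e0.
have [dl dl0 Hd] := H e e0; exists dl => // h hd.
apply: le_trans (Hd h hd); apply: le_trans (cim_le _).
by rewrite !cimB cimM /= mulr0 add0r.
Qed.

Lemma pdiff_Complex (a b : R -> R) (t a' b' : R) :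
  is_derive t 1 a a' -> is_derive t 1 b b' ->
  pdiff (fun s => Complex (a s) (b s)) t (Complex a' b').
Proof.
move=> /is_derive_epsR Ha /is_derive_epsR Hb e e0.
have e20 : 0 < e / 2 by rewrite divr_gt0.
have [da da0 {}Ha] := Ha _ e20; have [db db0 {}Hb] := Hb _ e20.
exists (Num.min da db); first by rewrite lt_min da0.
move=> h; rewrite lt_min => /andP[h1 h2].
apply: le_trans (cabs_le_creim _) _.
rewrite !creB creM !cimB cimM /= !mulr0 subr0 add0r.
by rewrite [e in leRHS]splitr mulrDl lerD// ?Ha ?Hb.
Qed.
End Calculus.

Section Exp.
Variable R : realType.
Local Notation K := (C R).

Definition expC (z : K) : K := toC (expR (cre z)) * Complex (cos (cim z)) (sin (cim z)).

Lemma expCD (z w : K) : expC (z + w) = expC z * expC w.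
Proof.
rewrite /expC creD cimD expRD cosD sinD.
apply: creim_eq; rewrite !(creM,cimM) /=; ring.
Qed.
Lemma expC0 : expC 0 = 1.
Proof. by apply: creim_eq; rewrite !(creM,cimM) /= expR0 cos0 sin0; ring. Qed.
Lemma cabs_expC (z : K) : cabs (expC z) = expR (cre z).
Proof.
rewrite /expC cabsM cabs_toC ger0_norm ?expR_ge0//.
by rewrite /cabs /= cos2Dsin2 sqrtr1 mulr1.
Qed.
Lemma expC_neq0 (z : K) : expC z != 0.
Proof. by rewrite -cabs_gt0 cabs_expC expR_gt0. Qed.

(** The parts of exp(w) - 1 - w are controlled by the derivatives at 0 of exp,
    cos and sin on the real line; the functional equation moves this to every
    point. *)
Lemma cdiff_expC0 : cdiff expC 0 1.
Proof.
move=> e e0.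
set a := Num.min (e / 8) 1.
have a0 : 0 < a by rewrite lt_min ltr01 divr_gt0.
have a1 : a <= 1 by rewrite ge_min lexx orbT.
have a8 : a <= e / 8 by rewrite ge_min lexx.
have /is_derive_epsR/(_ _ a0)[d1 d10 H1] : is_derive (0:R) 1 expR 1.
  by have := is_derive_expR (0:R); rewrite expR0.
have /is_derive_epsR/(_ _ a0)[d2 d20 H2] : is_derive (0:R) 1 (@cos R) 0.
  by have := is_derive_cos (0:R); rewrite sin0 oppr0.
have /is_derive_epsR/(_ _ a0)[d3 d30 H3] : is_derive (0:R) 1 (@sin R) 1.
  by have := is_derive_sin (0:R); rewrite cos0.
have e14 : 0 < e / 32 by rewrite divr_gt0.
exists (Num.min (Num.min d1 d2) (Num.min d3 (Num.min 1 (e / 32)))).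
  by rewrite !lt_min d10 d20 d30 ltr01 e14.
move=> h; rewrite !lt_min -!andbA => /and5P[h1 h2 h3 h4 h5].
rewrite expC0 add0r mul1r.
have xn := cre_le h; have yn := cim_le h; have n0 := cabs_ge0 h.
move: (H1 (cre h)) (H2 (cim h)) (H3 (cim h)).
rewrite !add0r expR0 cos0 sin0 !mul1r mul0r !subr0.
move=> /(_ (le_lt_trans xn h1)) X1 /(_ (le_lt_trans yn h2)) X2 /(_ (le_lt_trans yn h3)) X3.
apply: le_trans (cabs_le_creim _) _.
rewrite !creB !cimB creM cimM /= mul0r subr0 mul0r addr0 subr0.
move: (cabs h) n0 xn yn h4 h5 X1 X2 X3 {h1 h2 h3 H1 H2 H3} => n n0 xn yn n1 n32.
set E := expR _; set c := cos _; set s := sin _; set x := cre h; set y := cim h.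
rewrite -/x -/y in xn yn *.
have A (b : R) : `|b| <= n -> a * `|b| <= a * n by move=> ?; rewrite ler_wpM2l// ltW.
move=> /le_trans/(_ (A _ xn)) X1 /le_trans/(_ (A _ yn)) X2 /le_trans/(_ (A _ yn)) X3.
have an : a * n <= n by rewrite ler_piMl.
have an8 : a * n <= e / 8 * n by rewrite ler_wpM2r.
have E1 : `|E - 1| <= 2 * n.
  have -> : E - 1 = (E - 1 - x) + x by ring.
  apply: le_trans (ler_normD _ _) _; lra.
have s1 : `|s| <= 2 * n.
  have -> : s = (s - y) + y by ring.
  apply: le_trans (ler_normD _ _) _; lra.
have P1 : `|E - 1| * `|c - 1| <= 2 * n * (a * n) by rewrite ler_pM.
have P2 : `|E - 1| * `|s| <= 2 * n * (2 * n) by rewrite ler_pM.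
have P3 : n * (a * n) <= a * n.
  by rewrite ler_piMl// ?mulr_ge0// ltW.
have P4 : n * n <= e / 32 * n by rewrite ler_wpM2r// ltW.
have c2 : `|E * c - 1 - x| <= e / 8 * n + e / 8 * n + `|E - 1| * `|c - 1|.
  have -> : E * c - 1 - x = (E - 1 - x) + (c - 1) + (E - 1) * (c - 1) by ring.
  apply: le_trans (ler_normD _ _) _; rewrite normrM lerD2r.
  apply: le_trans (ler_normD _ _) _; lra.
have s2 : `|E * s - y| <= e / 8 * n + `|E - 1| * `|s|.
  have -> : E * s - y = (s - y) + (E - 1) * s by ring.
  apply: le_trans (ler_normD _ _) _; rewrite normrM lerD2r; lra.
have en0 : 0 <= e * n by rewrite mulr_ge0// ltW.
lra.
Qed.

Lemma cdiff_expC z : cdiff expC z (expC z).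
Proof.
have H : cdiff (fun w => w - z) z 1.
  by rewrite -[1]subr0; apply: cdiffB; [exact: cdiff_id|exact: cdiff_cst].
have := cdiffMl (expC z) (cdiff_comp H (d := 1) _).
rewrite subrr !mulr1 => /(_ _ cdiff_expC0).
by apply: cdiff_ext => w; rewrite -expCD addrC subrK.
Qed.
End Exp.

(** * Bisection, the mean value inequality and antiderivatives *)

Section Bisection.
Variable R : realType.
Implicit Types (x y s a b e q : R).

Lemma expr_small q e : 0 <= q < 1 -> 0 < e -> exists N, forall n, (N <= n)%N -> q ^+ n < e.
Proof.
move=> /andP[q0 q1] e0.
have : `|q| < 1 by rewrite ger0_norm.
move=> /cvg_expr/cvgrPdist_lt/(_ e e0)[N _ H].
exists N => n /H /=; rewrite sub0r normrN ger0_norm//.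
by rewrite exprn_ge0.
Qed.

(** Bisection principle on squares: a property that holds for a square as soon
    as it holds for its four quarters, and for all small squares near each
    point, holds for every square; otherwise a nested sequence of bad quarters
    would shrink to a point.  It replaces compactness throughout, from Goursat's
    theorem to the finiteness of zeros. *)
Lemma square_ind (P : R -> R -> R -> Prop) (x y s : R) :
  0 < s ->
  (forall x y s, 0 < s -> P x y s -> P (x + s) y s -> P x (y + s) s ->
     P (x + s) (y + s) s -> P x y (s + s)) ->
  (forall a b, x <= a <= x + s -> y <= b <= y + s ->
     exists2 dl : R, 0 < dl & forall x y s, 0 < s < dl ->
     x <= a <= x + s -> y <= b <= y + s -> P x y s) ->
  P x y s.
Proof.
move=> s0 Psplit Ploc; apply: contrapT => nP.
pose bad (p : R * R * R) := 0 < p.2 /\ ~ P p.1.1 p.1.2 p.2.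
pose sub (p p' : R * R * R) := [/\ p'.2 = p.2 / 2,
   p.1.1 <= p'.1.1, p'.1.1 + p'.2 <= p.1.1 + p.2, p.1.2 <= p'.1.2 &
   p'.1.2 + p'.2 <= p.1.2 + p.2].
have step p : exists p', bad p -> bad p' /\ sub p p'.
  have [bp|] := pselect (bad p); last by exists p.
  case: p bp => [[u v] r] [/= r0 npr].
  have r20 : 0 < r / 2 by rewrite divr_gt0.
  have [H1|H1] := pselect (P u v (r / 2)); last first.
    by exists (u, v, r / 2) => _; split; split => //=; lra.
  have [H2|H2] := pselect (P (u + r / 2) v (r / 2)); last first.
    by exists (u + r / 2, v, r / 2) => _; split; split => //=; lra.
  have [H3|H3] := pselect (P u (v + r / 2) (r / 2)); last first.
    by exists (u, v + r / 2, r / 2) => _; split; split => //=; lra.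
  have [H4|H4] := pselect (P (u + r / 2) (v + r / 2) (r / 2)); last first.
    by exists (u + r / 2, v + r / 2, r / 2) => _; split; split => //=; lra.
  by case: npr; rewrite [r]splitr; apply: Psplit.
have [nxt Hn] := choice step.
pose S n := iter n nxt (x, y, s).
have Sbad n : bad (S n).
  by elim: n => [|n IH] //; have [] := Hn (S n) IH.
have Ssub n : sub (S n) (S n.+1) by have [_] := Hn (S n) (Sbad n).
have Ss n : (S n).2 = s * 2^-1 ^+ n.
  by elim: n => [|n IH]; [rewrite mulr1|have [-> _ _ _ _] := Ssub n; rewrite IH exprSr mulrA].
have Smono n k : [/\ (S n).1.1 <= (S (n + k)%N).1.1,
    (S (n + k)%N).1.1 + (S (n + k)%N).2 <= (S n).1.1 + (S n).2,
    (S n).1.2 <= (S (n + k)%N).1.2 &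
    (S (n + k)%N).1.2 + (S (n + k)%N).2 <= (S n).1.2 + (S n).2].
  elim: k => [|k [h1 h2 h3 h4]]; first by rewrite addn0.
  rewrite addnS; have [_ g1 g2 g3 g4] := Ssub (n + k)%N.
  by split; [exact: le_trans h1 g1|exact: le_trans g2 h2|exact: le_trans h3 g3|exact: le_trans g4 h4].
have spos n : 0 < (S n).2 by have [] := Sbad n.
have cross m n : (S m).1.1 <= (S n).1.1 + (S n).2 /\ (S m).1.2 <= (S n).1.2 + (S n).2.
  have [/subnKC mn|/ltnW/subnKC nm] := leqP m n.
    have [h1 h2 h3 h4] := Smono m (n - m)%N; rewrite mn in h1 h2 h3 h4.
    by have := spos n; split; lra.
  have [h1 h2 h3 h4] := Smono n (m - n)%N; rewrite nm in h1 h2 h3 h4.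
  by have := spos m; split; lra.
pose X := range (fun n => (S n).1.1); pose Y := range (fun n => (S n).1.2).
pose a := sup X; pose b := sup Y.
have supX : has_sup X.
  split; first by exists (S 0%N).1.1, 0%N.
  by exists ((S 0%N).1.1 + (S 0%N).2) => _ [n _ <-]; case: (cross n 0%N).
have supY : has_sup Y.
  split; first by exists (S 0%N).1.2, 0%N.
  by exists ((S 0%N).1.2 + (S 0%N).2) => _ [n _ <-]; case: (cross n 0%N).
have aP n : (S n).1.1 <= a <= (S n).1.1 + (S n).2.
  apply/andP; split; first by apply: ub_le_sup; [case: supX|exists n].
  apply: ge_sup; first by case: supX.
  by move=> _ [m _ <-]; case: (cross m n).
have bP n : (S n).1.2 <= b <= (S n).1.2 + (S n).2.
  apply/andP; split; first by apply: ub_le_sup; [case: supY|exists n].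
  apply: ge_sup; first by case: supY.
  by move=> _ [m _ <-]; case: (cross m n).
have [dl dl0 Hdl] := Ploc a b (aP 0%N) (bP 0%N).
have [N HN] : exists N, forall n, (N <= n)%N -> 2^-1 ^+ n < dl / s.
  by apply: expr_small; [lra|rewrite divr_gt0].
case: (Sbad N) => sN; apply; apply: Hdl => //.
by rewrite sN Ss mulrC -ltr_pdivlMr// HN.
Qed.
End Bisection.

Section Antiderivative.
Variable R : realType.
Local Notation K := (C R).
Implicit Types (x y s a b e t M : R) (u v U V : R -> R).

Definition rcont u := forall x e, 0 < e -> exists2 dl : R, 0 < dl &
  forall y, `|y - x| < dl -> `|u y - u x| < e.

Lemma rcont_continuous u : rcont u -> continuous u.
Proof.
move=> H x; apply/cvgrPdist_lt => e e0.
have [dl dl0 Hd] := H x e e0.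
apply/nbhs_ballP; exists dl => // y; rewrite /ball /= distrC => /Hd.
by rewrite distrC.
Qed.

Lemma is_derive_within U u a b : (forall x, a <= x <= b -> is_derive x 1 U (u x)) ->
  {within `[a, b], continuous U}.
Proof.
move=> H; apply: derivable_within_continuous => x; rewrite in_itv /= => xab.
by have [] := H x xab.
Qed.

(** A mean is bounded by a bound of the function; this is how all integral
    estimates below are made. *)
Lemma mvt_le U u a b M : a <= b -> (forall x, a <= x <= b -> is_derive x 1 U (u x)) ->
  (forall x, a <= x <= b -> u x <= M) -> U b - U a <= M * (b - a).
Proof.
move=> ab dU uM.
have dU' x : x \in `]a, b[ -> is_derive x 1 U (u x).
  by move=> xab; apply: dU; move: xab; rewrite in_itv /= => /andP[/ltW -> /ltW ->].
have [c cab ->] := MVT_segment ab dU' (is_derive_within dU).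
by rewrite ler_wpM2r ?subr_ge0// uM//; rewrite in_itv in cab.
Qed.

Lemma mvt_ge U u a b M : a <= b -> (forall x, a <= x <= b -> is_derive x 1 U (u x)) ->
  (forall x, a <= x <= b -> M <= u x) -> M * (b - a) <= U b - U a.
Proof.
move=> ab dU uM.
have dU' x : x \in `]a, b[ -> is_derive x 1 U (u x).
  by move=> xab; apply: dU; move: xab; rewrite in_itv /= => /andP[/ltW -> /ltW ->].
have [c cab ->] := MVT_segment ab dU' (is_derive_within dU).
by rewrite ler_wpM2r ?subr_ge0// uM//; rewrite in_itv in cab.
Qed.

Lemma antiderivative_diff U V u a b x y : a <= x <= b -> a <= y <= b ->
  (forall x, a <= x <= b -> is_derive x 1 U (u x)) ->
  (forall x, a <= x <= b -> is_derive x 1 V (u x)) -> U y - U x = V y - V x.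
Proof.
wlog xy : x y / x <= y.
  move=> H xab yab dU dV; have [xy|/ltW yx] := leP x y; first exact: H.
  by have := H y x yx yab xab dU dV; lra.
move=> xab yab dU dV.
have W t : x <= t <= y -> is_derive t 1 (fun t => U t - V t) 0.
  move=> txy; have tab : a <= t <= b by lra.
  rewrite -(subrr (u t)); have dUt := dU t tab; have dVt := dV t tab.
  exact: is_deriveB.
have H1 := @mvt_le (fun t => U t - V t) (fun=> 0) x y 0 xy W (fun _ _ => lexx _).
have H2 := @mvt_ge (fun t => U t - V t) (fun=> 0) x y 0 xy W (fun _ _ => lexx _).
by move: H1 H2; rewrite /= !mul0r; lra.
Qed.

Lemma antiderivative_local u M : rcont u -> 0 < M ->
  exists U, forall x, - M <= x <= M -> is_derive x 1 U (u x).
Proof.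
move=> /rcont_continuous cu M0.
exists (fun x => \int[@lebesgue_measure R]_(t in `[- M - 1, x]) u t) => x xM.
have [||||dF Fx] := @continuous_FTC1_closed R u (- M - 1) x (M + 1).
- by lra.
- apply: continuous_compact_integrable; first exact: segment_compact.
  by apply: continuous_subspaceT => ?; exact: cu.
- by lra.
- exact: cu.
by rewrite -Fx derive1E; apply: DeriveDef.
Qed.

(** Antiderivatives on growing bounded intervals, normalized at 0, fit
    together. *)
Lemma antiderivative u : rcont u -> exists U, forall x, is_derive x 1 U (u x).
Proof.
move=> cu.
have H n : exists U, forall x, - n.+1%:R <= x <= n.+1%:R -> is_derive x 1 U (u x).
  by apply: antiderivative_local.
have [W HW] := choice H.
pose U x := let n := Num.truncn `|x| in W n x - W n 0.
have UE n x : `|x| <= n.+1%:R -> U x = W n x - W n 0.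
  move=> xn; rewrite /U; set m := Num.truncn `|x|.
  have xm : `|x| <= m.+1%:R by exact/ltW/truncnS_gt.
  move: xn xm; rewrite !ler_norml => xn xm.
  have [mn|/ltnW nm] := leqP m n.
    have mnR : m.+1%:R <= n.+1%:R :> R by rewrite ler_nat.
    have m0 : 0 <= m.+1%:R :> R by [].
    have dn t : - m.+1%:R <= t <= m.+1%:R -> is_derive t 1 (W n) (u t).
      by move=> tm; apply: HW; lra.
    have z0 : - m.+1%:R <= (0 : R) <= m.+1%:R by lra.
    exact: antiderivative_diff z0 xm (HW m) dn.
  have mnR : n.+1%:R <= m.+1%:R :> R by rewrite ler_nat.
  have m0 : 0 <= n.+1%:R :> R by [].
  have dm t : - n.+1%:R <= t <= n.+1%:R -> is_derive t 1 (W m) (u t).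
    by move=> tm; apply: HW; lra.
  have z0 : - n.+1%:R <= (0 : R) <= n.+1%:R by lra.
  exact: antiderivative_diff z0 xn dm (HW n).
exists U => x.
pose n := (Num.truncn `|x|).+1.
have xn : `|x| < n%:R by exact: truncnS_gt.
have dW : is_derive x 1 (W n) (u x).
  apply: HW; rewrite -ler_norml; apply: (le_trans (ltW xn)).
  by rewrite ler_nat.
move: dW => /is_derive_epsR H'; apply/is_derive_epsR => e e0.
have [dl dl0 Hd] := H' e e0; exists (Num.min 1 dl).
  by rewrite lt_min ltr01.
move=> h; rewrite lt_min => /andP[h1 h2].
rewrite !(UE n); first by rewrite (_ : W n (x + h) - W n 0 - (W n x - W n 0) = W n (x + h) - W n x); [exact: Hd|ring].
  by rewrite (le_trans (ltW xn))// ler_nat.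
apply: le_trans (ler_normD _ _) _; rewrite -natr1; apply: lerD; exact: ltW.
Qed.

(** A chosen antiderivative, so that the integral of a continuous function is
    an increment, additive in its end points by definition. *)
Definition prim u : R -> R := xget (fun=> 0) [set U | forall x, is_derive x 1 U (u x)].

Lemma prim_derive u : rcont u -> forall x, is_derive x 1 (prim u) (u x).
Proof. by move=> /antiderivative[U HU]; rewrite /prim; case: xgetP => [V _ //|/(_ U)]. Qed.

Definition rint u a b := prim u b - prim u a.

Lemma rint_eq u U a b : rcont u -> (forall x, is_derive x 1 U (u x)) ->
  rint u a b = U b - U a.
Proof.
move=> cu HU; pose m := Num.min a b; pose M := Num.max a b.
apply: (@antiderivative_diff _ _ u m M) => //.
- by rewrite /m /M ge_min le_max !lexx.
- by rewrite /m /M ge_min le_max !lexx !orbT.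
- by move=> x _; exact: prim_derive.
Qed.

Lemma rint_bound u a b M : rcont u ->
  (forall x, (a <= x <= b) || (b <= x <= a) -> `|u x| <= M) ->
  `|rint u a b| <= M * `|b - a|.
Proof.
move=> cu; wlog ab : a b / a <= b.
  move=> H Hu; have [ab|/ltW ba] := leP a b; first exact: H.
  have := H b a ba; rewrite distrC /rint (distrC b); apply.
  by move=> x xx; apply: Hu; rewrite orbC.
move=> Hu; rewrite (@ger0_norm _ (b - a)) ?subr_ge0//.
have dU x (_ : a <= x <= b) := prim_derive cu x.
have HM x : a <= x <= b -> - M <= u x <= M.
  by move=> xab; rewrite -ler_norml; apply: Hu; rewrite xab.
have h1 := mvt_ge ab dU (fun x xab => proj1 (andP (HM x xab))).
have h2 := mvt_le ab dU (fun x xab => proj2 (andP (HM x xab))).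
by rewrite ler_norml -mulNr /rint h1 h2.
Qed.

Implicit Types (p q : R -> K) (c : K).
Definition pcont p := forall x e, 0 < e -> exists2 dl : R, 0 < dl &
  forall y, `|y - x| < dl -> cabs (p y - p x) < e.

Lemma pcont_re p : pcont p -> rcont (fun t => cre (p t)).
Proof.
move=> H x e e0; have [dl dl0 Hd] := H x e e0; exists dl => // y /Hd.
by apply: le_lt_trans; rewrite -creB cre_le.
Qed.
Lemma pcont_im p : pcont p -> rcont (fun t => cim (p t)).
Proof.
move=> H x e e0; have [dl dl0 Hd] := H x e e0; exists dl => // y /Hd.
by apply: le_lt_trans; rewrite -cimB cim_le.
Qed.

Definition cint p a b : K :=
  Complex (rint (fun t => cre (p t)) a b) (rint (fun t => cim (p t)) a b).

Lemma cint_add p a b e : cint p a b + cint p b e = cint p a e.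
Proof. by apply: creim_eq; rewrite ?creD ?cimD /= /rint; ring. Qed.
Lemma cint_sym p a b : cint p b a = - cint p a b.
Proof. by apply: creim_eq; rewrite ?creN ?cimN /= /rint; ring. Qed.
Lemma cint_id p a : cint p a a = 0.
Proof. by apply: creim_eq; rewrite /= /rint subrr. Qed.

Lemma cint_eq p q a b : pcont p -> (forall t, pdiff q t (p t)) ->
  cint p a b = q b - q a.
Proof.
move=> cp dq; apply: creim_eq; rewrite ?creB ?cimB /=.
  exact: (rint_eq a b (pcont_re cp) (fun t => pdiff_cre (dq t))).
exact: (rint_eq a b (pcont_im cp) (fun t => pdiff_cim (dq t))).
Qed.

(** The constant 2 comes from estimating real and imaginary parts separately. *)
Lemma cint_bound p a b M : pcont p ->
  (forall x, (a <= x <= b) || (b <= x <= a) -> cabs (p x) <= M) ->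
  cabs (cint p a b) <= 2 * M * `|b - a|.
Proof.
move=> cp Hp; apply: le_trans (cabs_le_creim _) _ => /=.
rewrite mulrAC mulr_natl mulrnAl mulr2n mulrC; apply: lerD; rewrite rint_bound//.
- exact: pcont_re.
- by move=> x /Hp; apply: le_trans; exact: cre_le.
- exact: pcont_im.
- by move=> x /Hp; apply: le_trans; exact: cim_le.
Qed.

Lemma cint_anti p : pcont p -> forall t,
  pdiff (fun t => Complex (prim (fun t => cre (p t)) t) (prim (fun t => cim (p t)) t)) t (p t).
Proof.
move=> cp t; rewrite [p t](_ : _ = Complex (cre (p t)) (cim (p t))); last by case: (p t).
by apply: pdiff_Complex; apply: prim_derive; [exact: pcont_re|exact: pcont_im].
Qed.

Lemma pcontB p q : pcont p -> pcont q -> pcont (fun t => p t - q t).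
Proof.
move=> cp cq x e e0.
have e20 : 0 < e / 2 by rewrite divr_gt0.
have [d1 d10 H1] := cp x _ e20; have [d2 d20 H2] := cq x _ e20.
exists (Num.min d1 d2); first by rewrite lt_min d10.
move=> y; rewrite lt_min => /andP[/H1 h1 /H2 h2].
have -> : p y - q y - (p x - q x) = (p y - p x) - (q y - q x) by ring.
by apply: le_lt_trans (cabsB _ _) _; rewrite [e]splitr ltrD.
Qed.

Lemma pcont_cst c : pcont (fun=> c).
Proof. by move=> x e e0; exists 1 => // y _; rewrite subrr cabs0. Qed.

Lemma pdiffB p q t c (d : K) : pdiff p t c -> pdiff q t d -> pdiff (fun t => p t - q t) t (c - d).
Proof.
move=> cp cq e e0.
have e20 : 0 < e / 2 by rewrite divr_gt0.
have [d1 d10 H1] := cp _ e20; have [d2 d20 H2] := cq _ e20.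
exists (Num.min d1 d2); first by rewrite lt_min d10.
move=> y; rewrite lt_min => /andP[/H1 h1 /H2 h2].
set A := (X in cabs X); have -> : A = (p (t + y) - p t - c * toC y) - (q (t + y) - q t - d * toC y).
  by rewrite /A; ring.
by apply: le_trans (cabsB _ _) _; rewrite [e in leRHS]splitr mulrDl lerD.
Qed.

Lemma cintB p q a b : pcont p -> pcont q ->
  cint (fun t => p t - q t) a b = cint p a b - cint q a b.
Proof.
move=> cp cq; rewrite (cint_eq _ _ _ (fun t => pdiffB (cint_anti cp t) (cint_anti cq t))).
  by apply: creim_eq; rewrite ?creB ?cimB /= /rint; ring.
exact: pcontB.
Qed.

Lemma pdiff_line c t : pdiff (fun t => c * toC t) t c.
Proof.
move=> e e0; exists 1 => // h _.
by rewrite toCD mulrDr [c * _ + _]addrC addrK subrr cabs0 mulr_ge0// ltW.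
Qed.

Lemma cint_cst c a b : cint (fun=> c) a b = c * toC (b - a).
Proof.
rewrite (cint_eq _ _ (pcont_cst c) (@pdiff_line c)) -mulrBr.
by rewrite toCD toCN.
Qed.
End Antiderivative.

(** * Goursat's theorem and primitives *)

Section Goursat.
Variable R : realType.
Local Notation K := (C R).
Implicit Types (x y s a b e t M : R) (z w h c d : K) (f g : K -> K).

Definition ccont f := forall z e, 0 < e -> exists2 dl : R, 0 < dl &
  forall w, cabs (w - z) < dl -> cabs (f w - f z) < e.

Definition iC : K := Complex 0 1.

Definition hint f y a b := cint (fun t => f (Complex t y)) a b.
Definition vint f x a b := cint (fun t => f (Complex x t)) a b.

(** The integral of f along the boundary of a rectangle, counterclockwise. *)
Definition boundary_int f x0 x1 y0 y1 :=
  hint f y0 x0 x1 - hint f y1 x0 x1 + iC * (vint f x1 y0 y1 - vint f x0 y0 y1).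
Local Notation J := boundary_int.

Lemma ComplexB a b x y : Complex a b - Complex x y = Complex (a - x) (b - y) :> K.
Proof. by []. Qed.
Lemma ComplexE a b : Complex a b = toC a + iC * toC b :> K.
Proof. by apply: creim_eq; rewrite ?creD ?cimD ?creM ?cimM /=; ring. Qed.
Lemma cabs_im x : cabs (Complex 0 x) = `|x|.
Proof. by rewrite /cabs /= expr0n add0r sqrtr_sqr. Qed.
Lemma cabs_iC : cabs iC = 1.
Proof. by rewrite cabs_im normr1. Qed.

Lemma pcont_h f y : ccont f -> pcont (fun t => f (Complex t y)).
Proof.
move=> cf x e e0; have [dl dl0 H] := cf (Complex x y) e e0.
by exists dl => // t xt; apply: H; rewrite ComplexB subrr -/(toC _) cabs_toC.
Qed.
Lemma pcont_v f x : ccont f -> pcont (fun t => f (Complex x t)).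
Proof.
move=> cf y e e0; have [dl dl0 H] := cf (Complex x y) e e0.
by exists dl => // t yt; apply: H; rewrite ComplexB subrr cabs_im.
Qed.

Lemma pdiff_h y t : pdiff (fun t => Complex t y : K) t 1.
Proof.
have := pdiff_Complex (is_derive_id t 1) (is_derive_cst y t 1).
exact.
Qed.
Lemma pdiff_v x t : pdiff (fun t => Complex x t : K) t iC.
Proof.
have := pdiff_Complex (is_derive_cst x t 1) (is_derive_id t 1).
exact.
Qed.

Lemma boundary_int_splitx f a b e y0 y1 : J f a e y0 y1 = J f a b y0 y1 + J f b e y0 y1.
Proof. rewrite /J /hint -!(cint_add _ a b e); ring. Qed.
Lemma boundary_int_splity f x0 x1 a b e : J f x0 x1 a e = J f x0 x1 a b + J f x0 x1 b e.
Proof. rewrite /J /vint -!(cint_add _ a b e); ring. Qed.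
Lemma boundary_int_symx f a b y0 y1 : J f b a y0 y1 = - J f a b y0 y1.
Proof. rewrite /J /hint !(cint_sym _ a b); ring. Qed.
Lemma boundary_int_symy f a b x0 x1 : J f x0 x1 b a = - J f x0 x1 a b.
Proof. rewrite /J /vint !(cint_sym _ a b); ring. Qed.

Lemma ccontB f g : ccont f -> ccont g -> ccont (fun z => f z - g z).
Proof.
move=> cp cq x e e0.
have e20 : 0 < e / 2 by rewrite divr_gt0.
have [d1 d10 H1] := cp x _ e20; have [d2 d20 H2] := cq x _ e20.
exists (Num.min d1 d2); first by rewrite lt_min d10.
move=> y; rewrite lt_min => /andP[/H1 h1 /H2 h2].
have -> : f y - g y - (f x - g x) = (f y - f x) - (g y - g x) by ring.
by apply: le_lt_trans (cabsB _ _) _; rewrite [e]splitr ltrD.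
Qed.

Lemma cdiff_ccont f : (forall z, exists d, cdiff f z d) -> ccont f.
Proof. by move=> H z e e0; have [d /cdiff_cont] := H z; apply. Qed.

Lemma cint_mull p a b c : pcont p -> cint (fun t => c * p t) a b = c * cint p a b.
Proof.
move=> cp; have [->|c0] := eqVneq c 0.
  have -> : (fun t => 0 * p t) = fun=> 0 by apply/funext => t; rewrite mul0r.
  by rewrite cint_cst !mul0r.
have ccp : pcont (fun t => c * p t).
  move=> t e e0; have c0' : 0 < cabs c by rewrite cabs_gt0.
  have [dl dl0 H] := cp t (e / cabs c) (divr_gt0 e0 c0').
  exists dl => // u /H; rewrite ltr_pdivlMr// -mulrBr cabsM mulrC.
  by [].
have dcp t := pdiff_comp (cint_anti cp t) (cdiffMl c (cdiff_id _)).
rewrite (@cint_eq _ _ (fun t => c * (Complex (prim (fun t => cre (p t)) t) (prim (fun t => cim (p t)) t) : K)) a b ccp).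
  rewrite -mulrBr; congr (_ * _).
by move=> t; have := dcp t; rewrite mulr1.
Qed.

Lemma boundary_int_exact f g x0 x1 y0 y1 : ccont f -> (forall z, cdiff g z (f z)) ->
  J f x0 x1 y0 y1 = 0.
Proof.
move=> cf dg.
have Hh y a b : hint f y a b = g (Complex b y) - g (Complex a y).
  apply: (@cint_eq _ _ (fun t => g (Complex t y))) => [|t]; first exact: pcont_h.
  by have := pdiff_comp (pdiff_h y t) (dg _); rewrite mulr1.
have Hv x a b : iC * vint f x a b = g (Complex x b) - g (Complex x a).
  rewrite /vint -cint_mull; last exact: pcont_v.
  apply: (@cint_eq _ _ (fun t => g (Complex x t))) => [|t].
    move=> t e e0; have [dl dl0 H] := pcont_v x cf t e0.
    by exists dl => // u ut; rewrite -mulrBr cabsM cabs_iC mul1r; exact: H.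
  by have := pdiff_comp (pdiff_v x t) (dg _); rewrite mulrC.
rewrite /J mulrBr !Hh !Hv; ring.
Qed.

Lemma boundary_int_sub f g x0 x1 y0 y1 : ccont f -> ccont g ->
  J (fun z => f z - g z) x0 x1 y0 y1 = J f x0 x1 y0 y1 - J g x0 x1 y0 y1.
Proof.
move=> cf cg; rewrite /J /hint /vint !cintB; first ring.
all: by [exact: pcont_h|exact: pcont_v].
Qed.

Lemma boundary_int_bound f x0 x1 y0 y1 M : ccont f -> x0 <= x1 -> y0 <= y1 ->
  (forall x y, x0 <= x <= x1 -> y0 <= y <= y1 -> cabs (f (Complex x y)) <= M) ->
  cabs (J f x0 x1 y0 y1) <= 4 * M * ((x1 - x0) + (y1 - y0)).
Proof.
move=> cf x01 y01 HM.
have sub0 a b x : a <= b -> (a <= x <= b) || (b <= x <= a) -> a <= x <= b.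
  by move=> ? /orP[|]; lra.
have Hh y : y0 <= y <= y1 -> cabs (hint f y x0 x1) <= 2 * M * (x1 - x0).
  move=> yy; have := @cint_bound _ _ x0 x1 M (pcont_h y cf) _.
  rewrite (@ger0_norm _ (x1 - x0)) ?subr_ge0//; apply => x /(sub0 _ _ _ x01) xx; exact: HM.
have Hv x : x0 <= x <= x1 -> cabs (vint f x y0 y1) <= 2 * M * (y1 - y0).
  move=> xx; have := @cint_bound _ _ y0 y1 M (pcont_v x cf) _.
  rewrite (@ger0_norm _ (y1 - y0)) ?subr_ge0//; apply => y /(sub0 _ _ _ y01) yy; exact: HM.
have h1 := Hh y0 _; have h2 := Hh y1 _; have v1 := Hv x0 _; have v2 := Hv x1 _.
rewrite /J; apply: le_trans (cabsD _ _) _; rewrite cabsM cabs_iC mul1r mulrDr.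
apply: lerD; apply: le_trans (cabsB _ _) _.
  have : cabs (hint f y0 x0 x1) <= 2 * M * (x1 - x0) by apply: Hh; lra.
  have : cabs (hint f y1 x0 x1) <= 2 * M * (x1 - x0) by apply: Hh; lra.
  by lra.
have : cabs (vint f x0 y0 y1) <= 2 * M * (y1 - y0) by apply: Hv; lra.
have : cabs (vint f x1 y0 y1) <= 2 * M * (y1 - y0) by apply: Hv; lra.
by lra.
Qed.

Lemma boundary_int_affine c d x0 x1 y0 y1 : J (fun z => c + d * z) x0 x1 y0 y1 = 0.
Proof.
apply: (@boundary_int_exact _ (fun z => c * z + d / 2 * (z * z))).
  apply: cdiff_ccont => z; exists (0 + d * 1).
  by apply: cdiffD; [exact: cdiff_cst|apply: cdiffMl; exact: cdiff_id].
move=> z.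
have -> : c + d * z = c * 1 + d / 2 * (1 * z + z * 1) by field.
apply: cdiffD; first by apply: cdiffMl; exact: cdiff_id.
by apply: cdiffMl; apply: cdiffM; exact: cdiff_id.
Qed.

(** Near a point of differentiability f is an affine function, which has a
    primitive, plus an error that is small compared with the side. *)
Lemma boundary_int_local f z0 d e : ccont f -> cdiff f z0 d -> 0 < e ->
  exists2 dl : R, 0 < dl & forall x0 x1 y0 y1, x0 <= cre z0 <= x1 -> y0 <= cim z0 <= y1 ->
    (x1 - x0) + (y1 - y0) < dl ->
    cabs (J f x0 x1 y0 y1) <= 4 * e * ((x1 - x0) + (y1 - y0)) ^+ 2.
Proof.
move=> cf df e0; have [dl dl0 H] := df e e0; exists dl => // x0 x1 y0 y1 xz yz D.
have caff : ccont (fun z => (f z0 - d * z0) + d * z).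
  apply: cdiff_ccont => z; exists (0 + d * 1).
  by apply: cdiffD; [exact: cdiff_cst|apply: cdiffMl; exact: cdiff_id].
have -> : J f x0 x1 y0 y1 = J (fun z => f z - ((f z0 - d * z0) + d * z)) x0 x1 y0 y1.
  by rewrite boundary_int_sub// boundary_int_affine subr0.
rewrite expr2 mulrA -[4 * e * _]mulrA.
apply: boundary_int_bound; [exact: ccontB|lra|lra|].
move=> x y xx yy; set w := Complex x y.
have wz : cabs (w - z0) <= (x1 - x0) + (y1 - y0).
  apply: le_trans (cabs_le_creim _) _; rewrite creB cimB /=.
  by apply: lerD; rewrite ler_norml; lra.
have -> : f w - (f z0 - d * z0 + d * w) = f (z0 + (w - z0)) - f z0 - d * (w - z0).
  by rewrite [z0 + _]addrC subrK; ring.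
apply: le_trans (H _ (le_lt_trans wz D)) _.
by rewrite ler_wpM2l// ltW.
Qed.

(** A scaling of the second coordinate turns rectangles into squares.  The bound
    by e times the square of the side passes from the four quarters to a square
    and holds locally, hence, by bisection, everywhere. *)
Lemma goursat f x0 x1 y0 y1 : ccont f -> x0 <= x1 -> y0 <= y1 ->
  (forall x y, x0 <= x <= x1 -> y0 <= y <= y1 -> exists d, cdiff f (Complex x y) d) ->
  J f x0 x1 y0 y1 = 0.
Proof.
move=> cf; rewrite le_eqVlt => /orP[/eqP <-|x01].
  by rewrite /J /hint !cint_id !subrr mulr0 addr0.
rewrite le_eqVlt => /orP[/eqP <-|y01].
  by rewrite /J /vint !cint_id !subrr mulr0 addr0.
move=> df.
pose k := (y1 - y0) / (x1 - x0).
have k0 : 0 < k by rewrite divr_gt0 ?subr_gt0.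
have Hs e : 0 < e -> cabs (J f x0 x1 y0 y1) <= e * (x1 - x0) ^+ 2.
  move=> e0.
  pose P x y s := cabs (J f x (x + s) (k * y) (k * (y + s))) <= e * s ^+ 2.
  suff : P x0 (y0 / k) (x1 - x0).
    rewrite /P [x0 + _]addrC subrK mulrDr [k * (y0 / k)]mulrC divfK ?gt_eqF//.
    rewrite [k * (_ - _)]divfK; last by rewrite gt_eqF ?subr_gt0.
    by rewrite [y0 + _]addrC subrK.
  apply: (@square_ind R P); first by rewrite subr_gt0.
  - rewrite /P => x y s s0 H1 H2 H3 H4.
    rewrite !addrA (boundary_int_splitx f x (x + s)) (boundary_int_splity f x (x + s) _ (k * (y + s))).
    rewrite (boundary_int_splity f (x + s) _ _ (k * (y + s))).
    apply: le_trans (cabsD _ _) _.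
    apply: le_trans (lerD (cabsD _ _) (cabsD _ _)) _.
    have -> : e * (s + s) ^+ 2 = e * s ^+ 2 + e * s ^+ 2 + (e * s ^+ 2 + e * s ^+ 2) by ring.
    by apply: lerD; apply: lerD.
  - move=> a b axx bxx.
    have [d fd] : exists d, cdiff f (Complex a (k * b)) d.
      apply: df; first by move: axx; lra.
      move: bxx => /andP[b1 b2]; rewrite mulrC -ler_pdivrMr// b1 /=.
      rewrite -ler_pdivlMr//; apply: le_trans b2 _.
      rewrite le_eqVlt; apply/orP; left; apply/eqP.
      by rewrite /k; field; rewrite ?subr_eq0 ?gt_eqF.
    have e'0 : 0 < e / (4 * (1 + k) ^+ 2) by rewrite divr_gt0// mulr_gt0// exprn_gt0// addr_gt0.
    have [dl dl0 H] := boundary_int_local cf fd e'0.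
    exists (dl / (1 + k)); first by rewrite divr_gt0// addr_gt0.
    move=> x y s /andP[s0]; rewrite ltr_pdivlMr ?addr_gt0// => sdl xa yb.
    rewrite /P; have := H x (x + s) (k * y) (k * (y + s)) xa _ _.
    have -> : x + s - x + (k * (y + s) - k * y) = s * (1 + k) by ring.
    have -> : 4 * (e / (4 * (1 + k) ^+ 2)) * (s * (1 + k)) ^+ 2 = e * s ^+ 2.
      by field; rewrite gt_eqF// addr_gt0.
    apply => //.
    by rewrite /= !ler_pM2l.
apply/eqP; rewrite -cabs_eq0 eq_le cabs_ge0 andbT.
apply/ler_addgt0Pl => e e0; rewrite addr0.
have x0' : 0 < (x1 - x0) ^+ 2 by rewrite exprn_gt0 // subr_gt0.
by have := Hs _ (divr_gt0 e0 x0'); rewrite divfK// gt_eqF.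
Qed.

(** Cutting the rectangle around the exceptional point leaves a rectangle of
    arbitrarily small perimeter, on which f is bounded. *)
Lemma goursat_but_one f z0 x0 x1 y0 y1 : ccont f -> x0 <= x1 -> y0 <= y1 ->
  (forall z, z != z0 -> exists d, cdiff f z d) ->
  J f x0 x1 y0 y1 = 0.
Proof.
move=> cf x01 y01 df.
have zero x0' x1' y0' y1' : x0' <= x1' -> y0' <= y1' ->
    [|| cre z0 < x0', x1' < cre z0, cim z0 < y0' | y1' < cim z0] -> J f x0' x1' y0' y1' = 0.
  move=> xx yy H; apply: goursat => // x y xi yi; apply: df; apply/eqP => E.
  by move: H; rewrite -E /=; case/or4P; lra.
have [dl dl0 H] := cf z0 1 ltr01.
pose M := cabs (f z0) + 1.
have M0 : 0 < M by rewrite ltr_wpDl// cabs_ge0.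
have [ain|aout] := boolP (x0 <= cre z0 <= x1); last first.
  by apply: zero => //; move: aout; rewrite negb_and -!ltNge => /orP[->//|->]; rewrite orbT.
have [bin|bout] := boolP (y0 <= cim z0 <= y1); last first.
  by apply: zero => //; move: bout; rewrite negb_and -!ltNge => /orP[->|->]; rewrite !orbT.
have Hs e : 0 < e < dl -> cabs (J f x0 x1 y0 y1) <= 4 * M * e.
  move=> /andP[e0 edl].
  pose n := e / 4.
  have n0 : 0 < n by rewrite divr_gt0.
  have H1 : J f x0 (Num.max x0 (cre z0 - n)) y0 y1 = 0.
    case: (leP x0 (cre z0 - n)) => h; last by rewrite /J /hint !cint_id !subrr mulr0 addr0.
    by apply: zero => //; apply/or4P; apply: Or42; lra.
  have H2 : J f (Num.min x1 (cre z0 + n)) x1 y0 y1 = 0.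
    case: (leP x1 (cre z0 + n)) => h; first by rewrite /J /hint !cint_id !subrr mulr0 addr0.
    by apply: zero; rewrite ?(ltW h)//; apply/or4P; apply: Or41; lra.
  rewrite (boundary_int_splitx f x0 (Num.max x0 (cre z0 - n))) H1 add0r.
  rewrite (boundary_int_splitx f _ (Num.min x1 (cre z0 + n))) H2 addr0.
  have : Num.max x0 (cre z0 - n) <= cre z0 by rewrite ge_max; move: ain; lra.
  have : cre z0 <= Num.min x1 (cre z0 + n) by rewrite le_min; move: ain; lra.
  have : cre z0 - n <= Num.max x0 (cre z0 - n) by rewrite le_max lexx orbT.
  have : Num.min x1 (cre z0 + n) <= cre z0 + n by rewrite ge_min lexx orbT.
  move: (Num.max _ _) (Num.min _ _) => c1 c2 h1 h2 h3 h4.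
  have H3 : J f c1 c2 y0 (Num.max y0 (cim z0 - n)) = 0.
    case: (leP y0 (cim z0 - n)) => h; last by rewrite /J /vint !cint_id !subrr mulr0 addr0.
    by apply: zero => //; [lra|apply/or4P; apply: Or44; lra].
  have H4 : J f c1 c2 (Num.min y1 (cim z0 + n)) y1 = 0.
    case: (leP y1 (cim z0 + n)) => h; first by rewrite /J /vint !cint_id !subrr mulr0 addr0.
    by apply: zero; [lra|exact: ltW|apply/or4P; apply: Or43; lra].
  rewrite (boundary_int_splity f _ _ y0 (Num.max y0 (cim z0 - n))) H3 add0r.
  rewrite (boundary_int_splity f _ _ _ (Num.min y1 (cim z0 + n))) H4 addr0.
  have : Num.max y0 (cim z0 - n) <= cim z0 by rewrite ge_max; move: bin; lra.
  have : cim z0 <= Num.min y1 (cim z0 + n) by rewrite le_min; move: bin; lra.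
  have : cim z0 - n <= Num.max y0 (cim z0 - n) by rewrite le_max lexx orbT.
  have : Num.min y1 (cim z0 + n) <= cim z0 + n by rewrite ge_min lexx orbT.
  move: (Num.max _ _) (Num.min _ _) => d1 d2 k1 k2 k3 k4.
  have Mb : cabs (J f c1 c2 d1 d2) <= 4 * M * (c2 - c1 + (d2 - d1)).
    apply: boundary_int_bound => //; [lra|lra|] => x y xx yy.
    have fz : cabs (f (Complex x y) - f z0) < 1.
      apply: H; apply: le_lt_trans edl; apply: le_trans (cabs_le_creim _) _.
      rewrite creB cimB /= (splitr e); apply: lerD; rewrite ler_norml; move: n0; rewrite /n in h1 h2 h3 h4 k1 k2 k3 k4 *; lra.
    rewrite -(subrK (f z0) (f _)); apply: le_trans (cabsD _ _) _.
    by rewrite /M addrC lerD2l ltW.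
  apply: le_trans Mb _; rewrite ler_wpM2l//; first by rewrite mulr_ge0// ltW.
  by rewrite /n in h1 h2 h3 h4 k1 k2 k3 k4 *; lra.
apply/eqP; rewrite -cabs_eq0 eq_le cabs_ge0 andbT.
apply/ler_addgt0Pl => e e0; rewrite addr0.
have := Hs (Num.min (dl / 2) (e / (4 * M))) _.
have h1 : Num.min (dl / 2) (e / (4 * M)) <= e / (4 * M) by rewrite ge_min lexx orbT.
have h2 : Num.min (dl / 2) (e / (4 * M)) <= dl / 2 by rewrite ge_min lexx.
have h3 : 0 < Num.min (dl / 2) (e / (4 * M)) by rewrite lt_min !divr_gt0// mulr_gt0.
rewrite h3 (le_lt_trans h2) ?ltr_pdivrMr// ?mulr_natr ?mulr2n ?ltrDl// => /(_ isT).
move=> /le_trans; apply.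
by rewrite -ler_pdivlMl ?mulr_gt0// [_^-1 * e]mulrC.
Qed.

(** The primitive is integrated along the horizontal, then the vertical
    segment; the rectangle theorem makes its increments local. *)
Lemma primitive f z0 : ccont f -> (forall z, z != z0 -> exists d, cdiff f z d) ->
  exists g, forall z, cdiff g z (f z).
Proof.
move=> cf df.
have J0 x0 x1 y0 y1 : J f x0 x1 y0 y1 = 0.
  wlog x01 : x0 x1 / x0 <= x1.
    move=> HH; have [x01|/ltW x10] := leP x0 x1; first exact: HH.
    by rewrite boundary_int_symx HH// oppr0.
  wlog y01 : y0 y1 / y0 <= y1.
    move=> HH; have [y01|/ltW y10] := leP y0 y1; first exact: HH.
    by rewrite boundary_int_symy HH// oppr0.
  exact: goursat_but_one df.
exists (fun z => hint f 0 0 (cre z) + iC * vint f (cre z) 0 (cim z)) => z e e0.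
have [dl dl0 H] := cf z (e / 4) (divr_gt0 e0 (ltr0n _ 4)).
exists (dl / 2); first by rewrite divr_gt0.
move=> h hdl; set x := cre z; set y := cim z; rewrite creD cimD -/x -/y.
set a := cre h; set b := cim h.
have E : hint f 0 0 (x + a) + iC * vint f (x + a) 0 (y + b) - (hint f 0 0 x + iC * vint f x 0 y)
   = hint f y x (x + a) + iC * vint f (x + a) y (y + b).
  have := J0 x (x + a) 0 y; rewrite /J => /eqP.
  rewrite addr_eq0 => /eqP EJ.
  rewrite /hint /vint in EJ *.
  rewrite -(cint_add _ 0 x (x + a)) -(cint_add _ 0 y (y + b)).
  by apply/eqP; rewrite -subr_eq0; apply/eqP; move/eqP: EJ; rewrite -subr_eq0 => /eqP <-; ring.
rewrite E.
have -> : hint f y x (x + a) + iC * vint f (x + a) y (y + b) - f z * h =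
   cint (fun t => f (Complex t y) - f z) x (x + a) +
   iC * cint (fun t => f (Complex (x + a) t) - f z) y (y + b).
  rewrite (cintB _ _ (pcont_h _ cf) (pcont_cst _)) (cintB _ _ (pcont_v _ cf) (pcont_cst _)) !cint_cst.
  rewrite (addrC x) addrK (addrC y) addrK /hint /vint.
  have -> : h = toC a + iC * toC b by rewrite -ComplexE /a /b; case: (h).
  ring.
have ha := cre_le h; have hb := cim_le h; rewrite -/a -/b in ha hb.
have near u v : `|u - x| <= `|a| -> `|v - y| <= `|b| -> cabs (f (Complex u v) - f z) <= e / 4.
  move=> ua vb; apply/ltW/H; apply: le_lt_trans (cabs_le_creim _) _.
  by rewrite creB cimB /= -/x -/y; move: hdl; lra.
apply: le_trans (cabsD _ _) _; rewrite cabsM cabs_iC mul1r.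
have n1 : cabs (cint (fun t => f (Complex t y) - f z) x (x + a)) <= 2 * (e / 4) * `|x + a - x|.
  apply: cint_bound => [|t tx]; first exact: pcontB (pcont_h _ cf) (pcont_cst _).
  apply: near; last by rewrite subrr normr0.
  case/orP: tx => tx; first by rewrite !ger0_norm; lra.
  by rewrite !ler0_norm; lra.
have n2 : cabs (cint (fun t => f (Complex (x + a) t) - f z) y (y + b)) <= 2 * (e / 4) * `|y + b - y|.
  apply: cint_bound => [|t tx]; first exact: pcontB (pcont_v _ cf) (pcont_cst _).
  apply: near; first by rewrite [x + a]addrC addrK.
  case/orP: tx => tx; first by rewrite !ger0_norm; lra.
  by rewrite !ler0_norm; lra.
apply: le_trans (lerD n1 n2) _.
rewrite (addrC x) addrK (addrC y) addrK -mulrDr.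
have -> : 2 * (e / 4) = e / 2 by field.
have : `|a| + `|b| <= 2 * cabs h by lra.
have e2 : 0 <= e / 2 by rewrite divr_ge0// ltW.
move=> /(ler_wpM2l e2) /le_trans; apply.
by rewrite mulrA divfK.
Qed.
End Goursat.

(** * Means over circles and Cauchy's formula *)

Section CircleMean.
Variable R : realType.
Local Notation K := (C R).
Implicit Types (x y s a b e t M r rho : R) (z w h c d : K) (f g : K -> K) (p q : R -> K).

Definition circ r t : K := circle_point r t.

Lemma cabs_circ r t : 0 <= r -> cabs (circ r t) = r.
Proof.
move=> r0; rewrite /cabs /= !exprMn -mulrDr cos2Dsin2 mulr1 sqrtr_sqr ger0_norm//.
Qed.

Lemma pdiff_circ r t : pdiff (circ r) t (iC R * circ r t).
Proof.
have hc : is_derive t 1 (fun s => r * cos s) (- (r * sin t)).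
  by rewrite -mulrN; apply: is_deriveZ.
have hs : is_derive t 1 (fun s => r * sin s) (r * cos t) by apply: is_deriveZ.
have := pdiff_Complex hc hs; congr pdiff.
by apply: creim_eq; rewrite ?creM ?cimM /=; ring.
Qed.

Lemma circ_surj z : exists2 t, - pi <= t <= pi & z = circ (cabs z) t.
Proof.
have [->|z0] := eqVneq z 0.
  exists 0; first by rewrite oppr_le0 pi_ge0.
  by rewrite cabs0; apply: creim_eq; rewrite /= mul0r.
have n0 : 0 < cabs z by rewrite cabs_gt0.
pose x := cre z / cabs z; pose y := cim z / cabs z.
have xy : x ^+ 2 + y ^+ 2 = 1.
  rewrite /x /y !expr_div_n -mulrDl -cabs_sqr divff// expf_neq0 ?gt_eqF//.
have x1 : -1 <= x <= 1.
  rewrite -ler_norml /x normrM normfV (ger0_norm (cabs_ge0 z)).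
  by rewrite ler_pdivrMr// mul1r cre_le.
have sx : `|y| = sin (acos x).
  rewrite sin_acos//.
  by rewrite -sqrtr_sqr; congr Num.sqrt; rewrite -xy; ring.
have ac0 := acos_ge0 x1; have acpi := acos_lepi x1.
have zE : z = Complex (cabs z * x) (cabs z * y).
  by apply: creim_eq; rewrite /= mulrC divfK ?gt_eqF.
case: (ger0P y) sx => y0 sx.
- exists (acos x); first by rewrite acpi andbT; have := pi_ge0 R; lra.
  by rewrite {1}zE /circ /circle_point acosK// -sx.
- exists (- acos x); first by lra.
  by rewrite {1}zE /circ /circle_point cosN sinN acosK// -sx opprK.
Qed.

Definition tp : R := pi *+ 2.
Lemma tp_gt0 : 0 < tp. Proof. by rewrite mulrn_wgt0// pi_gt0. Qed.
Definition cmean p : K := toC tp^-1 * cint p 0 tp.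

Lemma toC_neq0 x : x != 0 -> toC x != 0.
Proof. by apply: contra => /eqP/toC_inj/eqP. Qed.

Lemma cmean_cst c : cmean (fun=> c) = c.
Proof.
rewrite /cmean cint_cst subr0 mulrCA -toCM mulVf ?mulr1//.
by rewrite gt_eqF// tp_gt0.
Qed.
Lemma cmeanB p q : pcont p -> pcont q -> cmean (fun t => p t - q t) = cmean p - cmean q.
Proof. by move=> cp cq; rewrite /cmean cintB// mulrBr. Qed.
Lemma cmean_mull p c : pcont p -> cmean (fun t => c * p t) = c * cmean p.
Proof. by move=> cp; rewrite /cmean cint_mull// mulrCA. Qed.
Lemma cmean_bound p M : pcont p -> (forall t, cabs (p t) <= M) -> cabs (cmean p) <= 2 * M.
Proof.
move=> cp H; rewrite /cmean cabsM cabs_toC ger0_norm ?invr_ge0 ?(ltW tp_gt0)//.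
rewrite ler_pdivrMl ?tp_gt0//.
have := @cint_bound _ p 0 tp M cp (fun x _ => H x).
by rewrite subr0 (ger0_norm (ltW tp_gt0)) mulrC.
Qed.

Lemma pcont_circ f r : 0 <= r -> (forall w, cabs w = r -> exists d, cdiff f w d) ->
  pcont (fun t => f (circ r t)).
Proof.
move=> r0 H x e e0.
have [d fd] := H _ (cabs_circ x r0).
have [dl dl0 Hd] := cdiff_cont fd e0.
have D0 : 0 < r + 1 by rewrite ltr_wpDl.
have [dl' dl'0 Hd'] := pdiff_circ r x (ltr01 : 0 < 1 :> R).
exists (Num.min dl' (dl / (r + 1))); first by rewrite lt_min dl'0 divr_gt0.
move=> y; rewrite lt_min => /andP[y1]; rewrite ltr_pdivlMr// => y2.
apply: Hd; apply: le_lt_trans y2; have := Hd' _ y1.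
rewrite [x + _]addrC subrK mul1r => H1.
rewrite -(subrK (iC R * circ r x * toC (y - x)) (circ r y - circ r x)).
apply: le_trans (cabsD _ _) _.
by rewrite [leRHS]mulrDr mulr1 addrC lerD// !cabsM cabs_iC mul1r cabs_circ// cabs_toC mulrC.
Qed.

(** The mean of z g(z) over a circle vanishes when g has a primitive along it. *)
Lemma cmean_deriv g G r : 0 <= r -> (forall w, cabs w = r -> cdiff G w (g w)) ->
  pcont (fun t => g (circ r t) * circ r t) ->
  cmean (fun t => g (circ r t) * circ r t) = 0.
Proof.
move=> r0 HG cg; rewrite /cmean.
rewrite (@cint_eq _ _ (fun t => - iC R * G (circ r t)) 0 tp cg); last first.
  move=> t; have := pdiff_comp (pdiff_circ r t) (cdiffMl (- iC R) (HG _ (cabs_circ t r0))).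
  congr pdiff; rewrite [LHS](_ : _ = - (iC R * iC R) * (g (circ r t) * circ r t)); last by ring.
  have -> : iC R * iC R = -1 by apply: creim_eq; rewrite !(creM, cimM) /=; ring.
  by rewrite opprK mul1r.
have -> : circ r tp = circ r 0.
  by rewrite /circ /circle_point /tp cos2pi sin2pi cos0 sin0.
by rewrite subrr mulr0.
Qed.

Lemma cdiffX z n : cdiff (fun w => w ^+ n) z (n%:R * z ^+ n.-1).
Proof.
elim: n => [|n IH]; first by rewrite mul0r; exact: cdiff_cst.
have := cdiffM (cdiff_id z) IH; rewrite mul1r mulrCA => H.
have -> : n.+1%:R * z ^+ n.+1.-1 = z ^+ n + n%:R * (z * z ^+ n.-1).
  case: n {IH H} => [|n]; first by rewrite mul0r addr0 mul1r.
  by rewrite -exprS /= -[n.+2%:R]natr1 mulrDl mul1r addrC.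
by apply: cdiff_ext H => w; rewrite exprS.
Qed.

Lemma cdiffXV z n : z != 0 ->
  cdiff (fun w => (w ^+ n)^-1) z (- (n%:R * z ^+ n.-1) / (z ^+ n) ^+ 2).
Proof.
by move=> z0; apply: (@cdiffV _ (fun w => w ^+ n)); [rewrite expf_neq0|exact: cdiffX].
Qed.

Lemma cdiff_subV z w : w - z != 0 ->
  cdiff (fun w => (w - z)^-1) w (- (1 - 0) / (w - z) ^+ 2).
Proof.
move=> wz; apply: (@cdiffV _ (fun w => w - z)) => //.
by apply: cdiffB; [exact: cdiff_id|exact: cdiff_cst].
Qed.

Lemma cmean_exprN r m : 0 < r -> cmean (fun t => (circ r t) ^- m.+1) = 0.
Proof.
move=> r0.
pose g w : K := (w ^+ m.+2)^-1.
have H w : cabs w = r -> w != 0 by move=> wr; rewrite -cabs_gt0 wr.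
have E : (fun t => (circ r t) ^- m.+1) = (fun t => g (circ r t) * circ r t).
  apply/funext => t; have w0 := H _ (cabs_circ t (ltW r0)).
  by rewrite /g (exprS _ m.+1) invfM mulrAC mulVf// mul1r.
rewrite E; apply: (@cmean_deriv _ (fun w => - (m.+1%:R)^-1 * (w ^+ m.+1)^-1)); first exact: ltW.
  move=> w wr; have w0 := H _ wr.
  have := cdiffMl (- (m.+1%:R)^-1) (cdiffXV m.+1 w0).
  congr cdiff; rewrite /g /= !exprS.
  have p0 : w ^+ m != 0 by rewrite expf_neq0.
  have m0 : m.+1%:R != 0 :> K by rewrite pnatr_eq0.
  by move: (w ^+ m) p0 (m.+1%:R) m0 => p p0 k k0; field; rewrite w0 p0.
rewrite -E; apply: (@pcont_circ (fun w => (w ^+ m.+1)^-1)); first exact: ltW.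
move=> w wr; have w0 := H _ wr.
by eexists; exact: (cdiffXV m.+1 w0).
Qed.

(** The quotient (f(w) - f(z))/(w - z) is continuous and differentiable except at
    z, so that it has a primitive, and its mean vanishes. *)
Lemma cauchy f z rho : 0 < rho -> (forall w, exists d, cdiff f w d) -> cabs z < rho ->
  cmean (fun t => let w := circ rho t in (f w - f z) * (w / (w - z))) = 0.
Proof.
move=> r0 df zr.
have [dz fdz] := df z.
pose g w := if w == z then dz else (f w - f z) / (w - z).
have dg w : w != z -> exists d, cdiff g w d.
  move=> wz; have [d fd] := df w.
  have H1 := cdiffB fd (cdiff_cst (f z) w).
  have wz0 : w - z != 0 by rewrite subr_eq0.
  have H2 := cdiffM H1 (cdiff_subV wz0).
  eexists => e e0; have [dl dl0 H] := H2 e e0.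
  have wz1 : 0 < cabs (w - z) by rewrite cabs_gt0.
  exists (Num.min dl (cabs (w - z))); first by rewrite lt_min dl0.
  move=> h; rewrite lt_min => /andP[h1 h2]; have Hh := H h h1.
  rewrite /g (negbTE wz); case: eqP => [E|_]; last exact: Hh.
  exfalso; move: h2.
  by rewrite (_ : w - z = - h) ?cabsN ?ltxx// -E; ring.
have cg : ccont g.
  move=> v e e0; have [->|vz] := eqVneq v z; last first.
    by have [d dgv] := dg v vz; exact: cdiff_cont dgv _ e0.
  have [dl dl0 H] := fdz (e / 2) (divr_gt0 e0 (ltr0n _ 2)).
  exists dl => // u uz; rewrite /g eqxx; case: eqP => [_|/eqP uz0].
    by rewrite subrr cabs0.
  have uz1 : u - z != 0 by rewrite subr_eq0.
  have := H _ uz; rewrite [z + _]addrC subrK.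
  have -> : f u - f z - dz * (u - z) = ((f u - f z) / (u - z) - dz) * (u - z).
    by rewrite mulrBl divfK.
  rewrite cabsM ler_pM2r ?cabs_gt0// => /le_lt_trans; apply.
  by rewrite ltr_pdivrMr// mulr_natr mulr2n ltrDl.
have [G HG] := primitive cg dg.
have wz t : circ rho t != z.
  by apply/eqP => E; move: zr; rewrite -E cabs_circ ?ltxx// ltW.
have E : (fun t => let w := circ rho t in (f w - f z) * (w / (w - z)))
   = (fun t => g (circ rho t) * circ rho t).
  apply/funext => t /=; rewrite /g (negbTE (wz t)); rewrite -!mulrA; congr (_ * _).
  by rewrite mulrC.
rewrite E; apply: (@cmean_deriv _ G); first exact: ltW.
  by move=> w _; exact: HG.
apply: (@pcont_circ (fun w => g w * w)); first exact: ltW.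
move=> w wr; have wz' : w != z by apply/eqP => E'; move: zr; rewrite -E' wr ltxx.
have [d gd] := dg w wz'; eexists; exact: cdiffM gd (cdiff_id w).
Qed.

(** Cauchy's integral for a Taylor coefficient. *)
Definition coefc f rho m : K := cmean (fun t => f (circ rho t) * (circ rho t) ^- m).

(** Cauchy's formula with the geometric series for 1/(1 - z/w) cut after N
    terms. *)
Lemma cauchy_remainder f z rho N : 0 < rho -> (forall w, exists d, cdiff f w d) ->
  cabs z < rho ->
  cmean (fun t => let w := circ rho t in (f w - f z) * (w / (w - z)) * (z / w) ^+ N.+1) =
  f z - \sum_(m < N.+1) coefc f rho m * z ^+ m.
Proof.
move=> r0 df zr.
have w0 w : cabs w = rho -> w != 0 by move=> wr; rewrite -cabs_gt0 wr.
have wz w : cabs w = rho -> w - z != 0.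
  by move=> wr; rewrite subr_eq0; apply/eqP => E; move: zr; rewrite -E wr ltxx.
have dR m w : cabs w = rho -> exists d, cdiff (fun w => (f w - f z) * (w / (w - z)) * (z / w) ^+ m) w d.
  move=> wr; have [d fd] := df w; eexists.
  apply: cdiffM.
    apply: cdiffM; first exact: cdiffB fd (cdiff_cst _ _).
    by apply: cdiffM (cdiff_id _) (cdiff_subV (wz w wr)).
  apply: (@cdiff_comp _ (fun w => w ^+ m)); last exact: cdiffX.
  by apply: cdiffMl; apply: (@cdiffV _ id); [exact: w0|exact: cdiff_id].
have dS m w : cabs w = rho -> exists d, cdiff (fun w => f w * (w ^+ m)^-1) w d.
  move=> wr; have [d fd] := df w; eexists.
  exact: cdiffM fd (cdiffXV m (w0 w wr)).
have dT m w : cabs w = rho -> exists d, cdiff (fun w => (w ^+ m)^-1) w d.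
  by move=> wr; eexists; exact: (cdiffXV m (w0 w wr)).
have cR m := pcont_circ (ltW r0) (dR m).
have cS m := pcont_circ (ltW r0) (dS m).
have cT m := pcont_circ (ltW r0) (dT m).
pose I m := cmean (fun t => (f (circ rho t) - f z) * (circ rho t / (circ rho t - z)) * (z / circ rho t) ^+ m).
have step m : I m.+1 = I m - z ^+ m * (coefc f rho m - f z * cmean (fun t => (circ rho t) ^- m)).
  rewrite /coefc -cmean_mull; last exact: cT.
  rewrite -cmeanB; [|exact: cS|].
    rewrite -cmean_mull; last first.
      apply: (@pcont_circ (fun w => f w * w ^- m - f z * w ^- m)); first exact: ltW.
      move=> w wr; have [d1 h1] := dS m w wr; have [d2 h2] := dT m w wr.
      eexists; exact: cdiffB h1 (cdiffMl (f z) h2).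
    rewrite /I -cmeanB; [|exact: cR|].
      congr cmean; apply/funext => t; have wr := cabs_circ t (ltW r0).
      have h1 := w0 _ wr; have h2 := wz _ wr; move: (circ rho t) h1 h2 => w h1 h2.
      rewrite exprS expr_div_n.
      have h3 : w ^+ m != 0 by rewrite expf_neq0.
      by field; rewrite h1 h2 h3.
    apply: (@pcont_circ (fun w => z ^+ m * (f w * w ^- m - f z * w ^- m)) rho); first exact: ltW.
    move=> w wr; have [d1 h1] := dS m w wr; have [d2 h2] := dT m w wr.
    eexists; apply: cdiffMl; exact: cdiffB h1 (cdiffMl (f z) h2).
  apply: (@pcont_circ (fun w => f z * w ^- m) rho); first exact: ltW.
  move=> w wr; have [d2 h2] := dT m w wr.
  eexists; exact: (cdiffMl (f z) h2).
have I0 : I 0%N = 0.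
  rewrite -[RHS](cauchy r0 df zr); congr cmean; apply/funext => t.
  by rewrite expr0 mulr1.
rewrite -/(I N.+1); elim: N => [|N IH].
  rewrite step I0 big_ord_recl big_ord0 !expr0 mulr1 mul1r addr0 sub0r opprB.
  congr (_ - _).
  have -> : (fun t => (circ rho t) ^- 0) = fun=> 1 by apply/funext => t; rewrite expr0 invr1.
  by rewrite cmean_cst mulr1.
rewrite step IH (cmean_exprN _ r0) mulr0 subr0 [in RHS]big_ord_recr /= opprD addrA.
by rewrite [z ^+ _ * _]mulrC.
Qed.
End CircleMean.

(** * Taylor expansions of entire functions *)

Section Series.
Variable R : realType.
Local Notation K := (C R).
Implicit Types (x y s b e t M A B r rho : R) (z w h c d : K) (f g : K -> K) (a : nat -> K).

Lemma entireP f : entire f <-> forall z, exists d, cdiff f z d.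
Proof.
split=> [H z|H z]; first by exists (derive1 f z); exact: derivable_cdiff.
by have [d /cdiff_derivable] := H z.
Qed.

Lemma entire_cdiff f z : entire f -> cdiff f z (derive1 f z).
Proof. by move=> H; exact: derivable_cdiff. Qed.

Lemma entire_ccont f : entire f -> ccont f.
Proof. by move=> /entireP H; exact: cdiff_ccont. Qed.

(** By bisection of a square that contains the disc. *)
Lemma ccont_bounded f r : ccont f -> exists2 M : R, 0 <= M & forall w, cabs w <= r -> cabs (f w) <= M.
Proof.
move=> cf.
have [r0|r0] := ltP r 0.
  by exists 0 => // w wr; have := cabs_ge0 w; lra.
pose P x y s := exists2 M : R, 0 <= M & forall w,
  x <= cre w <= x + s -> y <= cim w <= y + s -> cabs (f w) <= M.
have [M M0 HM] : P (- r) (- r) (r + r + 1).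
  apply: (@square_ind R P); first by lra.
  - move=> x y s s0 [M1 h1 H1] [M2 h2 H2] [M3 h3 H3] [M4 h4 H4].
    exists (M1 + M2 + M3 + M4); first by lra.
    move=> w xw yw; have [wx|wx] := leP (cre w) (x + s); have [wy|wy] := leP (cim w) (y + s).
    + by have := H1 w; move=> H; have : cabs (f w) <= M1; [apply: H; lra|lra].
    + by have := H3 w; move=> H; have : cabs (f w) <= M3; [apply: H; lra|lra].
    + by have := H2 w; move=> H; have : cabs (f w) <= M2; [apply: H; lra|lra].
    + by have := H4 w; move=> H; have : cabs (f w) <= M4; [apply: H; lra|lra].
  - move=> u v _ _; have [dl dl0 H] := cf (Complex u v) 1 ltr01.
    exists (dl / 2); first by rewrite divr_gt0.
    move=> x y s s0 xu yv; exists (cabs (f (Complex u v)) + 1).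
      by rewrite addr_ge0// cabs_ge0.
    move=> w xw yw; rewrite -(subrK (f (Complex u v)) (f w)).
    apply: le_trans (cabsD _ _) _; rewrite addrC lerD2l; apply/ltW/H.
    apply: le_lt_trans (cabs_le_creim _) _; rewrite creB cimB /=.
    have h1 : `|cre w - u| <= s by rewrite ler_norml; lra.
    have h2 : `|cim w - v| <= s by rewrite ler_norml; lra.
    by lra.
exists M => // w wr; apply: HM.
  by have := cre_le w; rewrite ler_norml; lra.
by have := cim_le w; rewrite ler_norml; lra.
Qed.

Definition psum a N z : K := \sum_(m < N) a m * z ^+ m.

(** An expansion with the bounds that Cauchy's estimates give; in the disc of half
    the radius the geometric tail costs a factor 2. *)
Definition series_bd f a rho A :=
  (forall m, cabs (a m) * rho ^+ m <= A) /\
  (forall N z, cabs z <= rho / 2 -> cabs (f z - psum a N z) <= 2 * A * (cabs z / rho) ^+ N).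

Lemma psum_tail a rho A z N k : 0 < rho -> (forall m, cabs (a m) * rho ^+ m <= A) ->
  cabs z <= rho / 2 -> cabs (psum a (N + k) z - psum a N z) <= 2 * A * (cabs z / rho) ^+ N * (1 - 2^-1 ^+ k).
Proof.
move=> r0 aA zr.
have A0 : 0 <= A by apply: le_trans (aA 0%N); rewrite mulr_ge0 ?cabs_ge0// exprn_ge0// ltW.
set q := cabs z / rho.
have q0 : 0 <= q by rewrite divr_ge0 ?cabs_ge0// ltW.
have q1 : q <= 2^-1 by rewrite /q ler_pdivrMr// mulrC.
elim: k => [|k IH]; first by rewrite addn0 subrr cabs0 expr0 subrr mulr0.
rewrite addnS /psum big_ord_recr /= addrAC; apply: le_trans (cabsD _ _) _.
apply: le_trans (lerD IH (lexx _)) _.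
have H : cabs (a (N + k)%N * z ^+ (N + k)) <= A * q ^+ N * 2^-1 ^+ k.
  rewrite cabsM cabsX -(divfK (lt0r_neq0 r0) (cabs z)) -/q exprMn mulrCA mulrC.
  have h1 : q ^+ (N + k) <= q ^+ N * 2^-1 ^+ k.
    by rewrite exprD ler_wpM2l ?exprn_ge0// lerXn2r ?nnegrE// invr_ge0.
  rewrite -[leRHS]mulrA; apply: ler_pM => //.
    by rewrite mulr_ge0 ?cabs_ge0// exprn_ge0// ltW.
  by rewrite exprn_ge0.
apply: le_trans (lerD (lexx _) H) _.
rewrite (exprS _ k) le_eqVlt; apply/orP; left; apply/eqP; by field.
Qed.

Lemma series_circle f rho M : 0 < rho -> entire f ->
  (forall w, cabs w = rho -> cabs (f w) <= M) -> series_bd f (coefc f rho) rho (2 * M).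
Proof.
move=> r0 /entireP df fM.
have M0 : 0 <= M.
  have /fM : cabs (toC rho) = rho by rewrite cabs_toC ger0_norm// ltW.
  by apply: le_trans; exact: cabs_ge0.
have w0 w : cabs w = rho -> w != 0 by move=> wr; rewrite -cabs_gt0 wr.
have ab m : cabs (coefc f rho m) * rho ^+ m <= 2 * M.
  rewrite -ler_pdivlMr ?exprn_gt0// -mulrA; apply: cmean_bound.
    apply: (@pcont_circ _ (fun w => f w * w ^- m) rho); first exact: ltW.
    move=> w wr; have [d fd] := df w; eexists.
    exact: cdiffM fd (cdiffXV m (w0 w wr)).
  move=> t; have wr := cabs_circ t (ltW r0).
  by rewrite cabs_div cabsX wr ler_wpM2r ?fM// invr_ge0 exprn_ge0// ltW.
split=> // N z zr.
have zr' : cabs z < rho by lra.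
apply/ler_addgt0Pl => e e0.
pose D := 2 * ((M + cabs (f z)) * (rho / (rho - cabs z))).
have D0 : 0 <= D.
  by rewrite mulr_ge0// mulr_ge0 ?addr_ge0 ?cabs_ge0// divr_ge0 ?subr_ge0 ?(ltW r0) ?(ltW zr').
have q01 : 0 <= cabs z / rho < 1.
  by rewrite divr_ge0 ?cabs_ge0 ?(ltW r0)//= ltr_pdivrMr// mul1r.
have D1 : 0 < D + 1 by rewrite ltr_wpDl.
have [k Hk] := expr_small q01 (divr_gt0 e0 D1).
have qk := Hk (N + k).+1 (leq_trans (leq_addl N k) (leqnSn _)).
have tail := @psum_tail _ rho _ z N k.+1 r0 ab zr.
have rem : cabs (f z - psum (coefc f rho) (N + k.+1) z) <= D * (cabs z / rho) ^+ (N + k).+1.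
  rewrite addnS /psum -(cauchy_remainder _ r0 df zr') /D -!mulrA.
  have wz w : cabs w = rho -> w - z != 0.
    by move=> wr; rewrite subr_eq0; apply/eqP => E; move: zr'; rewrite -E wr ltxx.
  apply: cmean_bound.
    apply: (@pcont_circ _ (fun w => (f w - f z) * (w / (w - z)) * (z / w) ^+ (N + k).+1) rho); first exact: ltW.
    move=> w wr; have [d fd] := df w; eexists; apply: cdiffM.
      apply: cdiffM; first exact: cdiffB fd (cdiff_cst _ _).
      exact: cdiffM (cdiff_id _) (cdiff_subV (wz w wr)).
    apply: (@cdiff_comp _ (fun w => w ^+ (N + k).+1)); last exact: cdiffX.
    by apply: cdiffMl; apply: (@cdiffV _ id); [exact: w0|exact: cdiff_id].
  move=> t; have wr := cabs_circ t (ltW r0); move: (circ rho t) wr => w wr /=.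
  rewrite !cabsM !cabsX !cabs_div wr -!mulrA.
  apply: ler_pM; rewrite ?cabs_ge0//.
  - by rewrite !mulr_ge0 ?invr_ge0 ?cabs_ge0 ?exprn_ge0 ?mulr_ge0 ?invr_ge0 ?cabs_ge0// ltW.
  - by apply: le_trans (cabsB _ _) _; rewrite lerD2r fM.
  rewrite ler_wpM2l ?(ltW r0)// ler_wpM2r//.
    by rewrite exprn_ge0// divr_ge0 ?cabs_ge0// ltW.
  rewrite cabsV lef_pV2 ?posrE ?subr_gt0//; last by rewrite cabs_gt0 wz.
  by apply: le_trans (cabs_subr _ _); rewrite wr.
rewrite (_ : f z - psum (coefc f rho) N z = (f z - psum (coefc f rho) (N + k.+1) z) +
  (psum (coefc f rho) (N + k.+1) z - psum (coefc f rho) N z)); last by rewrite addrA subrK.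
apply: le_trans (cabsD _ _) _; apply: lerD.
  apply: le_trans rem _.
  apply: le_trans (ler_wpM2l D0 (ltW qk)) _.
  by rewrite mulrCA ler_piMr ?(ltW e0)// ler_pdivrMr// mul1r lerDl.
apply: le_trans tail _.
rewrite ler_piMr//; first by rewrite !mulr_ge0// exprn_ge0//; case/andP: q01.
Qed.

Lemma le_small_eq0 c B r : 0 < r -> (forall x, 0 < x <= r -> cabs c <= B * x) -> c = 0.
Proof.
move=> r0 H; apply/eqP; rewrite -cabs_eq0 eq_le cabs_ge0 andbT.
apply/ler_addgt0Pl => e e0; rewrite addr0.
have B0 : 0 <= B.
  have /H : 0 < r <= r by rewrite r0 lexx.
  by rewrite -ler_pdivrMr// => /(le_trans _); apply; rewrite divr_ge0 ?cabs_ge0// ltW.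
have B1 : 0 < B + 1 by rewrite ltr_wpDl.
have /H : 0 < Num.min r (e / (B + 1)) <= r by rewrite lt_min r0 divr_gt0//= ge_min lexx.
move=> /le_trans; apply.
have h : Num.min r (e / (B + 1)) <= e / (B + 1) by rewrite ge_min lexx orbT.
apply: le_trans (ler_wpM2l B0 h) _.
by rewrite mulrCA ler_piMr ?(ltW e0)// ler_pdivrMr// mul1r lerDl.
Qed.

(** Two expansions on discs of different radii agree on the smaller disc, and
    the lowest coefficient that differs would dominate near 0. *)
Lemma series_uniq f a (b : nat -> K) rho A sg B : 0 < rho -> 0 < sg ->
  series_bd f a rho A -> series_bd f b sg B -> a =1 b.
Proof.
move=> r0 s0 [aA fa] [bB fb] n.
elim/ltn_ind: n => n IH; apply/eqP; rewrite -subr_eq0; apply/eqP.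
have A0 : 0 <= A by apply: le_trans (aA 0%N); rewrite mulr_ge0 ?cabs_ge0// exprn_ge0// ltW.
have B0 : 0 <= B by apply: le_trans (bB 0%N); rewrite mulr_ge0 ?cabs_ge0// exprn_ge0// ltW.
apply: (@le_small_eq0 _ (2 * A / rho ^+ n.+1 + 2 * B / sg ^+ n.+1) (Num.min (rho / 2) (sg / 2))).
  by rewrite lt_min !divr_gt0.
move=> x /andP[x0]; rewrite le_min => /andP[x1 x2].
have cx : cabs (toC x) = x by rewrite cabs_toC ger0_norm// ltW.
have := fa n.+1 (toC x); have := fb n.+1 (toC x); rewrite cx => /(_ x2) h2 /(_ x1) h1.
have E : (a n - b n) * toC x ^+ n = (f (toC x) - psum b n.+1 (toC x)) - (f (toC x) - psum a n.+1 (toC x)).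
  rewrite /psum !big_ord_recr /=.
  have -> : \sum_(i < n) a i * toC x ^+ i = \sum_(i < n) b i * toC x ^+ i.
    by apply: eq_bigr => i _; rewrite IH.
  ring.
rewrite -(ler_pM2r (exprn_gt0 n x0)) -{1}cx -cabsX -cabsM E.
apply: le_trans (cabsB _ _) _; rewrite addrC; apply: le_trans (lerD h1 h2) _.
rewrite mulrDl mulrDl !expr_div_n !exprS le_eqVlt; apply/orP; left; apply/eqP.
by field; rewrite !expf_neq0 ?gt_eqF.
Qed.

Definition taylor f : nat -> K := coefc f 1.

(** Coefficients computed on the unit circle and on the circle of radius rho
    agree by uniqueness, which gives the expansion on every disc with the bound
    of the function there. *)
Lemma taylorP f rho M : 0 < rho -> entire f ->
  (forall w, cabs w = rho -> cabs (f w) <= M) -> series_bd f (taylor f) rho (2 * M).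
Proof.
move=> r0 ef fM; have [M1 M10 HM1] := ccont_bounded 1 (entire_ccont ef).
have H1 := series_circle r0 ef fM.
have H2 : series_bd f (taylor f) 1 (2 * M1).
  by apply: series_circle => // w w1; apply: HM1; rewrite w1.
by have /funext := series_uniq ltr01 r0 H2 H1 => ->.
Qed.

Lemma taylor_exists f rho : 0 < rho -> entire f -> exists2 A : R, 0 <= A & series_bd f (taylor f) rho A.
Proof.
move=> r0 ef; have [M M0 HM] := ccont_bounded rho (entire_ccont ef).
exists (2 * M); first by rewrite mulr_ge0.
by apply: taylorP => // w wr; apply: HM; rewrite wr.
Qed.

Lemma taylor0 f : entire f -> taylor f 0 = f 0.
Proof.
move=> ef; have [A A0 [_ H]] := taylor_exists ltr01 ef.
have := H 1%N 0; rewrite cabs0 => /(_ _)/wrap[].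
  by rewrite divr_ge0.
rewrite /psum big_ord_recl big_ord0 expr0 mulr1 addr0 mul0r expr1 mulr0 => h.
by apply/esym/eqP; rewrite -subr_eq0 -cabs_eq0 eq_le h cabs_ge0.
Qed.

Lemma entire_shift f z : entire f -> entire (fun w => f (z + w)).
Proof.
move=> /entireP df; apply/entireP => w; have [d fd] := df (z + w).
exists (d * (0 + 1)); apply: (@cdiff_comp _ f) => //.
exact: cdiffD (cdiff_cst z w) (cdiff_id w).
Qed.

Arguments entire_shift [f] z _.

Lemma taylor1 f : entire f -> taylor f 1 = derive1 f 0.
Proof.
move=> ef; apply/esym/cdiff_derive1.
have [A A0 [_ H]] := taylor_exists ltr01 ef.
move=> e e0; have A1 : 0 < 2 * A + 1 by rewrite ltr_wpDl// mulr_ge0.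
exists (Num.min (1/2) (e / (2 * A + 1))); first by rewrite lt_min !divr_gt0.
move=> h; rewrite lt_min => /andP[h1]; rewrite ltr_pdivlMr// => h2.
have := H 2%N h (ltW h1).
rewrite /psum !big_ord_recl big_ord0 /= expr0 mulr1 addr0 /bump /= addn0 expr1 taylor0//.
rewrite opprD addrA add0r => /le_trans; apply.
rewrite divr1 expr2 mulrA ler_wpM2r ?cabs_ge0//.
apply: le_trans (ltW h2); rewrite mulrC ler_wpM2l ?cabs_ge0//.
by rewrite lerDl.
Qed.

Lemma derive1_shift f z w : entire f -> derive1 (fun w => f (z + w)) w = derive1 f (z + w).
Proof.
move=> ef; apply: cdiff_derive1; rewrite -[derive1 f _]mulr1.
have -> : (1 : K) = 0 + 1 by rewrite add0r.
apply: (@cdiff_comp _ f); last exact: entire_cdiff.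
exact: cdiffD (cdiff_cst z w) (cdiff_id w).
Qed.

Lemma cauchy_derive f z rho M : 0 < rho -> entire f ->
  (forall w, cabs (w - z) = rho -> cabs (f w) <= M) -> cabs (derive1 f z) <= 2 * M / rho.
Proof.
move=> r0 ef fM; have es := entire_shift z ef.
have [|aA _] := @taylorP (fun w => f (z + w)) rho M r0 es.
  by move=> w wr; apply: fM; rewrite [z + w]addrC addrK.
by have := aA 1%N; rewrite taylor1// derive1_shift// addr0 expr1 ler_pdivlMr.
Qed.

(** The difference quotient of f' at a point is estimated by comparing the
    second-order expansions of f at that point and at the nearby one. *)
Lemma entire_derive1 f : entire f -> entire (derive1 f).
Proof.
move=> ef; apply/entireP => u.
have [M M0 HM] := ccont_bounded (cabs u + 3) (entire_ccont ef).
exists (2 * taylor (fun w => f (u + w)) 2) => e e0.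
have exp2 v : cabs (v - u) <= 1 -> forall k, cabs k <= 1 ->
    cabs (f (v + k) - (f v + derive1 f v * k + taylor (fun w => f (v + w)) 2 * k ^+ 2)) <= 4 * M * (cabs k / 2) ^+ 3.
  move=> vu k k1; have es := entire_shift v ef.
  have [|_ H] := @taylorP (fun w => f (v + w)) 2 M (ltr0n _ 2) es.
    move=> w w2; apply: HM; rewrite (_ : v + w = u + ((v - u) + w)); last by ring.
    apply: le_trans (cabsD _ _) _; rewrite lerD2l.
    by apply: le_trans (cabsD _ _) _; rewrite w2; lra.
  have := H 3%N k; rewrite divff ?pnatr_eq0// => /(_ k1).
  rewrite /psum !big_ord_recr big_ord0 /= taylor0// taylor1// derive1_shift// !addr0 add0r expr0 mulr1 expr1.
  by rewrite mulrA -natrM.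
have D0 : 0 < 4 * M + 1 by rewrite ltr_wpDl// mulr_ge0.
exists (Num.min (1/2) (e / (4 * M + 1))); first by rewrite lt_min !divr_gt0.
move=> h; rewrite lt_min => /andP[h1]; rewrite ltr_pdivlMr// => h2.
have [->|h0] := eqVneq h 0.
  by rewrite addr0 subrr mulr0 subrr cabs0 mulr0.
have hp : 0 < cabs h by rewrite cabs_gt0.
have c2h : cabs (2 * h) = 2 * cabs h by rewrite cabsM cabs_nat.
have uhu : cabs (u + h - u) <= 1 by rewrite [u + h]addrC addrK; lra.
have h1' : cabs h <= 1 by lra.
have h1'' : cabs (- h) <= 1 by rewrite cabsN; lra.
have h1''' : cabs (2 * h) <= 1 by rewrite c2h; lra.
have E1 := exp2 (u + h) uhu h h1'.
have E2 := exp2 (u + h) uhu (- h) h1''.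
have E3 := exp2 u _ (2 * h) h1'''; rewrite subrr cabs0 in E3; have {}E3 := E3 ler01.
rewrite cabsN in E2; rewrite c2h in E3.
rewrite -(ler_pM2l (_ : 0 < cabs (2 * h))) ?c2h ?mulr_gt0// -c2h -cabsM.
set b := taylor (fun w => f (u + w)) 2 in E3 *.
set b' := taylor (fun w => f (u + h + w)) 2 in E1 E2.
set X1 := (X in cabs X <= _) in E1; set X2 := (X in cabs X <= _) in E2; set X3 := (X in cabs X <= _) in E3.
have -> : 2 * h * (derive1 f (u + h) - derive1 f u - 2 * b * h) = X3 - X1 + X2.
  rewrite /X1 /X2 /X3 (_ : u + h - h = u); last by rewrite addrK.
  rewrite (_ : u + h + h = u + 2 * h); last by ring.
  move: (derive1 f (u + h)) (derive1 f u) (f (u + 2 * h)) (f (u + h)) (f u) (b) (b').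
  by move=> D1 D2 f1 f2 f3 b1 b2; ring.
apply: le_trans (cabsD _ _) _; apply: le_trans (lerD (cabsB _ _) E2) _.
apply: le_trans (lerD (lerD E3 E1) (lexx _)) _.
rewrite c2h; move: (cabs h) hp h2 => n n0 h2.
have -> : 4 * M * (2 * n / 2) ^+ 3 + 4 * M * (n / 2) ^+ 3 + 4 * M * (n / 2) ^+ 3 = 5 * M * n * (n * n) by field.
have -> : 2 * n * (e * n) = 2 * e * (n * n) by ring.
rewrite ler_wpM2r ?mulr_ge0 ?(ltW n0)//.
have : 0 <= M * n by rewrite mulr_ge0// ltW.
lra.
Qed.
End Series.
Arguments entire_shift {R} [f] z _ : rename.

(** * Derivatives, zeros and the minimum principle *)

Local Opaque entire derive1 derive1n.
Section Entire.
Variable R : realType.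
Local Notation K := (C R).
Implicit Types (x y s b e t M A B r rho : R) (z w h c d : K) (f g : K -> K) (a : nat -> K).

Lemma entire_cst c : entire (fun=> c : K).
Proof. by apply/entireP => z; exists 0; exact: cdiff_cst. Qed.
Lemma entire_id : entire (fun w : K => w).
Proof. by apply/entireP => z; exists 1; exact: cdiff_id. Qed.
Arguments entire_cst : clear implicits.
Lemma entireD f g : entire f -> entire g -> entire (fun w => f w + g w).
Proof.
move=> /entireP ef /entireP eg; apply/entireP => z.
by have [a fa] := ef z; have [b gb] := eg z; exists (a + b); exact: cdiffD.
Qed.
Lemma entireN f : entire f -> entire (fun w => - f w).
Proof. by move=> /entireP ef; apply/entireP => z; have [a fa] := ef z; exists (- a); exact: cdiffN. Qed.
Lemma entireB f g : entire f -> entire g -> entire (fun w => f w - g w).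
Proof. by move=> ef eg; exact: entireD ef (entireN eg). Qed.
Lemma entireM f g : entire f -> entire g -> entire (fun w => f w * g w).
Proof.
move=> /entireP ef /entireP eg; apply/entireP => z.
by have [a fa] := ef z; have [b gb] := eg z; eexists; exact: cdiffM fa gb.
Qed.
Lemma entire_subc z : entire (fun w : K => w - z).
Proof. exact: entireB entire_id (entire_cst z). Qed.
Arguments entire_subc : clear implicits.
Lemma entireX f n : entire f -> entire (fun w => f w ^+ n).
Proof.
move=> ef; elim: n => [|n IH].
  rewrite (_ : (fun w => _) = fun=> 1); first exact: entire_cst.
  by apply/funext => w; rewrite expr0.
rewrite (_ : (fun w => _) = fun w => f w * f w ^+ n); first exact: entireM.
by apply/funext => w; rewrite exprS.
Qed.
Arguments entireX [f] n _.
Lemma entire_comp f g : entire f -> entire g -> entire (fun w => f (g w)).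
Proof.
move=> /entireP ef /entireP eg; apply/entireP => z.
have [a ga] := eg z; have [b fb] := ef (g z); eexists; exact: cdiff_comp ga fb.
Qed.
Lemma entire_horner (p : {poly K}) : entire (horner p).
Proof. by apply/entireP => z; eexists; exact: cdiff_horner. Qed.
Lemma entire_expC : entire (@expC R).
Proof. by apply/entireP => z; eexists; exact: cdiff_expC. Qed.
Arguments entire_horner : clear implicits.
Arguments entire_cst : clear implicits.

Lemma entire_sum (I : Type) (s : seq I) (P : pred I) (F : I -> K -> K) :
  (forall i, entire (F i)) -> entire (fun w => \sum_(i <- s | P i) F i w).
Proof.
move=> H; elim: s => [|i s IH].
  by rewrite (_ : (fun w => _) = fun=> 0); [exact: entire_cst|apply/funext => w; rewrite big_nil].
have [Pi|Pi] := boolP (P i).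
  rewrite (_ : (fun w => _) = fun w => F i w + \sum_(i <- s | P i) F i w); first exact: (entireD (H i) IH).
  by apply/funext => w; rewrite big_cons Pi.
rewrite (_ : (fun w => _) = fun w => \sum_(i <- s | P i) F i w)//.
by apply/funext => w; rewrite big_cons (negbTE Pi).
Qed.
Arguments entire_sum [I] s P [F] _.
Lemma entire_prod (I : Type) (s : seq I) (P : pred I) (F : I -> K -> K) :
  (forall i, entire (F i)) -> entire (fun w => \prod_(i <- s | P i) F i w).
Proof.
move=> H; elim: s => [|i s IH].
  by rewrite (_ : (fun w => _) = fun=> 1); [exact: entire_cst|apply/funext => w; rewrite big_nil].
have [Pi|Pi] := boolP (P i).
  rewrite (_ : (fun w => _) = fun w => F i w * \prod_(i <- s | P i) F i w); first exact: (entireM (H i) IH).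
  by apply/funext => w; rewrite big_cons Pi.
rewrite (_ : (fun w => _) = fun w => \prod_(i <- s | P i) F i w)//.
by apply/funext => w; rewrite big_cons (negbTE Pi).
Qed.

Arguments entire_prod [I] s P [F] _.
Lemma entire_derive1n i f : entire f -> entire (derive1n i f).
Proof.
move=> ef; elim: i => [|i IH]; first by rewrite derive1n0.
by rewrite derive1nS; exact: (entire_derive1 IH).
Qed.

Arguments entire_derive1n i [f] _.

Lemma derive1D f g : entire f -> entire g ->
  derive1 (fun w => f w + g w) = fun w => derive1 f w + derive1 g w.
Proof.
by move=> ef eg; apply/funext => z; apply: cdiff_derive1; apply: cdiffD; exact: entire_cdiff.
Qed.
Lemma derive1B f g : entire f -> entire g ->
  derive1 (fun w => f w - g w) = fun w => derive1 f w - derive1 g w.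
Proof.
by move=> ef eg; apply/funext => z; apply: cdiff_derive1; apply: cdiffB; exact: entire_cdiff.
Qed.
Lemma derive1M f g : entire f -> entire g ->
  derive1 (fun w => f w * g w) = fun w => derive1 f w * g w + f w * derive1 g w.
Proof.
by move=> ef eg; apply/funext => z; apply: cdiff_derive1; apply: cdiffM; exact: entire_cdiff.
Qed.
Lemma derive1_horner (p : {poly K}) : derive1 (horner p) = horner p^`().
Proof. by apply/funext => z; apply: cdiff_derive1; exact: cdiff_horner. Qed.
Lemma derive1n_horner i (p : {poly K}) : derive1n i (horner p) = horner (derivn i p).
Proof.
elim: i => [|i IH]; first by rewrite derive1n0 derivn0.
by rewrite derive1nS IH derive1_horner derivnS.
Qed.
Lemma derive1nB i f g : entire f -> entire g ->
  derive1n i (fun w => f w - g w) = fun w => derive1n i f w - derive1n i g w.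
Proof.
move=> ef eg; elim: i => [|i IH]; first by rewrite !derive1n0.
by rewrite derive1nS IH (derive1B (entire_derive1n i ef) (entire_derive1n i eg)) !derive1nS.
Qed.

Arguments derive1nB i [f g] _ _.

(** Cauchy's estimate, iterated, doubles the radius at each derivative. *)
Lemma derive1n_bound i g r B : 1 <= r -> entire g ->
  (forall w, cabs w <= 2 ^+ i * r -> cabs (g w) <= B) ->
  forall w, cabs w <= r -> cabs (derive1n i g w) <= 2 ^+ i * B.
Proof.
move=> r1; elim: i g B => [|i IH] g B eg gB w wr.
  by rewrite derive1n0 expr0 mul1r; apply: gB; rewrite expr0 mul1r.
rewrite derive1Sn exprSr -mulrA.
apply: IH wr => [|{}w wr]; first exact: entire_derive1 eg.
have p1 : 1 <= 2 ^+ i * r.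
  by rewrite -[leLHS]mulr1 ler_pM// exprn_ege1// ler1n.
have B0 : 0 <= B.
  apply: le_trans (gB 0 _); first exact: cabs_ge0.
  by rewrite cabs0 mulr_ge0 ?exprn_ge0//; lra.
apply: (@le_trans _ _ (2 * B / (2 ^+ i * r))).
  apply: cauchy_derive eg _ => [|u uw]; first by lra.
  apply: gB; rewrite -(subrK w u); apply: le_trans (cabsD _ _) _.
  by rewrite uw exprS -mulrA; lra.
by rewrite ler_piMr ?mulr_ge0// invf_le1//; lra.
Qed.

(** A truncated Taylor series approximates f with error geometric in the number
    of terms, and [derive1n_bound] applied to the remainder does the same for the
    derivatives. *)
Lemma taylor_poly f rho B r (n d : nat) : 1 <= r -> 2 ^+ n * r <= rho / 2 -> entire f ->
  (forall w, cabs w = rho -> cabs (f w) <= B) ->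
  exists2 p : {poly K}, (size p <= d)%N & forall i w, (i <= n)%N -> cabs w <= r ->
    cabs (derive1n i f w - (derivn i p).[w]) <= 2 ^+ n * (4 * B * (2 ^+ n * r / rho) ^+ d).
Proof.
move=> r1 rr ef fB; pose p := \poly_(m < d) taylor f m.
have p1 k : 1 <= 2 ^+ k :> R by rewrite exprn_ege1// ler1n.
have r0 : 0 < 2 ^+ n * r by rewrite mulr_gt0 ?exprn_gt0//; lra.
have rho0 : 0 < rho by lra.
have B0 : 0 <= B.
  have /fB : cabs (toC rho) = rho by rewrite cabs_toC ger0_norm// ltW.
  by apply: le_trans; exact: cabs_ge0.
have [_ H] := taylorP rho0 ef fB.
exists p; first exact: size_poly.
move=> i w iN wr.
have -> : derive1n i f w - (derivn i p).[w] = derive1n i (fun w => f w - p.[w]) w.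
  by rewrite (derive1nB _ ef (entire_horner p)) derive1n_horner.
have ni : 2 ^+ i <= 2 ^+ n :> R by rewrite ler_eXn2l// ltr1n.
set E := 4 * B * _.
have E0 : 0 <= E by rewrite !mulr_ge0// exprn_ge0// divr_ge0// ltW.
apply: (@le_trans _ _ (2 ^+ i * E)); last by rewrite ler_wpM2r.
apply: (@derive1n_bound i (fun w => f w - p.[w]) r E r1 (entireB ef (entire_horner p))) wr => u ur.
have ur' : cabs u <= 2 ^+ n * r by apply: le_trans ur _; rewrite ler_wpM2r//; lra.
rewrite horner_poly; apply: le_trans (H d u _) _; first by lra.
rewrite mulrA -natrM ler_wpM2l ?mulr_ge0// lerXn2r ?nnegrE ?divr_ge0 ?cabs_ge0 ?(ltW rho0) ?(ltW r0)//.
by rewrite ler_wpM2r// invr_ge0 ltW.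
Qed.

Lemma taylor_eq0 f : entire f -> (forall m, taylor f m = 0) -> forall w, f w = 0.
Proof.
move=> ef H w.
have r0 : 0 < 2 * cabs w + 1 by have := cabs_ge0 w; lra.
have [A A0 [_ HA]] := taylor_exists r0 ef.
apply/eqP; rewrite -cabs_eq0 eq_le cabs_ge0 andbT.
apply/ler_addgt0Pl => e e0; rewrite addr0.
have wr : cabs w <= (2 * cabs w + 1) / 2 by lra.
have q01 : 0 <= cabs w / (2 * cabs w + 1) < 1.
  by rewrite divr_ge0 ?cabs_ge0 ?(ltW r0)//= ltr_pdivrMr// mul1r; have := cabs_ge0 w; lra.
have D0 : 0 < 2 * A + 1 by lra.
have [N /(_ N (leqnn N)) HN] := expr_small q01 (divr_gt0 e0 D0).
have := HA N w wr; rewrite /psum big1 => [|i _]; last by rewrite H mul0r.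
rewrite subr0 => /le_trans; apply.
apply: (@le_trans _ _ ((2 * A + 1) * (e / (2 * A + 1)))); last by rewrite mulrC divfK// gt_eqF.
by rewrite ler_pM ?(ltW HN)// ?mulr_ge0 ?exprn_ge0//; [case/andP: q01|lra].
Qed.

(** The series with coefficients shifted by one converges to the quotient. *)
Lemma dvd_zero f : entire f -> taylor f 0 = 0 -> exists2 g, entire g &
  (forall w, f w = w * g w) /\ (forall m, taylor g m = taylor f m.+1).
Proof.
move=> ef f0; pose g w := if w == 0 then taylor f 1 else f w / w.
have fg w : f w = w * g w.
  rewrite /g; case: eqP => [->|/eqP w0]; first by rewrite -taylor0// f0 mul0r.
  by rewrite mulrC divfK.
have [A A0 [HA1 HA2]] := taylor_exists ltr01 ef.
have sg : series_bd g (fun m => taylor f m.+1) 1 A.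
  split=> [m|N z z1]; first by have := HA1 m.+1; rewrite !expr1n.
  have [->|z0] := eqVneq z 0.
    rewrite /g eqxx; case: N => [|N].
      rewrite /psum big_ord0 subr0 expr0 mulr1.
      by have := HA1 1%N; rewrite expr1n mulr1; lra.
    rewrite /psum big_ord_recl expr0 mulr1 big1 ?addr0 => [|i _].
      by rewrite subrr cabs0 !mulr_ge0 ?exprn_ge0// mulr_ge0 ?cabs_ge0// invr1.
    by rewrite exprS mul0r mulr0.
  have z0' : 0 < cabs z by rewrite cabs_gt0.
  have := HA2 N.+1 z z1.
  have -> : f z - psum (taylor f) N.+1 z = z * (g z - psum (fun m => taylor f m.+1) N z).
    rewrite mulrBr -fg /psum big_ord_recl f0 mul0r add0r big_distrr /=; congr (_ - _).
    by apply: eq_bigr => i _; rewrite exprS mulrCA.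
  by rewrite cabsM divr1 exprS mulrCA ler_pM2l.
have eg : entire g.
  apply/entireP => z; have [->|z0] := eqVneq z 0.
    exists (taylor f 2) => e e0.
    have D0 : 0 < 2 * A + 1 by lra.
    exists (Num.min (1/2) (e / (2 * A + 1))); first by rewrite lt_min !divr_gt0.
    move=> h; rewrite lt_min => /andP[h1]; rewrite ltr_pdivlMr// => h2.
    have [_ /(_ 2%N h (ltW h1))] := sg.
    rewrite /psum !big_ord_recl big_ord0 /= expr0 mulr1 addr0 /bump /= expr1 add0r.
    rewrite opprD addrA /g eqxx => /le_trans; apply.
    rewrite divr1 expr2 mulrA ler_wpM2r ?cabs_ge0//.
    by apply: le_trans (ltW h2); rewrite mulrC ler_wpM2l ?cabs_ge0// lerDl.
  have [d fd] := (entireP f).1 ef z.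
  have H2 := cdiffM fd (cdiffXV 1 z0).
  eexists => e e0; have [dl dl0 H] := H2 e e0.
  exists (Num.min dl (cabs z)); first by rewrite lt_min dl0 cabs_gt0.
  move=> h; rewrite lt_min => /andP[h1 h2]; have Hh := H h h1.
  rewrite /g (negbTE z0); case: eqP => [E|_]; last exact: Hh.
  by exfalso; move: h2; rewrite (_ : z = - h) ?cabsN ?ltxx//; apply/eqP; rewrite -addr_eq0 E.
exists g => //; split => //.
have [B B0 HB] := taylor_exists ltr01 eg.
by move=> m; exact: (series_uniq ltr01 ltr01 HB sg m).
Qed.

(** The order of vanishing is the index of the first non-zero coefficient, which
    exists since f is not identically zero. *)
Lemma factor_zero f : entire f -> (exists w, f w != 0) ->
  exists k, exists2 g, entire g & g 0 != 0 /\ forall w, f w = w ^+ k * g w.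
Proof.
move=> ef [w fw].
have [m fm] : exists m, taylor f m != 0.
  apply: contrapT => /forallNP H; move/eqP: fw; apply; apply: taylor_eq0 => // m.
  by have /negP := H m; rewrite negbK => /eqP.
elim: m f ef fm {w fw} => [|m IH] f ef fm.
  exists 0%N; exists f => //; split; first by rewrite -taylor0.
  by move=> w; rewrite expr0 mul1r.
have [f0|f0] := eqVneq (taylor f 0) 0; last first.
  exists 0%N; exists f => //; split; first by rewrite -taylor0.
  by move=> w; rewrite expr0 mul1r.
have [g eg [fg tg]] := dvd_zero ef f0.
rewrite -tg in fm; have [k [g' eg' [g'0 H]]] := IH g eg fm.
exists k.+1; exists g' => //; split=> // w.
by rewrite fg H exprS mulrA.
Qed.

Lemma factor_at f z : entire f -> (exists w, f w != 0) ->
  exists k, exists2 g, entire g & g z != 0 /\ forall w, f w = (w - z) ^+ k * g w.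
Proof.
move=> ef [w fw].
have [|k [g eg [g0 H]]] := factor_zero (entire_shift z ef).
  by exists (w - z); rewrite addrC subrK.
exists k; exists (fun w => g (- z + w)); first exact: entire_shift.
split; first by rewrite addNr.
by move=> u; rewrite [- z + u]addrC -H [z + _]addrC subrK.
Qed.

Lemma ccont_neq0 f z : ccont f -> f z != 0 -> exists2 dl : R, 0 < dl & forall w, cabs (w - z) < dl -> f w != 0.
Proof.
move=> cf fz; have fz' : 0 < cabs (f z) by rewrite cabs_gt0.
have [dl dl0 H] := cf z _ fz'; exists dl => // w /H; apply: contraTneq => ->.
by rewrite sub0r cabsN ltxx.
Qed.

Lemma isolated_zeros f z : entire f -> (exists w, f w != 0) ->
  exists2 dl : R, 0 < dl & forall w, cabs (w - z) < dl -> f w = 0 -> w = z.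
Proof.
move=> ef nf; have [k [g eg [gz H]]] := factor_at z ef nf.
have [dl dl0 Hdl] := ccont_neq0 (entire_ccont eg) gz; exists dl => // w wz.
rewrite H => /eqP; rewrite mulf_eq0 (negbTE (Hdl w wz)) orbF expf_eq0 => /andP[_].
by rewrite subr_eq0 => /eqP.
Qed.

(** By bisection, since zeros are isolated. *)
Lemma finite_zeros f s : entire f -> (exists w, f w != 0) ->
  exists zs : seq K, forall w, cabs w <= s -> f w = 0 -> w \in zs.
Proof.
move=> ef nf; have [s0|s0] := ltP s 0.
  by exists [::] => w ws; have w0 := cabs_ge0 w; exfalso; lra.
pose P x y t := exists zs : seq K, forall w,
  x <= cre w <= x + t -> y <= cim w <= y + t -> f w = 0 -> w \in zs.
have [zs Hzs] : P (- s) (- s) (s + s + 1).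
  apply: (@square_ind R P); first by lra.
  - move=> x y t t0 [z1 h1] [z2 h2] [z3 h3] [z4 h4]; exists (z1 ++ z2 ++ z3 ++ z4).
    move=> w xw yw fw; rewrite !mem_cat.
    have [wx|wx] := leP (cre w) (x + t); have [wy|wy] := leP (cim w) (y + t).
    + by rewrite h1//; lra.
    + by rewrite h3 ?orbT//; lra.
    + by rewrite h2 ?orbT//; lra.
    + by rewrite h4 ?orbT//; lra.
  - move=> u v _ _; have [dl dl0 H] := isolated_zeros (Complex u v) ef nf.
    exists (dl / 2); first by rewrite divr_gt0.
    move=> x y t t0 xu yv; exists [:: Complex u v : K] => w xw yw fw.
    rewrite inE; apply/eqP; apply: H => //.
    apply: le_lt_trans (cabs_le_creim _) _; rewrite creB cimB /=.
    have h1 : `|cre w - u| <= t by rewrite ler_norml; lra.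
    have h2 : `|cim w - v| <= t by rewrite ler_norml; lra.
    by lra.
exists zs => w ws; apply: Hzs.
  by have := cre_le w; rewrite ler_norml; lra.
by have := cim_le w; rewrite ler_norml; lra.
Qed.

(** The zeros in the disc, finite in number, are divided out one at a time, each
    to its full order. *)
Lemma zero_factorization f s : entire f -> (exists w, f w != 0) ->
  exists zs : seq K, exists2 g, entire g &
    [/\ forall w, f w = (\prod_(z <- zs) (w - z)) * g w,
        forall z, z \in zs -> cabs z <= s &
        forall w, cabs w <= s -> g w != 0].
Proof.
move=> ef nf; have [Z HZ] := finite_zeros s ef nf.
elim: Z f ef nf HZ => [|z Z IH] f ef nf HZ.
  exists [::]; exists f => //; split=> // [w|w ws]; first by rewrite big_nil mul1r.
  by apply/eqP => /(HZ w ws); rewrite in_nil.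
have [zs|zs] := leP (cabs z) s; last first.
  apply: IH => // w ws fw; have := HZ w ws fw; rewrite inE => /orP[/eqP E|//].
  by move: ws; rewrite E leNgt zs.
have [k [g eg [gz H]]] := factor_at z ef nf.
have [||Z' [h eh [Hh1 Hh2 Hh3]]] := IH g eg.
- by exists z.
- move=> w ws gw; have := HZ w ws; rewrite H gw mulr0 inE => /(_ erefl)/orP[/eqP E|//].
  by move: gz; rewrite -E gw eqxx.
exists (nseq k z ++ Z'); exists h => //; split=> // [w|u].
  by rewrite big_cat /= H Hh1 mulrA; congr (_ * _ * _); rewrite big_nseq -Monoid.iteropE.
by rewrite mem_cat mem_nseq => /orP[/andP[_ /eqP ->]//|/Hh2].
Qed.

Lemma derive1_subX z k :
  derive1 (fun w => (w - z) ^+ k.+1 : K) = fun w => k.+1%:R * (w - z) ^+ k.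
Proof.
apply/funext => w; apply: cdiff_derive1; rewrite -[_ * _]mulr1 -[X in _ * X]subr0.
apply: (@cdiff_comp _ (fun w => w ^+ k.+1)); last exact: cdiffX.
exact: cdiffB (cdiff_id w) (cdiff_cst z w).
Qed.

(** Differentiation lowers the exponent of the factor by one and keeps the other
    factor non-zero at z. *)
Lemma derive1n_factor f g z k : entire g -> g z != 0 ->
  (forall w, f w = (w - z) ^+ k * g w) ->
  derive1n k f z != 0 /\ forall i, (i < k)%N -> derive1n i f z = 0.
Proof.
elim: k f g => [|k IH] f g eg gz H.
  by split=> [|//]; rewrite derive1n0 H expr0 mul1r.
have ef : f = fun w => (w - z) ^+ k.+1 * g w by apply/funext.
have ed := entire_subc z.
pose g1 w := k.+1%:R * g w + (w - z) * derive1 g w.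
have eg1 : entire g1.
  apply: entireD; first exact: entireM (entire_cst _) eg.
  exact: entireM ed (entire_derive1 eg).
have df : forall w, derive1 f w = (w - z) ^+ k * g1 w.
  move=> w; rewrite ef (derive1M (entireX k.+1 ed) eg) derive1_subX /g1 exprS.
  by move: (derive1 g w) (g w) ((w - z) ^+ k) (k.+1%:R) => a1 a2 a3 a4; ring.
have g1z : g1 z != 0 by rewrite /g1 subrr mul0r addr0 mulf_neq0 ?pnatr_eq0.
have [h1 h2] := IH (derive1 f) g1 eg1 g1z df; split; first by rewrite derive1Sn.
case=> [_|i]; first by rewrite derive1n0 H subrr exprS mul0r mul0r.
by rewrite ltnS derive1Sn; exact: h2.
Qed.

Lemma zero_multiplicity_factor f g z k : entire g -> g z != 0 ->
  (forall w, f w = (w - z) ^+ k * g w) -> zero_multiplicity f z = k.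
Proof.
move=> eg gz H; have [h1 h2] := derive1n_factor eg gz H.
rewrite /zero_multiplicity; case: xgetP => [m _ [m1 m2]|/(_ k) []//].
have [mk|km|//] := ltngtP m k; first by move: m1; rewrite h2 ?eqxx.
by move: h1; rewrite m2 ?eqxx.
Qed.

Lemma zero_multiplicity_count f g (zs : seq K) z : entire g -> g z != 0 ->
  (forall w, f w = (\prod_(u <- zs) (w - u)) * g w) ->
  zero_multiplicity f z = count_mem z zs.
Proof.
move=> eg gz H.
apply: (@zero_multiplicity_factor f (fun w => (\prod_(u <- zs | u != z) (w - u)) * g w)).
- exact: entireM (entire_prod zs (fun u => u != z) entire_subc) eg.
- rewrite mulf_neq0// prodf_seq_neq0; apply/allP => u _.
  by apply/implyP; rewrite subr_eq0 eq_sym.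
- move=> w; rewrite H mulrA; congr (_ * _).
  rewrite (bigID (fun u => u == z)) /=; congr (_ * _).
  elim: zs {H} => [|u zs IH]; first by rewrite big_nil expr0.
  rewrite big_cons /=; case: eqP => [->|_]; last by rewrite add0n.
  by rewrite add1n exprS IH.
Qed.

Lemma toCX x n : toC (x ^+ n) = toC x ^+ n.
Proof. by elim: n => [|n IH] //; rewrite !exprS toCM IH. Qed.

(** If f - f(z) starts with the term q(0) h^k, a step h in the direction of a
    k-th root of -f(z)/q(0) moves f(z) towards 0. *)
Lemma local_decrease f z : entire f -> f z != 0 -> (exists w, f w != f z) ->
  forall dl, 0 < dl -> exists2 w, cabs (w - z) < dl & cabs (f w) < cabs (f z).
Proof.
move=> ef fz [w fw] dl dl0.
pose g h := f (z + h) - f z.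
have eg : entire g := entireB (entire_shift z ef) (entire_cst (f z)).
have [|k [q eq [q0 H]]] := factor_zero eg.
  by exists (w - z); rewrite /g [z + _]addrC subrK subr_eq0.
have k0 : (0 < k)%N.
  rewrite lt0n; apply/eqP => k0; have := H 0; rewrite k0 expr0 mul1r /g addr0 subrr.
  by move/esym/eqP; rewrite (negbTE q0).
(* Along h = t zt the leading term q(0) h^k equals - t^k f(z). *)
pose zt : K := k.-root (- f z / q 0).
have ztk : zt ^+ k = - f z / q 0 by rewrite rootCK.
have zt0 : zt != 0.
  apply/eqP => E; move: ztk; rewrite E expr0n gtn_eqF//= => /esym/eqP.
  by rewrite mulf_eq0 oppr_eq0 invr_eq0 (negbTE fz) (negbTE q0).
have zt0' : 0 < cabs zt by rewrite cabs_gt0.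
have q0' : 0 < cabs (q 0) by rewrite cabs_gt0.
have [d1 d10 Hd1] := entire_ccont eq 0 q0'.
pose t := Num.min (1/2) (Num.min (d1 / (2 * cabs zt)) (dl / (2 * cabs zt))).
have t0 : 0 < t by rewrite !lt_min !divr_gt0// mulr_gt0.
have t1 : t <= 1/2 by rewrite ge_min lexx.
have half x : 0 < x -> t <= x / (2 * cabs zt) -> t * cabs zt < x.
  move=> x0; rewrite ler_pdivlMr ?mulr_gt0// => h.
  by have : 0 < t * cabs zt := mulr_gt0 t0 zt0'; lra.
have t2 : t * cabs zt < d1 by apply: half => //; rewrite !ge_min lexx orbT.
have t3 : t * cabs zt < dl by apply: half => //; rewrite !ge_min lexx !orbT.
pose h := toC t * zt.
have ch : cabs h = t * cabs zt by rewrite cabsM cabs_toC ger0_norm// ltW.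
exists (z + h); first by rewrite [z + h]addrC addrK ch.
have qh : cabs (q h - q 0) < cabs (q 0) by apply: Hd1; rewrite subr0 ch.
have tk : toC t ^+ k = toC (t ^+ k) by rewrite toCX.
have -> : f (z + h) = f z * toC (1 - t ^+ k) + h ^+ k * (q h - q 0).
  have E := H h; rewrite /g in E.
  rewrite mulrBr -E /h exprMn ztk tk toCD toCN toC1.
  by field.
have tk0 : 0 < t ^+ k by rewrite exprn_gt0.
have tk1 : t ^+ k <= 1 by rewrite exprn_ile1//; lra.
apply: le_lt_trans (cabsD _ _) _.
rewrite !cabsM cabs_toC ger0_norm ?subr_ge0// /h exprMn ztk tk cabsM cabs_toC (ger0_norm (ltW tk0)).
rewrite cabs_div cabsN.
have fz' : 0 < cabs (f z) by rewrite cabs_gt0.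
have : t ^+ k * (cabs (f z) / cabs (q 0) * cabs (q h - q 0)) < t ^+ k * cabs (f z).
  by rewrite ltr_pM2l// -mulrA gtr_pMr// ltr_pdivrMl// mulr1.
by rewrite mulrA; lra.
Qed.

(** If |f(0)| were below m, the infimum of |f| over the disc would be too, so it
    would not be approached near the circle; by bisection it would be attained
    inside, against [local_decrease]. *)
Lemma minimum_principle f s m : 0 <= s -> entire f ->
  (forall w, cabs w <= s -> f w != 0) ->
  (forall w, cabs w = s -> m <= cabs (f w)) -> m <= cabs (f 0).
Proof.
move=> s0 ef f0 fm; rewrite leNgt; apply/negP => lt.
have cs : cabs (toC s) = s by rewrite cabs_toC ger0_norm.
have nc z : exists w, f w != f z.
  apply: contrapT => /forallNP H.
  have E w : f w = f z by apply/eqP/negPn/negP; exact: H.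
  by have := fm _ cs; rewrite E -(E 0) leNgt lt.
pose S := [set cabs (f w) | w in [set w | cabs w <= s]].
have S0 : S !=set0.
  by exists (cabs (f 0)); exists 0 => //; rewrite /mkset cabs0.
have Slb : has_lbound S by exists 0 => _ [w _ <-]; exact: cabs_ge0.
pose mu := inf S.
have muP w : cabs w <= s -> mu <= cabs (f w) by move=> ws; apply: ge_inf => //; exists w.
have mu0 : mu < m by apply: le_lt_trans lt; apply: muP; rewrite cabs0.
have cf := entire_ccont ef.
pose P x y t := exists2 eta : R, 0 < eta & forall w, cabs w <= s ->
  x <= cre w <= x + t -> y <= cim w <= y + t -> mu + eta <= cabs (f w).
have [eta eta0 Heta] : P (- s) (- s) (s + s + 1).
  apply: (@square_ind R P); first by lra.
  - move=> x y t t0 [n1 n10 h1] [n2 n20 h2] [n3 n30 h3] [n4 n40 h4].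
    exists (Num.min (Num.min n1 n2) (Num.min n3 n4)); first by rewrite !lt_min n10 n20 n30 n40.
    have L1 : Num.min (Num.min n1 n2) (Num.min n3 n4) <= n1 by rewrite !ge_min lexx.
    have L2 : Num.min (Num.min n1 n2) (Num.min n3 n4) <= n2 by rewrite !ge_min lexx !orbT.
    have L3 : Num.min (Num.min n1 n2) (Num.min n3 n4) <= n3 by rewrite !ge_min lexx !orbT.
    have L4 : Num.min (Num.min n1 n2) (Num.min n3 n4) <= n4 by rewrite !ge_min lexx !orbT.
    move: (Num.min _ _) L1 L2 L3 L4 => n L1 L2 L3 L4 w ws xw yw.
    have [wx|wx] := leP (cre w) (x + t); have [wy|wy] := leP (cim w) (y + t).
    + by have : mu + n1 <= cabs (f w); [apply: h1 => //; lra|lra].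
    + by have : mu + n3 <= cabs (f w); [apply: h3 => //; lra|lra].
    + by have : mu + n2 <= cabs (f w); [apply: h2 => //; lra|lra].
    + by have : mu + n4 <= cabs (f w); [apply: h4 => //; lra|lra].
  - move=> u v _ _; pose z : K := Complex u v.
    have near (dl t x y : R) w : 0 < t < dl / 2 -> x <= u <= x + t -> y <= v <= y + t ->
        x <= cre w <= x + t -> y <= cim w <= y + t -> cabs (w - z) < dl.
      move=> tt xu yv xw yw; apply: le_lt_trans (cabs_le_creim _) _; rewrite creB cimB /=.
      have h1 : `|cre w - u| <= t by rewrite ler_norml; lra.
      have h2 : `|cim w - v| <= t by rewrite ler_norml; lra.
      by lra.
    have [zs|zs] := ltP s (cabs z).
      exists ((cabs z - s) / 2); first by rewrite divr_gt0// subr_gt0.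
      move=> x y t tt xu yv; exists 1 => // w ws xw yw.
      have := near _ _ _ _ w tt xu yv xw yw; have := cabs_subr z w; rewrite cabsC; lra.
    suff muz : mu < cabs (f z).
      have e0 : 0 < (cabs (f z) - mu) / 2 by rewrite divr_gt0// subr_gt0.
      have [dl dl0 Hdl] := cf z _ e0; exists (dl / 2); first by rewrite divr_gt0.
      move=> x y t tt xu yv; exists ((cabs (f z) - mu) / 2) => // w ws xw yw.
      have := Hdl w (near _ _ _ _ w tt xu yv xw yw).
      by have := cabs_subr (f z) (f w); rewrite cabsC; lra.
    have [zs'|zs'] := eqVneq (cabs z) s; first by apply: lt_le_trans mu0 _; exact: fm.
    rewrite lt_neqAle muP// andbT; apply/eqP => E.
    have zlt : 0 < s - cabs z by rewrite subr_gt0 lt_neqAle zs' zs.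
    have [w wz] := local_decrease ef (f0 z zs) (nc z) zlt.
    rewrite -E ltNge muP//; have := cabs_subr w z; lra.
suff : mu + eta <= mu by rewrite gerDl leNgt eta0.
apply: lb_le_inf => // _ [w /= ws <-]; apply: Heta => //.
  by have := cre_le w; rewrite ler_norml; lra.
by have := cim_le w; rewrite ler_norml; lra.
Qed.
End Entire.
Arguments entire_sum {R} [I] s P [F] _.
Arguments entire_prod {R} [I] s P [F] _.
Arguments entire_subc {R} z _ : rename.
Arguments entireX {R} [f] n _.
Arguments entire_horner {R} p _ : rename.
Arguments entire_cst {R} c _ : rename.
Arguments entire_derive1n {R} i [f] _.
Arguments derive1nB {R} i [f g] _ _.

(** * Roots of unity and coefficient estimates for polynomials *)

Section RootsOfUnity.
Variable R : realType.
Local Notation K := (C R).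
Implicit Types (x y s b e t M A B r rho : R) (z w h c d : K) (p q : {poly K}).

Lemma circ1D s t : circ 1 s * circ 1 t = circ 1 (s + t) :> K.
Proof.
by apply: creim_eq; rewrite ?creM ?cimM /= !mul1r ?cosD ?sinD// addrC.
Qed.

Lemma circ1X t n : circ 1 t ^+ n = circ 1 (n%:R * t) :> K.
Proof.
elim: n => [|n IH].
  by rewrite expr0 mul0r; apply: creim_eq; rewrite /= mul1r ?cos0 ?sin0.
by rewrite exprS IH circ1D -natr1 mulrDl mul1r addrC.
Qed.

Lemma circ1_neq1 t : 0 < t < tp R -> circ 1 t != 1 :> K.
Proof.
move=> /andP[t0 t2]; apply/eqP => E.
have : cos t = 1 by have := congr1 (@cre R) E; rewrite /= mul1r.
have -> : t = (t / 2) *+ 2 by rewrite -mulr_natr divfK.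
rewrite cos_mulr2n cos2sin2 => H.
have : 0 < sin (t / 2).
  apply: sin_gt0_pi; rewrite divr_gt0//= ltr_pdivrMr//.
  by move: t2; rewrite /tp mulr2n; lra.
have : sin (t / 2) ^+ 2 = 0 by move: H; rewrite mulr2n; lra.
by move=> /eqP; rewrite sqrf_eq0 => /eqP ->; rewrite ltxx.
Qed.

(** Sampling a polynomial at the N-th roots of unity replaces integrals over the
    circle by finite sums, which are exact when N exceeds the size. *)
Definition unity_root_of N : K := circ 1 (tp R / N%:R).
Local Notation om := unity_root_of.

Lemma cabs_om N : cabs (om N) = 1.
Proof. by rewrite cabs_circ. Qed.

Lemma om_expN N : (0 < N)%N -> om N ^+ N = 1.
Proof.
move=> N0; rewrite circ1X mulrC divfK ?pnatr_eq0 -?lt0n//.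
by apply: creim_eq; rewrite /= mul1r ?cos2pi ?sin2pi.
Qed.

Lemma om_exp_neq1 N m : (0 < m < N)%N -> om N ^+ m != 1.
Proof.
move=> /andP[m0 mN]; rewrite circ1X; apply: circ1_neq1.
have N0 : 0 < N%:R :> R by rewrite ltr0n (leq_trans _ mN).
have t0 := tp_gt0 R.
have m0' : 0 < m%:R :> R by rewrite ltr0n.
apply/andP; split; first exact: mulr_gt0 m0' (divr_gt0 t0 N0).
by rewrite mulrCA gtr_pMr// ltr_pdivrMr// mul1r ltr_nat.
Qed.

Lemma om_neq0 N : om N != 0.
Proof. by rewrite -cabs_gt0 cabs_om. Qed.

Lemma om_sum N m : (0 < m < N)%N -> \sum_(j < N) (om N ^+ m) ^+ j = 0.
Proof.
move=> mN; have N0 : (0 < N)%N by case/andP: mN => _; exact: leq_trans.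
have := subrX1 (om N ^+ m) N; rewrite -exprM mulnC exprM om_expN// expr1n subrr.
by move/esym/eqP; rewrite mulf_eq0 subr_eq0 (negbTE (om_exp_neq1 mN)) => /eqP.
Qed.

Lemma conjc_cabs1 z : cabs z = 1 -> conjc z = z^-1.
Proof.
move=> z1; have z0 : z != 0 by rewrite -cabs_gt0 z1.
apply: (mulfI z0); rewrite divff//.
have : cabs z ^+ 2 = 1 by rewrite z1 expr1n.
rewrite cabs_sqr; case: (z) => a b /= H.
by apply: creim_eq; rewrite ?creM ?cimM /= -?H; ring.
Qed.

Lemma cre_conj z : toC (2 * cre z) = z + conjc z.
Proof. by case: z => a b; apply: creim_eq; rewrite ?creD ?cimD /=; ring. Qed.

(** Fourier inversion on the group of N-th roots of unity. *)
Lemma dft_coef p N m : (size p <= N)%N -> (m < N)%N ->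
  \sum_(j < N) p.[om N ^+ j] * (om N ^+ j) ^- m = N%:R * p`_m.
Proof.
move=> pN mN.
have N0 : (0 < N)%N by exact: leq_trans mN.
have E (l : 'I_N) : \sum_(j < N) (om N ^+ j) ^+ l * (om N ^+ j) ^- m = if l == Ordinal mN then N%:R else 0.
  case: eqP => [->|/eqP lm].
    under eq_bigr => j _ do rewrite divff ?expf_neq0 ?om_neq0//.
    by rewrite sumr_const card_ord.
  have [ml|lm'|ml] := ltngtP m l; last by move: lm; rewrite -val_eqE /= ml eqxx.
  - under eq_bigr => j _ do rewrite -expfB// -exprM mulnC exprM.
    by apply: om_sum; rewrite subn_gt0 ml (leq_ltn_trans (leq_subr _ _)).
  - under eq_bigr => j _.
      rewrite (_ : _ * _ = (om N ^+ (N - (m - l))) ^+ j); first over.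
      have x0 : (om N ^+ j) ^+ m != 0 by rewrite !expf_neq0 ?om_neq0.
      apply: (mulIf x0); rewrite divfK// -[X in _ = X ^+ _ * _]/(om N ^+ _) -[X in _ = X * _]exprM mulnC exprM -exprD.
      have -> : (N - (m - l) + m = N + l)%N by lia.
      by rewrite exprD -[_ ^+ N]exprM mulnC exprM om_expN// expr1n mul1r.
    by apply: om_sum; lia.
under eq_bigr => j _ do rewrite (horner_coef_wide _ pN) mulr_suml.
rewrite exchange_big /=.
under eq_bigr => l _.
  under eq_bigr => j _ do rewrite -mulrA.
  rewrite -mulr_sumr E; over.
rewrite (bigD1 (Ordinal mN)) //= eqxx big1 ?addr0 1?mulrC// => l /negbTE ->.
by rewrite mulr0.
Qed.

Lemma coef_le_circle p M m : (forall z, cabs z = 1 -> cabs p.[z] <= M) -> cabs p`_m <= M.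
Proof.
move=> pM; pose N := maxn (size p) m.+1.
have N0 : 0 < N%:R :> R by rewrite ltr0n leq_max orbT.
have := @dft_coef p N m (leq_maxl _ _) (leq_maxr _ _) => /(congr1 (@cabs R)).
rewrite cabsM cabs_nat => E.
rewrite -(ler_pM2l N0) -E; apply: le_trans (cabs_sum _ _ _) _.
rewrite mulr_natl -[N in _ *+ N]card_ord -sumr_const; apply: ler_sum => j _.
rewrite cabsM cabsV !cabsX cabs_om !expr1n invr1 mulr1.
by apply: pM; rewrite cabsX cabs_om expr1n.
Qed.

Lemma coef_scale p c m : (p \Po (c *: 'X))`_m = c ^+ m * p`_m.
Proof.
rewrite comp_polyE coef_sum.
under eq_bigr => i _ do rewrite exprZn coefZ coefZ coefXn.
have [ms|ms] := ltnP m (size p).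
  rewrite (bigD1 (Ordinal ms)) //= eqxx mulr1 big1 ?addr0 1?mulrC// => i im.
  by rewrite eq_sym -[_ == _]/(i == Ordinal ms) (negbTE im) !mulr0.
rewrite big1 => [|i _]; first by rewrite (nth_default _ ms) mulr0.
by rewrite gtn_eqF ?mulr0// (leq_trans (ltn_ord i)).
Qed.

Lemma horner_scale p c z : (p \Po (c *: 'X)).[z] = p.[c * z].
Proof. by rewrite horner_comp hornerZ hornerX. Qed.

Lemma coef_le_circle_radius p rho M m : 0 < rho -> (forall z, cabs z = rho -> cabs p.[z] <= M) ->
  cabs p`_m * rho ^+ m <= M.
Proof.
move=> r0 pM.
have := @coef_le_circle (p \Po (toC rho *: 'X)) M m.
rewrite coef_scale cabsM cabsX cabs_toC (ger0_norm (ltW r0)) mulrC; apply.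
by move=> z z1; rewrite horner_scale; apply: pM; rewrite cabsM z1 mulr1 cabs_toC ger0_norm ?ltW.
Qed.

(** For m > 0 the m-th Fourier coefficients of p and of 2 Re p agree, and that of
    the constant B vanishes; so up to sign the coefficient is the mean of 2 (B - Re p)
    times a unimodular factor.  Its modulus is at most the mean of the
    non-negative function 2 (B - Re p), which is 2 B because p(0) = 0. *)
Lemma borel_caratheodory p rho B : 0 < rho -> p.[0] = 0 ->
  (forall z, cabs z = rho -> cre p.[z] <= B) -> forall m, cabs p`_m * rho ^+ m <= 2 * B.
Proof.
move=> r0 p0 pB.
pose q := p \Po (toC rho *: 'X).
have q0 : q`_0 = 0 by rewrite -horner_coef0 horner_scale mulr0.
have qB z : cabs z = 1 -> cre q.[z] <= B.
  by move=> z1; rewrite horner_scale; apply: pB; rewrite cabsM z1 mulr1 cabs_toC ger0_norm ?ltW.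
have qm m : cabs p`_m * rho ^+ m = cabs q`_m.
  by rewrite coef_scale cabsM cabsX cabs_toC (ger0_norm (ltW r0)) mulrC.
move=> m; rewrite qm {qm}.
pose N := (size q + m).+1.
have N0 : 0 < N%:R :> R by rewrite ltr0n.
have omj1 (j : nat) : cabs (om N ^+ j) = 1 by rewrite cabsX cabs_om expr1n.
have sN : (size q <= N)%N by rewrite leqW// leq_addr.
(* twice the real part has the same m-th Fourier coefficient, for m > 0 *)
have conj_sum k : (0 < k)%N -> (k <= m)%N -> \sum_(j < N) conjc q.[om N ^+ j] * (om N ^+ j) ^- k = 0.
  move=> k0 km.
  have -> : \sum_(j < N) conjc q.[om N ^+ j] * (om N ^+ j) ^- k =
     conjc (\sum_(j < N) q.[om N ^+ j] * (om N ^+ j) ^+ k).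
    rewrite rmorph_sum; apply: eq_bigr => j _; rewrite rmorphM; congr (_ * _).
    by apply/esym; apply: conjc_cabs1; rewrite cabsX omj1 expr1n.
  rewrite (_ : \sum_(j < N) _ = \sum_(j < N) (q * 'X^k).[om N ^+ j] * (om N ^+ j) ^- 0).
    rewrite dft_coef ?coefMXn ?k0 ?mulr0 ?conjc0//.
    by rewrite (leq_trans (size_polyMleq _ _))// size_polyXn addnS /= leqW// leq_add2l.
  by apply: eq_bigr => j _; rewrite hornerM hornerXn expr0 invr1 mulr1.
have re0 : \sum_(j < N) cre q.[om N ^+ j] = 0.
  have := @dft_coef q N 0 sN isT; rewrite q0 mulr0 => /(congr1 (@cre R)); rewrite cre_sum /= => E.
  by rewrite -[RHS]E; apply: eq_bigr => j _; rewrite expr0 invr1 mulr1.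
have [m0|m0] := posnP m.
  rewrite m0 q0 cabs0 mulr_ge0//.
  have : \sum_(j < N) cre q.[om N ^+ j] <= \sum_(j < N) B by apply: ler_sum => j _; exact: qB.
  by rewrite re0 sumr_const card_ord -mulr_natr pmulr_lge0.
have E1 : \sum_(j < N) toC (2 * (cre q.[om N ^+ j] - B)) * (om N ^+ j) ^- m = N%:R * q`_m.
  rewrite -(dft_coef sN); last by rewrite ltnS leq_addl.
  have -> : \sum_(j < N) q.[om N ^+ j] * (om N ^+ j) ^- m = \sum_(j < N) q.[om N ^+ j] * (om N ^+ j) ^- m
    + \sum_(j < N) conjc q.[om N ^+ j] * (om N ^+ j) ^- m
    - toC (2 * B) * \sum_(j < N) (1 : {poly K}).[om N ^+ j] * (om N ^+ j) ^- m.
    have s1 : (size (1%R : {poly K}) <= N)%N by rewrite size_poly1.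
    have mN : (m < N)%N by rewrite ltnS leq_addl.
    by rewrite conj_sum// (dft_coef s1 mN) coef1 gtn_eqF// !mulr0 subr0 addr0.
  rewrite mulr_sumr -big_split -sumrB /=; apply: eq_bigr => j _.
  rewrite hornerC mul1r -mulrDl -mulrBl; congr (_ * _).
  by rewrite -cre_conj -toCN -toCD mulrBr.
have := congr1 (@cabs R) E1; rewrite cabsM cabs_nat => E2.
rewrite -(ler_pM2l N0) -E2; apply: le_trans (cabs_sum _ _ _) _.
apply: (@le_trans _ _ (\sum_(j < N) (2 * B - 2 * cre q.[om N ^+ j]))).
  apply: ler_sum => j _; rewrite cabsM cabsV cabsX omj1 expr1n invr1 mulr1 cabs_toC.
  by have := qB _ (omj1 j) => h; rewrite ler0_norm; lra.
by rewrite sumrB sumr_const card_ord -mulr_sumr re0 mulr0 subr0 -[leLHS]mulr_natl.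
Qed.

Lemma horner_le_coef p rho B z : 0 < rho -> p.[0] = 0 -> (forall m, cabs p`_m * rho ^+ m <= B) ->
  cabs z <= rho / 2 -> cabs p.[z] <= 2 * B * (cabs z / rho).
Proof.
move=> r0 p0 pB zr.
have B0 : 0 <= B by apply: le_trans (pB 0%N); rewrite mulr_ge0 ?cabs_ge0// exprn_ge0// ltW.
have := @psum_tail R (fun m => p`_m) rho B z 1 (size p) r0 pB zr.
have -> : psum (fun m => p`_m) (1 + size p) z = p.[z].
  by rewrite (@horner_coef_wide _ (1 + size p)) // add1n.
rewrite /psum big_ord_recl big_ord0 -horner_coef0 p0 mul0r addr0 subr0 expr1 => /le_trans; apply.
by rewrite ler_piMr// !mulr_ge0// ?cabs_ge0// invr_ge0 ltW.
Qed.
End RootsOfUnity.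

(** * Approximation on a circle by real parts of polynomials *)

Section CircleApprox.
Variable R : realType.
Local Notation K := (C R).
Implicit Types (x y s b e t M A B r rho q : R) (z w h c d : K) (u v : K -> R).
Local Notation om := (unity_root_of R).

Definition circ_cont u rho := forall z e, cabs z = rho -> 0 < e -> exists2 dl : R, 0 < dl &
  forall w, cabs w = rho -> cabs (w - z) < dl -> `|u w - u z| < e.

Lemma linear_expr_small q e : 0 <= q < 1 -> 0 < e -> exists n, n.*2.+1%:R * q ^+ n < e.
Proof.
move=> /andP[q0 q1] e0; pose s := (1 + q) / 2.
have s0 : 0 < s by rewrite /s; lra.
have s1 : s < 1 by rewrite /s; lra.
have qs : q <= s ^+ 2.
  have : 0 <= (1 - q) ^+ 2 by exact: sqr_ge0.
  rewrite /s; lra.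
have H n : (1 - s) * (n%:R * s ^+ n) <= 1 - s ^+ n.
  elim: n => [|n IH]; first by rewrite mul0r mulr0 expr0 subrr.
  rewrite -natr1 exprS.
  have h1 : s * ((1 - s) * (n%:R * s ^+ n)) <= s * (1 - s ^+ n) by rewrite ler_pM2l.
  have h2 : 0 <= (1 - s) * (1 - s * s ^+ n).
    by rewrite mulr_ge0 ?subr_ge0 ?(ltW s1)// -exprS exprn_ile1 ?ltW.
  by move: h1 h2; move: (s ^+ n) (n%:R) => P N; lra.
have D0 : 0 < 2 / (1 - s) + 1 by rewrite addr_gt0 ?divr_gt0 ?subr_gt0.
have [N HN] : exists N, forall n, (N <= n)%N -> s ^+ n < e / (2 / (1 - s) + 1).
  by apply: expr_small; rewrite ?divr_gt0// (ltW s0) s1.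
exists N; have := HN N (leqnn _); rewrite ltr_pdivlMr// mulrC => /(le_lt_trans _); apply.
have sN0 : 0 <= s ^+ N by rewrite exprn_ge0// ltW.
have qN : q ^+ N <= s ^+ N * s ^+ N by rewrite -expr2 -exprM mulnC exprM lerXn2r ?nnegrE ?exprn_ge0// ltW.
apply: le_trans (ler_wpM2l _ qN) _ => //; rewrite mulrA ler_wpM2r//.
rewrite -natr1 mulrDl mul1r; apply: lerD; last by rewrite exprn_ile1// ltW.
rewrite ler_pdivlMr ?subr_gt0// -muln2 natrM.
have := H N; lra.
Qed.

(** The central coefficient is the largest of the 2n + 1 coefficients of a row
    with sum 4^n. *)
Lemma central_bin_ge n : (4 ^ n <= n.*2.+1 * 'C(n.*2, n))%N.
Proof.
elim: n => [|n IH] //.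
have E1 := mul_bin_diag (n.+1.*2) n; rewrite doubleS /= in E1.
have E2 := mul_bin_diag (n.*2.+1) n; rewrite /= in E2.
have E3 : 'C(n.*2.+1, n) = 'C(n.*2.+1, n.+1).
  by rewrite -[in RHS]bin_sub; [congr 'C(_, _)|]; lia.
rewrite doubleS; rewrite E3 in E1.
rewrite expnS.
have k0 : (0 < n.+1 * n.+1)%N by [].
rewrite -(leq_pmul2l k0).
have -> : (n.+1 * n.+1 * (n.*2.+3 * 'C(n.*2.+2, n.+1)) = n.*2.+3 * (n.+1 * (n.+1 * 'C(n.*2.+2, n.+1))))%N by lia.
rewrite -E1.
have -> : (n.*2.+3 * (n.+1 * (n.*2.+2 * 'C(n.*2.+1, n.+1))) = n.*2.+3 * (n.*2.+2 * (n.+1 * 'C(n.*2.+1, n.+1))))%N by lia.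
rewrite -E2.
have -> : (n.*2.+3 * (n.*2.+2 * (n.*2.+1 * 'C(n.*2, n))) = n.*2.+3 * n.*2.+2 * (n.*2.+1 * 'C(n.*2, n)))%N by lia.
rewrite [(n.+1 * n.+1 * _)%N]mulnA; apply: leq_mul => //; lia.
Qed.

Lemma unit_inv z : cabs z = 1 -> cre z^-1 = cre z.
Proof. by move=> z1; rewrite -conjc_cabs1//; case: z {z1}. Qed.

Lemma parallelogram z w : cabs z = 1 -> cabs w = 1 -> cabs (z + w) ^+ 2 = 4 - cabs (w - z) ^+ 2.
Proof.
move=> z1 w1; have := cabs_sqr z; have := cabs_sqr w; rewrite z1 w1 !cabs_sqr !creB !cimB creD cimD.
by move: (cre z) (cim z) (cre w) (cim w) => a b c d h1 h2; lra.
Qed.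

(** A polynomial whose real part on the unit circle is the kernel |1 + z|^(2n):
    the terms of negative degree of the kernel are reflected, which does not
    change their real parts there. *)
Definition fejer_poly n : {poly K} :=
  \sum_(m < n.*2.+1) 'C(n.*2, m)%:R *: 'X^(m - n + (n - m)).

Lemma jackson_expansion n z : cabs z = 1 -> toC (cabs (1 + z) ^+ n.*2) = z ^- n * (1 + z) ^+ n.*2.
Proof.
move=> z1; have z0 : z != 0 by rewrite -cabs_gt0 z1.
rewrite -mul2n exprM toCX [X in X ^+ n](_ : _ = z^-1 * (1 + z) ^+ 2).
  by rewrite exprMn exprVn -exprM.
have -> : toC (cabs (1 + z) ^+ 2) = (1 + z) * conjc (1 + z).
  by rewrite cabs_sqr; case: (1 + z) => a b; apply: creim_eq; rewrite ?creM ?cimM /=; ring.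
have -> : conjc (1 + z) = 1 + z^-1.
  by rewrite -conjc_cabs1//; case: (z) => a b; apply: creim_eq; rewrite ?creD ?cimD /=; ring.
by field.
Qed.

Lemma fejer_polyE n z : cabs z = 1 -> cre (fejer_poly n).[z] = cabs (1 + z) ^+ n.*2.
Proof.
move=> z1; have z0 : z != 0 by rewrite -cabs_gt0 z1.
rewrite -[RHS]cre_toC jackson_expansion// exprDn mulr_sumr horner_sum !cre_sum.
apply: eq_bigr => m _; rewrite expr1n mul1r hornerZ hornerXn mulr_natl mulrnAr.
have creMn k (y : K) : cre (y *+ k) = cre y *+ k.
  by elim: k => [|k IH] //; rewrite !mulrS creD IH.
rewrite !creMn; congr (_ *+ _).
move: (nat_of_ord m) => l {m}.
have [ln|nl] := leqP l n.
  rewrite (eqP ln) add0n -unit_inv; last by rewrite cabsX z1 expr1n.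
  congr cre; rewrite -[in RHS](subnK ln) exprD invfM -mulrA mulVf ?mulr1//.
  by rewrite expf_neq0.
have nl' := ltnW nl.
rewrite (eqP nl') addn0; congr cre.
by rewrite -[in RHS](subnK nl') exprD mulrCA mulVf ?mulr1// expf_neq0.
Qed.

(** Expanding the kernel, only the constant term survives summation over the
    roots of unity. *)
Lemma fejer_sum n N z : (n.*2 < N)%N -> cabs z = 1 ->
  \sum_(j < N) cabs (z + om N ^+ j) ^+ n.*2 = N%:R * 'C(n.*2, n)%:R.
Proof.
move=> nN z1; have z0 : z != 0 by rewrite -cabs_gt0 z1.
apply: (@toC_inj R); rewrite toCM !toC_nat.
have toC_sum (I : finType) (F : I -> R) : toC (\sum_i F i) = \sum_i toC (F i).
  by apply: (big_morph (@toC R)); [exact: toCD|exact: toC0].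
rewrite toC_sum.
pose q : {poly K} := ((1 + 'X) ^+ n.*2) \Po (z^-1 *: 'X).
have cq : q`_n = z^-1 ^+ n * 'C(n.*2, n)%:R.
  rewrite coef_scale exprDn coef_sum; congr (_ * _).
  have nn : (n < n.*2.+1)%N by lia.
  rewrite (bigD1 (Ordinal nn)) //= expr1n mul1r coefMn coefXn eqxx big1 ?addr0// => i.
  rewrite expr1n mul1r coefMn coefXn => /negbTE im.
  by rewrite eq_sym -[_ == _]/(i == Ordinal nn) im mul0rn.
have sq : (size q <= N)%N.
  pose l1 : {poly K} := 1 + 'X; pose l2 : {poly K} := z^-1 *: 'X.
  have s1 : (size l1 <= 2)%N by rewrite /l1 addrC size_XaddC.
  have s2 : (size l2 <= 2)%N by rewrite (leq_trans (size_scale_leq _ _))// size_polyX.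
  apply: leq_trans (size_comp_poly_leq _ _) _.
  have s3 := size_poly_exp_leq l1 n.*2.
  have s4 : ((size l1).-1 * n.*2 <= 1 * n.*2)%N by apply: leq_mul => //; lia.
  have s5 : ((size (l1 ^+ n.*2)%R).-1 * (size l2).-1 <= n.*2 * 1)%N by apply: leq_mul; lia.
  by apply: leq_ltn_trans s5 _; lia.
have omu (j : nat) : cabs (om N ^+ j) = 1 by rewrite cabsX cabs_om expr1n.
rewrite (eq_bigr (fun j : 'I_N => z ^+ n * (q.[om N ^+ j] * (om N ^+ j) ^- n))).
  rewrite -mulr_sumr (dft_coef sq); last by lia.
  rewrite cq exprVn mulrA [z ^+ n * _]mulrC -!mulrA [z ^+ n * _]mulrA mulfV ?mul1r//.
  by rewrite expf_neq0.
move=> j _.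
have wz : cabs (z^-1 * om N ^+ j) = 1 by rewrite cabsM cabsV z1 omu invr1 mulr1.
have -> : cabs (z + om N ^+ j) = cabs (1 + z^-1 * om N ^+ j).
  by rewrite -[LHS]mul1r -[X in X * _]invr1 -{1}z1 -cabsV -cabsM mulrDr mulVf.
rewrite (jackson_expansion _ wz) /q horner_scale horner_exp hornerD hornerX hornerC.
rewrite exprMn invfM exprVn invrK -mulrA; congr (_ * _); exact: mulrC.
Qed.

(** Uniform continuity on a circle, by bisection of a square around it. *)
Lemma circ_unif u rho : circ_cont u rho -> exists2 dl : R, 0 < dl & forall z w,
  cabs z = rho -> cabs w = rho -> cabs (w - z) < dl -> `|u w - u z| < 1 / 2.
Proof.
move=> cu; have [r0|r0] := ltP rho 0.
  by exists 1 => // z w zr; have := cabs_ge0 z; lra.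
pose P x y t := exists2 dl : R, 0 < dl & forall z w, x <= cre z <= x + t -> y <= cim z <= y + t ->
  cabs z = rho -> cabs w = rho -> cabs (w - z) < dl -> `|u w - u z| < 1 / 2.
have [dl dl0 Hd] : P (- rho) (- rho) (rho + rho + 1); last first.
  exists dl => // z w zr; apply: Hd => //.
    by have := cre_le z; rewrite ler_norml; lra.
  by have := cim_le z; rewrite ler_norml; lra.
apply: (@square_ind R P); first by lra.
- move=> x y t t0 [n1 n10 h1] [n2 n20 h2] [n3 n30 h3] [n4 n40 h4].
  exists (Num.min (Num.min n1 n2) (Num.min n3 n4)); first by rewrite !lt_min n10 n20 n30 n40.
  move=> z w xw yw zr wr; rewrite !lt_min => /andP[/andP[g1 g2] /andP[g3 g4]].
  have [wx|wx] := leP (cre z) (x + t); have [wy|wy] := leP (cim z) (y + t).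
  + by apply: h1 => //; lra.
  + by apply: h3 => //; lra.
  + by apply: h2 => //; lra.
  + by apply: h4 => //; lra.
- move=> a b _ _; pose c : K := Complex a b.
  have near (dl t x y : R) w : 0 < t < dl / 2 -> x <= a <= x + t -> y <= b <= y + t ->
      x <= cre w <= x + t -> y <= cim w <= y + t -> cabs (w - c) < dl.
    move=> tt xu yv xw yw; apply: le_lt_trans (cabs_le_creim _) _; rewrite creB cimB /=.
    have h1 : `|cre w - a| <= t by rewrite ler_norml; lra.
    have h2 : `|cim w - b| <= t by rewrite ler_norml; lra.
    by lra.
  have [cr|cr] := eqVneq (cabs c) rho.
    have [dl dl0 Hd] := cu c (1/4) cr (divr_gt0 ltr01 (ltr0n _ 4)).
    exists (dl / 2 / 2); first by rewrite !divr_gt0.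
    move=> x y t tt xa yb; exists (dl / 2); first by rewrite divr_gt0.
    move=> z w xz yz zr wr wz.
    have zc : cabs (z - c) < dl / 2 := near _ _ _ _ z tt xa yb xz yz.
    have wc : cabs (w - c) < dl.
      by rewrite -(subrK z w) -addrA; apply: le_lt_trans (cabsD _ _) _; lra.
    have zc' : cabs (z - c) < dl by lra.
    by have := Hd z zr zc'; have := Hd w wr wc; rewrite !ltr_norml; lra.
  have d0 : 0 < `|cabs c - rho| by rewrite normr_gt0 subr_eq0.
  exists (`|cabs c - rho| / 2); first by rewrite divr_gt0.
  move=> x y t tt xa yb; exists 1 => // z w xz yz zr.
  have := near _ _ _ _ z tt xa yb xz yz; have := cabs_subr z c; have := cabs_subr c z.
  rewrite (cabsC c) zr => h1 h2 h3; exfalso; move: h3; rewrite ltNge => /negP; apply.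
  by rewrite ler_norml; lra.
Qed.

Lemma circ_bounded u rho : circ_cont u rho -> exists2 M : R, 0 <= M & forall z,
  cabs z = rho -> `|u z| <= M.
Proof.
move=> cu; have [r0|r0] := ltP rho 0.
  by exists 0 => // z zr; have := cabs_ge0 z; lra.
pose P x y t := exists2 M : R, 0 <= M & forall z, x <= cre z <= x + t -> y <= cim z <= y + t ->
  cabs z = rho -> `|u z| <= M.
have [M M0 Hd] : P (- rho) (- rho) (rho + rho + 1); last first.
  exists M => // z zr; apply: Hd => //.
    by have := cre_le z; rewrite ler_norml; lra.
  by have := cim_le z; rewrite ler_norml; lra.
apply: (@square_ind R P); first by lra.
- move=> x y t t0 [n1 n10 h1] [n2 n20 h2] [n3 n30 h3] [n4 n40 h4].
  exists (n1 + n2 + n3 + n4); first by lra.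
  move=> z xw yw zr.
  have [wx|wx] := leP (cre z) (x + t); have [wy|wy] := leP (cim z) (y + t).
  + by have : `|u z| <= n1; [apply: h1 => //; lra|lra].
  + by have : `|u z| <= n3; [apply: h3 => //; lra|lra].
  + by have : `|u z| <= n2; [apply: h2 => //; lra|lra].
  + by have : `|u z| <= n4; [apply: h4 => //; lra|lra].
- move=> a b _ _; pose c : K := Complex a b.
  have near (dl t x y : R) w : 0 < t < dl / 2 -> x <= a <= x + t -> y <= b <= y + t ->
      x <= cre w <= x + t -> y <= cim w <= y + t -> cabs (w - c) < dl.
    move=> tt xu yv xw yw; apply: le_lt_trans (cabs_le_creim _) _; rewrite creB cimB /=.
    have h1 : `|cre w - a| <= t by rewrite ler_norml; lra.
    have h2 : `|cim w - b| <= t by rewrite ler_norml; lra.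
    by lra.
  have [cr|cr] := eqVneq (cabs c) rho.
    have [dl dl0 Hd] := cu c 1 cr ltr01.
    exists (dl / 2); first by rewrite !divr_gt0.
    move=> x y t tt xa yb; exists (`|u c| + 1); first by rewrite addr_ge0.
    move=> z xz yz zr; have := Hd z zr (near _ _ _ _ z tt xa yb xz yz).
    by have := ler_dist_dist (u z) (u c); have := ler_norm (`|u z| - `|u c|); lra.
  have d0 : 0 < `|cabs c - rho| by rewrite normr_gt0 subr_eq0.
  exists (`|cabs c - rho| / 2); first by rewrite divr_gt0.
  move=> x y t tt xa yb; exists 0 => // z xz yz zr.
  have := near _ _ _ _ z tt xa yb xz yz; have := cabs_subr z c; have := cabs_subr c z.
  rewrite (cabsC c) zr => h1 h2 h3; exfalso; move: h3; rewrite ltNge => /negP; apply.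
  by rewrite ler_norml; lra.
Qed.

(** Means of u against the kernel |z + w|^(2n), which concentrates at w = z as n
    grows, taken as finite sums over roots of unity: they are real parts of
    polynomials and converge uniformly. *)
Lemma unit_circle_approx u : circ_cont u 1 -> exists p : {poly K}, forall z,
  cabs z = 1 -> `|cre p.[z] - u z| <= 1.
Proof.
move=> cu; have [dl0 dl00 Hdl0] := circ_unif cu; have [M M0 HM] := circ_bounded cu.
pose dl := Num.min dl0 1.
have dlp : 0 < dl by rewrite lt_min dl00 ltr01.
have dl1 : dl <= 1 by rewrite ge_min lexx orbT.
have Hdl z w : cabs z = 1 -> cabs w = 1 -> cabs (w - z) < dl -> `|u w - u z| < 1 / 2.
  by move=> z1 w1; rewrite lt_min => /andP[h _]; exact: Hdl0.
pose q := 1 - dl ^+ 2 / 4.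
have dl2 : 0 < dl ^+ 2 <= 1 by rewrite exprn_gt0//= exprn_ile1// ltW.
have q01 : 0 <= q < 1 by rewrite /q; lra.
have M10 : 0 < 2 * M + 1 by lra.
have e0 : 0 < 1 / 2 / (2 * M + 1) by rewrite !divr_gt0.
have [n Hn] := linear_expr_small q01 e0.
pose N := n.*2.+1.
pose T := N%:R * 'C(n.*2, n)%:R : R.
have C0 : 0 < 'C(n.*2, n)%:R :> R by rewrite ltr0n bin_gt0 -addnn leq_addr.
have T0 : 0 < T by rewrite mulr_gt0.
pose p : {poly K} := \sum_(j < N) toC (u (om N ^+ j) / T) *: (fejer_poly n \Po ((om N ^+ j)^-1 *: 'X)).
have omu (j : nat) : cabs (om N ^+ j) = 1 by rewrite cabsX cabs_om expr1n.
exists p => z z1.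
pose k (j : 'I_N) := cabs (z + om N ^+ j) ^+ n.*2 / T.
have k0 j : 0 <= k j by rewrite divr_ge0 ?(ltW T0)// exprn_ge0// cabs_ge0.
have ksum : \sum_(j < N) k j = 1 by rewrite -mulr_suml fejer_sum// divff// gt_eqF.
have pE : cre p.[z] = \sum_(j < N) u (om N ^+ j) * k j.
  rewrite horner_sum cre_sum; apply: eq_bigr => j _.
  rewrite hornerZ horner_scale creM /= mul0r subr0 fejer_polyE; last first.
    by rewrite cabsM cabsV omu invr1 mul1r.
  rewrite /k mulrAC mulrA; congr (_ * _ ^+ _ / _).
  rewrite -[LHS]mul1r -{1}(omu j) -cabsM mulrDr mulr1 mulrA mulfV ?mul1r 1?addrC//.
  by rewrite expf_neq0// om_neq0.
rewrite pE -[u z]mulr1 -ksum mulr_sumr -sumrB.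
apply: le_trans (ler_norm_sum _ _ _) _.
pose Q := q ^+ n * 4 ^+ n / T.
have Q0 : 0 <= Q by rewrite divr_ge0 ?(ltW T0)// mulr_ge0// exprn_ge0//; case/andP: q01.
have MQ : 0 <= 2 * M * Q := mulr_ge0 (mulr_ge0 (ler0n _ 2) M0) Q0.
have bound (j : 'I_N) : `|u (om N ^+ j) * k j - u z * k j| <= 1 / 2 * k j + 2 * M * Q.
  rewrite -mulrBl normrM (ger0_norm (k0 j)).
  have [near|far] := ltP (cabs (om N ^+ j - z)) dl.
    apply: (@le_trans _ _ (1 / 2 * k j)); first by rewrite ler_wpM2r// ltW// Hdl.
    by rewrite lerDl.
  apply: (@le_trans _ _ (2 * M * Q)); last by rewrite lerDr mulr_ge0.
  apply: ler_pM => //.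
    by apply: le_trans (ler_normB _ _) _; have := HM _ (omu j); have := HM _ z1; lra.
  rewrite /k /Q ler_wpM2r ?invr_ge0 ?(ltW T0)// -mul2n exprM parallelogram//.
  have h1 : 0 <= 4 - cabs (om N ^+ j - z) ^+ 2 by rewrite -parallelogram// sqr_ge0.
  have h2 : 0 <= q * 4 by rewrite mulr_ge0//; case/andP: q01.
  have h3 : 4 - cabs (om N ^+ j - z) ^+ 2 <= q * 4.
    have : dl ^+ 2 <= cabs (om N ^+ j - z) ^+ 2 by rewrite lerXn2r ?nnegrE ?cabs_ge0// ltW.
    by rewrite /q; lra.
  by rewrite -exprMn lerXn2r ?nnegrE.
apply: le_trans (ler_sum _ (fun j _ => bound j)) _.
rewrite big_split /= -mulr_sumr ksum mulr1 sumr_const card_ord -mulr_natl.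
suff : N%:R * (2 * M * Q) <= 1 / 2 by lra.
have NQ : N%:R * Q <= N%:R * q ^+ n.
  rewrite ler_wpM2l// /Q -mulrA ler_piMr ?exprn_ge0//; first by case/andP: q01.
  rewrite ler_pdivrMr// mul1r /T -natrM -natrX ler_nat; exact: central_bin_ge.
have NQ' : N%:R * Q <= 1 / 2 / (2 * M + 1) by apply: le_trans NQ _; exact: ltW.
rewrite mulrCA; apply: (@le_trans _ _ (2 * M * (1 / 2 / (2 * M + 1)))).
  by rewrite ler_wpM2l// mulr_ge0.
by rewrite mulrCA ler_piMr// ler_pdivrMr// mul1r lerDl.
Qed.

(** By scaling; an error of size one is enough because only logarithms up to
    bounded errors are compared. *)
Lemma circle_approx u rho : 0 < rho -> circ_cont u rho -> exists p : {poly K}, forall z,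
  cabs z = rho -> `|cre p.[z] - u z| <= 1.
Proof.
move=> r0 cu; have cr : cabs (toC rho) = rho by rewrite cabs_toC ger0_norm// ltW.
have r0' : toC rho != 0 by rewrite -cabs_gt0 cr.
have [|p Hp] := @unit_circle_approx (fun z => u (toC rho * z)).
  move=> z e z1 e0; have [|dl dl0 H] := cu (toC rho * z) e _ e0; first by rewrite cabsM cr z1 mulr1.
  exists (dl / rho); first by rewrite divr_gt0.
  move=> w w1; rewrite ltr_pdivlMr// => wz; apply: H; first by rewrite cabsM cr w1 mulr1.
  by rewrite -mulrBr cabsM cr mulrC.
exists (p \Po ((toC rho)^-1 *: 'X)) => z zr; rewrite horner_scale.
have := Hp ((toC rho)^-1 * z); rewrite mulrA mulfV// mul1r; apply.
by rewrite cabsM cabsV cr zr mulVf// gt_eqF.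
Qed.
End CircleApprox.

(** * The coefficient norm and the minimum modulus of polynomials *)

Section PolyNorm.
Variable R : realType.
Local Notation K := (C R).
Implicit Types (x y s b e t M A B r rho : R) (z w h c d : K) (p q : {poly K}).

(** The sum of the moduli of the coefficients: multiplicative up to a factor
    exponential in the degree, and comparable with the maximum on the unit
    circle. *)
Definition pnorm p : R := \sum_(i < size p) cabs p`_i.

Lemma pnorm_wide p N : (size p <= N)%N -> pnorm p = \sum_(i < N) cabs p`_i.
Proof.
move=> pN; rewrite /pnorm (big_ord_widen _ (fun i => cabs p`_i) pN).
rewrite [RHS](bigID (fun i : 'I_N => (i < size p)%N)) /= [X in _ = _ + X]big1 ?addr0// => i.
by rewrite -leqNgt => /(nth_default _) ->; rewrite cabs0.
Qed.

Lemma pnorm_ge0 p : 0 <= pnorm p.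
Proof. by apply: sumr_ge0 => i _; exact: cabs_ge0. Qed.

Lemma pnorm0 : pnorm 0 = 0.
Proof. by rewrite /pnorm size_poly0 big_ord0. Qed.

Lemma coef_le_pnorm p i : cabs p`_i <= pnorm p.
Proof.
have [ip|pi] := ltnP i (size p); last by rewrite nth_default// cabs0 pnorm_ge0.
rewrite /pnorm (bigD1 (Ordinal ip)) //= lerDl sumr_ge0// => j _; exact: cabs_ge0.
Qed.

Lemma pnorm_gt0 p : p != 0 -> 0 < pnorm p.
Proof.
by move=> p0; apply: lt_le_trans (coef_le_pnorm p (size p).-1); rewrite cabs_gt0 -lead_coefE lead_coef_eq0.
Qed.

Lemma pnormD p q : pnorm (p + q) <= pnorm p + pnorm q.
Proof.
pose N := maxn (size p) (size q).
rewrite (@pnorm_wide _ N) ?size_polyD// (@pnorm_wide p N) ?leq_maxl// (@pnorm_wide q N) ?leq_maxr//.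
by rewrite -big_split /=; apply: ler_sum => i _; rewrite coefD cabsD.
Qed.

Lemma pnormZ c p : pnorm (c *: p) = cabs c * pnorm p.
Proof.
rewrite (@pnorm_wide _ (size p)) ?size_scale_leq// /pnorm mulr_sumr.
by apply: eq_bigr => i _; rewrite coefZ cabsM.
Qed.

Lemma pnormN p : pnorm (- p) = pnorm p.
Proof. by rewrite -scaleN1r pnormZ cabsN cabs1 mul1r. Qed.

Lemma pnorm_sum (I : Type) (s : seq I) (P : pred I) (F : I -> {poly K}) :
  pnorm (\sum_(i <- s | P i) F i) <= \sum_(i <- s | P i) pnorm (F i).
Proof.
elim/big_ind2: _ => [|p x q y px qy|//]; first by rewrite pnorm0.
by apply: le_trans (pnormD _ _) _; apply: lerD.
Qed.

Lemma pnormXnM i p : pnorm ('X^i * p) = pnorm p.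
Proof.
have [->|p0] := eqVneq p 0; first by rewrite mulr0.
rewrite (@pnorm_wide ('X^i * p) (i + size p)); last first.
  by rewrite (leq_trans (size_polyMleq _ _))// size_polyXn.
rewrite big_split_ord /= big1 ?add0r => [|j _]; last by rewrite coefXnM ltn_ord cabs0.
by apply: eq_bigr => j _; rewrite coefXnM ltnNge leq_addr /= addKn.
Qed.

Lemma pnormM p q : pnorm (p * q) <= pnorm p * pnorm q.
Proof.
rewrite -{1}(coefK p) poly_def mulr_suml; apply: le_trans (pnorm_sum _ _ _) _.
rewrite {2}/pnorm mulr_suml; apply: ler_sum => i _.
by rewrite -scalerAl pnormZ pnormXnM.
Qed.

Lemma pnorm1 : pnorm 1 = 1.
Proof. by rewrite /pnorm size_poly1 big_ord1 coef1 cabs1. Qed.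

Lemma pnormX p n : pnorm (p ^+ n) <= pnorm p ^+ n.
Proof.
elim: n => [|n IH]; first by rewrite !expr0 pnorm1.
rewrite !exprS; apply: le_trans (pnormM _ _) _; apply: ler_wpM2l => //; exact: pnorm_ge0.
Qed.

Lemma pnorm_le p N M : (size p <= N)%N -> (forall i, cabs p`_i <= M) -> pnorm p <= N%:R * M.
Proof.
move=> pN pM; rewrite (pnorm_wide pN) mulr_natl -[N in _ *+ N]card_ord -sumr_const.
by apply: ler_sum.
Qed.

Lemma horner_le_pnorm p z r N : 1 <= r -> cabs z <= r -> (size p <= N)%N ->
  cabs p.[z] <= r ^+ N * pnorm p.
Proof.
move=> r1 zr pN; rewrite horner_coef; apply: le_trans (cabs_sum _ _ _) _.
rewrite /pnorm mulr_sumr; apply: ler_sum => i _; rewrite cabsM cabsX mulrC.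
apply: ler_wpM2r; first exact: cabs_ge0.
apply: (@le_trans _ _ (r ^+ i)).
  by rewrite lerXn2r ?nnegrE ?cabs_ge0//; lra.
by rewrite ler_weXn2l// (leq_trans (ltnW (ltn_ord i))).
Qed.

Lemma horner_le_pnorm1 p z : cabs z <= 1 -> cabs p.[z] <= pnorm p.
Proof.
by move=> z1; have := @horner_le_pnorm p z 1 (size p) (lexx _) z1 (leqnn _); rewrite expr1n mul1r.
Qed.

(** With rho = 3/2 + Re w/2 and w on the unit circle, the product of
    (rho - x)/(1 + x) is, up to a unimodular factor, a polynomial Q(w).  At the
    root w0 of w^2 + 10 w + 1 its factors have modulus |w0|, so Q is not small
    there, nor are its coefficients; hence neither is its maximum on
    the circle. *)
Lemma prod_root_distance (xs : seq R) : (forall x, x \in xs -> 0 <= x) ->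
  exists2 rho : R, 1 <= rho <= 2 &
    \prod_(x <- xs) (1 + x) <= 20 * (10 ^+ 4) ^+ size xs * \prod_(x <- xs) `|rho - x|.
Proof.
move=> xs0; pose D := size xs.
pose F x : {poly K} := (toC (1 + x))^-1 *: (4^-1 *: ('X^2 + 6 *: 'X + 1) - toC x *: 'X).
pose Q := \prod_(x <- xs) F x.
pose rhow w := 3 / 2 + cre w / 2.
have sF x : (size (F x) <= 3)%N.
  apply: leq_trans (size_scale_leq _ _) _; apply: leq_trans (size_polyD _ _) _.
  rewrite geq_max size_polyN !(leq_trans (size_scale_leq _ _)) ?size_polyX//.
  rewrite (leq_trans (size_polyD _ _))// geq_max size_poly1 andbT.
  by rewrite (leq_trans (size_polyD _ _))// geq_max size_polyXn (leq_trans (size_scale_leq _ _)) ?size_polyX.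
have sQ : (size Q <= (2 * D).+1)%N.
  rewrite /Q /D; elim: (xs) => [|x s IH]; first by rewrite big_nil size_poly1.
  rewrite big_cons; apply: leq_trans (size_polyMleq _ _) _.
  move: (sF x) IH; move: (size (F x)) (size (\prod_(j <- s) F j)) => A B.
  by rewrite /=; lia.
have FE x w : cabs w = 1 -> 0 <= x -> cabs (F x).[w] = `|rhow w - x| / (1 + x).
  move=> w1 x0; have w0 : w != 0 by rewrite -cabs_gt0 w1.
  rewrite /F hornerZ cabsM cabsV cabs_toC (ger0_norm (_ : 0 <= 1 + x)); last by lra.
  rewrite mulrC; congr (_ / _).
  rewrite !(hornerD, hornerN, hornerZ, hornerX, hornerXn, hornerC).
  have -> : 4^-1 * (w ^+ 2 + 6 * w + 1) - toC x * w = w * toC (rhow w - x).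
    have -> : toC (rhow w - x) = 4^-1 * (w + w^-1 + 6) - toC x.
      rewrite -(conjc_cabs1 w1) -cre_conj toCD toCN; congr (_ - _).
      apply: (mulfI (_ : 4 != 0)); first by rewrite pnatr_eq0.
      rewrite mulrA mulfV ?pnatr_eq0// mul1r /rhow -[4](toC_nat R 4) -[6](toC_nat R 6) -toCM -toCD.
      by congr toC; field.
    by field.
  by rewrite cabsM w1 mul1r cabs_toC.
pose s24 : R := Num.sqrt 24; pose w0 : R := - 5 - s24.
have s24_2 : s24 ^+ 2 = 24 by rewrite sqr_sqrtr.
have s24_0 : 0 <= s24 by exact: sqrtr_ge0.
have s24_5 : s24 <= 5.
  by rewrite -(ler_pXn2r (_ : 0 < 2)%N) ?nnegrE// s24_2 -natrX ler_nat.
(* w0 solves w^2 + 10 w + 1 = 0, which makes the root term of each factor drop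
   out: F x takes the value - w0 for every x. *)
have w0E : w0 ^+ 2 + 6 * w0 + 1 = - 4 * w0.
  by rewrite /w0; have : s24 * s24 = 24 by []; lra.
have cw0 : cabs (toC w0) = 5 + s24 by rewrite cabs_toC ler0_norm /w0; lra.
have Fw0 x : 0 <= x -> (F x).[toC w0] = - toC w0.
  move=> x0; rewrite /F !(hornerD, hornerN, hornerZ, hornerX, hornerXn, hornerC).
  have := congr1 (@toC R) w0E; rewrite !(toCD, toCM, toCN, toCX, toC_nat) toC1 => ->.
  have : 1 + toC x != 0 by rewrite -toC1 -toCD toC_neq0// gt_eqF//; lra.
  by move: (toC x) (toC w0) => a b ab; field.
have Qw0 : 1 <= cabs Q.[toC w0].
  rewrite /Q horner_prod cabs_prod big_seq.
  apply: (big_ind (fun y => 1 <= y)) => [//|y1 y2|x xs']; first exact: mulr_ege1.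
  by rewrite Fw0 ?xs0// cabsN cw0; lra.
have [w w1 Qw] : exists2 w, cabs w = 1 & 1 < cabs Q.[w] * (20 * (10 ^+ 4) ^+ D).
  apply: contrapT => H.
  have T0 : 0 < 20 * (10 ^+ 4) ^+ D :> R by rewrite mulr_gt0// !exprn_gt0.
  have coefQ i : cabs Q`_i <= (20 * (10 ^+ 4) ^+ D)^-1.
    apply: coef_le_circle => z z1; rewrite leNgt; apply/negP => lt; apply: H.
    by exists z => //; rewrite -ltr_pdivrMr// div1r.
  have := @horner_le_pnorm Q (toC w0) 10 (2 * D).+1 _ _ sQ.
  have w0_10 : cabs (toC w0) <= 10 by rewrite cw0; lra.
  move=> /(_ _ w0_10)/wrap[]; first by rewrite ler1n.
  move=> /(le_trans Qw0); apply/negP; rewrite -ltNge.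
  have Qn := pnorm_le sQ coefQ.
  have t0 : 0 < 10 ^+ (2 * D).+1 :> R by rewrite exprn_gt0.
  rewrite -(ler_pM2l t0) in Qn; apply: le_lt_trans Qn _.
  rewrite mulrA ltr_pdivrMr// mul1r exprS exprM.
  have D4 : (2 * D).+1%:R <= 4 ^+ D :> R.
    by rewrite -natrX ler_nat; elim: (D) => [|k IH] //; rewrite expnS; lia.
  have D100 : 4 ^+ D <= (10 ^+ 2) ^+ D :> R.
    by rewrite lerXn2r ?nnegrE ?exprn_ge0//; lra.
  have -> : (10 ^+ 4) ^+ D = (10 ^+ 2) ^+ D * (10 ^+ 2) ^+ D :> R by rewrite -exprMn -exprD.
  have P0 : 0 < (10 ^+ 2) ^+ D :> R by rewrite !exprn_gt0.
  move: P0 (le_trans D4 D100); move: ((10 ^+ 2) ^+ D) ((2 * D).+1%:R : R) => P k P0 kP.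
  have PP : 0 < P * P by rewrite mulr_gt0.
  have : P * k <= P * P by rewrite ler_pM2l.
  by lra.
exists (rhow w).
  by have := cre_le w; rewrite w1 ler_norml /rhow; lra.
have P0 : 0 < \prod_(x <- xs) (1 + x).
  rewrite big_seq; apply: (big_ind (fun y => 0 < y)) => [//|y1 y2|x xs']; first exact: mulr_gt0.
  by have := xs0 x xs'; lra.
move: Qw; rewrite /Q horner_prod cabs_prod.
have -> : \prod_(x <- xs) cabs (F x).[w] = (\prod_(x <- xs) `|rhow w - x|) / \prod_(x <- xs) (1 + x).
  rewrite -prodf_div big_seq [RHS]big_seq; apply: eq_bigr => x xs'.
  by rewrite FE ?xs0.
by rewrite mulrAC ltr_pdivlMr// mul1r => /ltW; rewrite mulrC.
Qed.

(** The distance from a point of the circle |z| = rho to a root is at least the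
    difference of the moduli, and [prod_root_distance] chooses one rho in [1, 2]
    for all the roots. *)
Lemma poly_min_modulus : exists2 A : R, 1 <= A & forall (d : nat) p, p != 0 -> (size p <= d.+1)%N ->
  exists2 rho : R, 1 <= rho <= 2 &
    forall z, cabs z = rho -> pnorm p <= A ^+ d.+1 * cabs p.[z].
Proof.
exists (20 * 10 ^+ 4) => [|d p p0 pd].
  by have : 1 <= 10 ^+ 4 :> R by [rewrite exprn_ege1// ler1n]; lra.
have [rs rsE] := closed_field_poly_normal p.
have c0 : 0 < cabs (lead_coef p) by rewrite cabs_gt0 lead_coef_eq0.
have srs : (size rs <= d)%N.
  move: pd; rewrite rsE size_scale ?lead_coef_eq0// size_prod_XsubC; exact.
have xs0 x : x \in [seq cabs z | z <- rs] -> 0 <= x by move=> /mapP[z _ ->]; exact: cabs_ge0.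
have [rho r12 H] := prod_root_distance xs0; exists rho => // z zr.
move: H; rewrite size_map !big_map => H.
have T1 : 1 <= 10 ^+ 4 :> R by rewrite exprn_ege1// ler1n.
have TA : 20 * (10 ^+ 4) ^+ size rs <= (20 * 10 ^+ 4) ^+ d.+1 :> R.
  have h1 : 20 <= 20 ^+ d.+1 :> R by rewrite exprS ler_peMr// exprn_ege1// ler1n.
  have h2 : (10 ^+ 4) ^+ size rs <= (10 ^+ 4) ^+ d.+1 :> R by rewrite ler_weXn2l// ltnW.
  rewrite [leRHS]exprMn; apply: ler_pM h1 h2; first by [].
  by rewrite exprn_ge0//; lra.
have pX w : pnorm ('X - w%:P) <= 1 + cabs w.
  apply: le_trans (pnormD _ _) _; rewrite pnormN -[w%:P]mulr1 mul_polyC pnormZ pnorm1 mulr1 lerD2r.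
  by rewrite -['X]mulr1 -['X]expr1 pnormXnM pnorm1.
have pn : pnorm p <= cabs (lead_coef p) * \prod_(w <- rs) (1 + cabs w).
  rewrite {1}rsE pnormZ ler_pM2l//.
  elim: (rs) => [|w s IH]; first by rewrite !big_nil pnorm1.
  rewrite !big_cons; apply: le_trans (pnormM _ _) _.
  by apply: ler_pM => //; exact: pnorm_ge0.
apply: le_trans pn _.
have P0 : 0 <= \prod_(w <- rs) `|rho - cabs w| by apply: prodr_ge0.
have -> : cabs p.[z] = cabs (lead_coef p) * \prod_(w <- rs) cabs (z - w).
  rewrite {1}rsE hornerZ horner_prod cabsM cabs_prod; congr (_ * _).
  by apply: eq_bigr => w _; rewrite hornerXsubC.
rewrite mulrCA ler_pM2l//; apply: le_trans H _.
have T0 : 0 <= 20 * (10 ^+ 4) ^+ size rs :> R by rewrite mulr_ge0// exprn_ge0//; lra.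
apply: ler_pM T0 P0 TA _.
apply: ler_prod => w _; rewrite normr_ge0 /= -zr.
have h1 := cabs_subr z w; have h2 := cabs_subr w z.
by rewrite cabsC in h2; rewrite ler_norml; lra.
Qed.

(** The values at two points of a circle differ by at most the length of an arc
    times a bound of the derivative; the mean value
    inequality for complex functions costs a factor 2. *)
Lemma circle_oscillation (h h' : K -> K) rho L : 0 <= rho ->
  (forall z, cabs z = rho -> cdiff h z (h' z)) -> (forall z, cabs z = rho -> cabs (h' z) <= L) ->
  forall z, cabs z = rho -> cabs (h z - h (toC rho)) <= 2 * pi * (L * rho).
Proof.
move=> r0 dh hL z zr.
have [t0 t0pi zt] := circ_surj z; rewrite zr in zt.
have c0 : circ rho 0 = toC rho by apply: creim_eq; rewrite /= ?cos0 ?sin0 ?mulr1 ?mulr0.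
have LR : 0 <= L * rho by apply: mulr_ge0 => //; apply: le_trans (hL _ zr); exact: cabs_ge0.
have dp t := pdiff_comp (pdiff_circ rho t) (dh _ (cabs_circ t r0)).
have bd t : cabs (h' (circ rho t) * (iC R * circ rho t)) <= L * rho.
  rewrite !cabsM cabs_iC mul1r cabs_circ// ler_wpM2r//; apply: hL; exact: cabs_circ.
have pi0 := pi_gt0 R.
have osc (U u : R -> R) : (forall t, is_derive t 1 U (u t)) -> (forall t, `|u t| <= L * rho) ->
    `|U t0 - U 0| <= pi * (L * rho).
  move=> dU uL.
  have ub t : u t <= L * rho by have := uL t; rewrite ler_norml => /andP[].
  have lb t : - (L * rho) <= u t by have := uL t; rewrite ler_norml => /andP[].
  have [t00|t00] := leP 0 t0.
    have h1 := mvt_le t00 (fun x _ => dU x) (fun x _ => ub x).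
    have h2 := mvt_ge t00 (fun x _ => dU x) (fun x _ => lb x).
    have h3 : L * rho * (t0 - 0) <= L * rho * pi by rewrite ler_wpM2l//; lra.
    by rewrite ler_norml; lra.
  have h1 := mvt_le (ltW t00) (fun x _ => dU x) (fun x _ => ub x).
  have h2 := mvt_ge (ltW t00) (fun x _ => dU x) (fun x _ => lb x).
  have h3 : L * rho * (0 - t0) <= L * rho * pi by rewrite ler_wpM2l//; lra.
  by rewrite ler_norml; lra.
have oR := osc _ _ (fun t => pdiff_cre (dp t)) (fun t => le_trans (cre_le _) (bd t)).
have oI := osc _ _ (fun t => pdiff_cim (dp t)) (fun t => le_trans (cim_le _) (bd t)).
apply: le_trans (cabs_le_creim _) _; rewrite creB cimB.
by rewrite -zt c0 in oR oI; lra.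
Qed.

Lemma pi_le4 : pi <= 4 :> R.
Proof. by have [/andP[_ h] _] := pihalf_02_cos_pihalf R; lra. Qed.

(** The Wronskian of two polynomials controls their distance to being
    proportional: integrate (y/p)' = W(p,y)/p^2 along the circle of minimum
    modulus, and bound y - e p by the maximum on that circle. *)
Lemma wronskian2_lower : exists2 A : R, 1 <= A & forall (d : nat) p q, p != 0 ->
  (size p <= d.+1)%N -> (size q <= d.+1)%N -> exists c,
    pnorm p * pnorm (q - c *: p) <= A ^+ d.+1 * pnorm (p * q^`() - p^`() * q).
Proof.
have [A A1 HA] := poly_min_modulus.
exists (2 * (32 * (2 * (4 * (A * A))))) => [|d p q p0 sp sy].
  have : 1 <= A * A by rewrite mulr_ege1.
  lra.
have [rho r12 Hrho] := HA d p p0 sp.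
set W := p * q^`() - p^`() * q.
have P0 := pnorm_gt0 p0; set P := pnorm p in P0 Hrho *.
have B0 : 0 < A ^+ d.+1 by rewrite exprn_gt0//; lra.
set B := A ^+ d.+1 in B0 Hrho *.
have pz z : cabs z = rho -> P / B <= cabs p.[z].
  by move=> zr; rewrite ler_pdivrMr// mulrC; exact: Hrho.
have PB0 : 0 < P / B by rewrite divr_gt0.
have pz0 z : cabs z = rho -> p.[z] != 0.
  by move=> zr; rewrite -cabs_gt0; apply: lt_le_trans (pz z zr).
have sW : (size W <= 2 * d.+1)%N.
  have sd (s : {poly K}) : (size s <= d.+1)%N -> (size s^`() <= d)%N.
    have [->|s0] := eqVneq s 0; first by rewrite linear0 size_poly0.
    by move=> ss; rewrite -ltnS (leq_trans (lt_size_deriv s0)).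
  have h1 := size_polyMleq p q^`(); have h2 := size_polyMleq p^`() q.
  have h3 := sd p sp; have h4 := sd q sy; have h5 := size_polyD (p * q^`()) (- (p^`() * q)).
  apply: leq_trans h5 _; rewrite geq_max size_polyN.
  by apply/andP; split; [apply: leq_trans h1 _|apply: leq_trans h2 _]; lia.
have Wz z : cabs z = rho -> cabs W.[z] <= 4 ^+ d.+1 * pnorm W.
  move=> zr; have := @horner_le_pnorm W z 2 (2 * d.+1) _ _ sW; rewrite exprM -natrX.
  by apply; rewrite ?ler1n// zr; case/andP: r12.
pose h z := q.[z] / p.[z].
pose h' z := W.[z] / p.[z] ^+ 2.
have dh z : cabs z = rho -> cdiff h z (h' z).
  move=> zr; have p0z := pz0 z zr.
  have := cdiffM (cdiff_horner q z) (@cdiffV _ (horner p) _ _ p0z (cdiff_horner p z)).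
  congr cdiff; rewrite /h' /W hornerD hornerN !hornerM.
  by move: (q^`().[z]) (q.[z]) (p^`().[z]) (p.[z]) p0z => a b c e e0; field.
pose L := 4 ^+ d.+1 * pnorm W / (P / B) ^+ 2.
have hL z : cabs z = rho -> cabs (h' z) <= L.
  move=> zr; rewrite /h' /L cabs_div cabsX; apply: ler_pM; rewrite ?cabs_ge0 ?invr_ge0 ?exprn_ge0 ?cabs_ge0//.
    exact: Wz.
  rewrite lef_pV2 ?posrE ?exprn_gt0 ?cabs_gt0 ?pz0//.
  by rewrite lerXn2r ?nnegrE ?cabs_ge0 ?(ltW PB0)// pz.
have r0 : 0 <= rho by lra.
have L0 : 0 <= L.
  by rewrite divr_ge0 ?exprn_ge0 ?(ltW PB0)// mulr_ge0 ?exprn_ge0 ?pnorm_ge0.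
have osc := circle_oscillation r0 dh hL.
pose c := h (toC rho); exists c.
have hc z : cabs z = rho -> cabs (h z - c) <= 16 * L.
  move=> zr; apply: le_trans (osc z zr) _.
  have h1 : pi * (L * rho) <= 4 * (L * 2).
    apply: ler_pM; [exact: pi_ge0|exact: mulr_ge0|exact: pi_le4|].
    by rewrite ler_wpM2l//; case/andP: r12.
  by lra.
have yc z : cabs z = rho -> cabs (q - c *: p).[z] <= 2 ^+ d.+1 * P * (16 * L).
  move=> zr; rewrite hornerD hornerN hornerZ.
  have -> : q.[z] - c * p.[z] = p.[z] * (h z - c).
    have p0z := pz0 z zr; rewrite /h mulrBr mulrCA divff// mulr1; congr (_ - _); exact: mulrC.
  have z2 : cabs z <= 2 by rewrite zr; case/andP: r12.
  have pz2 := @horner_le_pnorm p z 2 d.+1 (ler1n _ 2) z2 sp.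
  by rewrite cabsM; exact: ler_pM (cabs_ge0 _) (cabs_ge0 _) pz2 (hc z zr).
have rho0 : 0 < rho by lra.
have coefy m : cabs (q - c *: p)`_m <= 2 ^+ d.+1 * P * (16 * L).
  have := @coef_le_circle_radius R _ rho _ m rho0 yc; apply: le_trans.
  rewrite ler_peMr ?cabs_ge0// exprn_ege1//; lra.
have sz : (size (q - c *: p)%R <= d.+1)%N.
  rewrite (leq_trans (size_polyD _ _))// geq_max sy size_polyN.
  by rewrite (leq_trans (size_scale_leq _ _)).
have := pnorm_le sz coefy => ny.
rewrite -(ler_pM2l P0) in ny; apply: le_trans ny _.
have E2 : d.+1%:R <= 2 ^+ d.+1 :> R by rewrite -natrX ler_nat ltnW// ltn_expl.
have -> : P * (d.+1%:R * (2 ^+ d.+1 * P * (16 * L))) = (d.+1%:R * 16) * (2 ^+ d.+1 * (4 ^+ d.+1 * (B * B))) * pnorm W.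
  by rewrite /L; field; rewrite gt_eqF //= gt_eqF.
rewrite !exprMn -/B ler_wpM2r ?pnorm_ge0//.
have X0 : 0 <= 2 ^+ d.+1 * (4 ^+ d.+1 * (B * B)).
  by apply: mulr_ge0; [exact: exprn_ge0|apply: mulr_ge0; [exact: exprn_ge0|exact: ltW (mulr_gt0 B0 B0)]].
rewrite [leRHS]mulrA; apply: ler_wpM2r => //.
apply: ler_pM => //.
by apply: (@le_trans _ _ (32 ^+ 1)); [rewrite expr1; lra|rewrite ler_weXn2l// ler1n].
Qed.
End PolyNorm.

(** * The Wronskian dominates a system of polynomials *)

Section PolyWronskian.
Variable R : realType.
Local Notation K := (C R).
Implicit Types (p q : {poly K}) (P Q : nat -> {poly K}).

Definition pwronskian n P : {poly K} := \det (\matrix_(i < n, j < n) derivn i (P j)).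

(** The coefficient of y^(k) in the i-th derivative of p y' - p' y. *)
Fixpoint bracket_coef p (i k : nat) : {poly K} :=
  match i with
  | 0 => match k with 0 => - p^`() | 1 => p | _ => 0 end
  | i'.+1 => (bracket_coef p i' k)^`() + (if k is k'.+1 then bracket_coef p i' k' else 0)
  end.

Lemma bracket_coef_gt p i k : (i.+1 < k)%N -> bracket_coef p i k = 0.
Proof.
elim: i k => [|i IH] k /=; first by case: k => [|[|k]].
by case: k => // k ik; rewrite !IH ?linear0 ?addr0//; lia.
Qed.

Lemma bracket_coef_top p i : bracket_coef p i i.+1 = p.
Proof.
by elim: i => [|i IH] //=; rewrite IH bracket_coef_gt// linear0 add0r.
Qed.

Lemma bracket_coefP p q i : derivn i (p * q^`() - p^`() * q) =
  \sum_(k < i.+2) bracket_coef p i k * derivn k q.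
Proof.
elim: i => [|i IH].
  by rewrite derivn0 !big_ord_recl big_ord0 addr0 /= mulNr addrC.
rewrite derivnS IH (raddf_sum (@deriv K)) /=.
rewrite (eq_bigr (fun k : 'I_i.+2 => (bracket_coef p i k)^`() * derivn k q + bracket_coef p i k * derivn k.+1 q)); last first.
  by move=> k _; rewrite derivM -derivnS.
rewrite big_split /=.
rewrite [RHS](eq_bigr (fun k : 'I_i.+3 => (bracket_coef p i k)^`() * derivn k q +
   (if (k : nat) is k'.+1 then bracket_coef p i k' else 0) * derivn k q)); last first.
  by move=> k _; rewrite /= mulrDl.
rewrite big_split /=; congr (_ + _).
  by rewrite [RHS]big_ord_recr /= bracket_coef_gt// linear0 mul0r addr0.
by rewrite [RHS]big_ord_recl /= mul0r add0r; apply: eq_bigr.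
Qed.

(** Frobenius' identity: dividing the functions by the first one and
    differentiating lowers the order of the Wronskian by one.  A
    triangular matrix with diagonal 1, P 0, ..., P 0 takes the matrix of
    derivatives of the P j to the rows of the P j and of the derivatives of the
    brackets, whose first column is P 0, 0, ..., 0. *)
Lemma wronskian_reduce n P :
  P 0%N ^+ n * pwronskian n.+1 P =
  P 0%N * pwronskian n (fun j => P 0%N * (P j.+1)^`() - (P 0%N)^`() * P j.+1).
Proof.
set p := P 0%N.
pose B : 'M[{poly K}]_n.+1 := \matrix_(i, k)
  (if (i : nat) is i'.+1 then bracket_coef p i' k else ((k : nat) == 0%N)%:R).
pose M : 'M[{poly K}]_n.+1 := \matrix_(i, j) derivn i (P j).
have detB : \det B = p ^+ n.
  rewrite det_trig; last first.
    apply/is_trig_mxP => i k ik; rewrite mxE; case: i ik => [[|i] ii] /= ik.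
      by case: (k : nat) ik.
    exact: bracket_coef_gt.
  rewrite big_ord_recl mxE /= mul1r (eq_bigr (fun=> p)) ?prodr_const ?card_ord// => i _.
  by rewrite mxE /= bracket_coef_top.
have BM (i j : 'I_n.+1) : (B *m M) i j =
    if (i : nat) is i'.+1 then derivn i' (p * (P j)^`() - p^`() * P j) else P j.
  rewrite mxE; case: i => [[|i] ii] /=.
    rewrite big_ord_recl !mxE /= mul1r big1 ?addr0// => k _.
    by rewrite !mxE /= mul0r.
  rewrite bracket_coefP.
  rewrite (eq_bigr (fun k : 'I_n.+1 => bracket_coef p i k * derivn k (P j))); last first.
    by move=> k _; rewrite !mxE.
  rewrite [RHS](big_ord_widen n.+1 (fun k => bracket_coef p i k * derivn k (P j))) //.
  rewrite (bigID (fun k : 'I_n.+1 => (k < i.+2)%N)) /= [X in _ + X]big1 ?addr0// => k.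
  by rewrite -leqNgt => ik; rewrite bracket_coef_gt ?mul0r.
rewrite -detB /pwronskian -/M -det_mulmx (expand_det_col _ ord0) big_ord_recl big1 ?addr0.
  rewrite BM /=; congr (_ * _); rewrite /cofactor /= addn0 expr0 mul1r.
  congr (\det _); apply/matrixP => i j.
  by rewrite mxE mxE BM mxE /=.
by move=> i _; rewrite BM /= -/p [p^`() * p]mulrC subrr linear0 mul0r.
Qed.

(** A unipotent triangular change of the family; it preserves the Wronskian. *)
Definition combine P (c : nat -> nat -> K) (m : nat) := P m + \sum_(i < m) c m i *: P i.

(** By induction on the order, through [wronskian_reduce]: the induction
    hypothesis corrects the brackets of P 0 with the other members, and the case
    of two polynomials corrects these members by multiples of P 0. *)
Lemma wronskian_lower n : exists2 A : R, 1 <= A & forall (d : nat) P,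
  (forall j, (size (P j) <= d.+1)%N) ->
  exists c : nat -> nat -> K,
    \prod_(j < n.+1) pnorm (combine P c j) <= A ^+ d.+1 * pnorm (pwronskian n.+1 P).
Proof.
elim: n => [|n [A A1 IH]].
  exists 1 => // d P sP; exists (fun _ _ => 0).
  rewrite big_ord1 /combine big_ord0 addr0 expr1n mul1r.
  by rewrite /pwronskian det_mx11 mxE derivn0.
have [B B1 HB] := wronskian2_lower R.
exists (B ^+ n.+1 * A ^+ 2) => [|d P sP]; first by rewrite mulr_ege1// exprn_ege1.
have [p0|p0] := eqVneq (P 0%N) 0.
  exists (fun _ _ => 0); rewrite big_ord_recl {1}/combine big_ord0 addr0 p0 pnorm0 mul0r.
  by rewrite mulr_ge0 ?pnorm_ge0// exprn_ge0// mulr_ge0 ?exprn_ge0//; lra.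
pose V q := P 0%N * q^`() - (P 0%N)^`() * q.
have VD q1 q2 : V (q1 + q2) = V q1 + V q2.
  by rewrite /V linearD /= !mulrDr opprD addrACA.
have VZ c q : V (c *: q) = c *: V q.
  by rewrite /V linearZ /= -!scalerAr -scalerBr.
pose Q j := V (P j.+1).
have sV q : (size q <= d.+1)%N -> (size (V q) <= (2 * d).+1)%N.
  move=> sq; have sd (s : {poly K}) : (size s <= d.+1)%N -> (size s^`() <= d)%N.
    have [->|s0] := eqVneq s 0; first by rewrite linear0 size_poly0.
    by move=> ss; rewrite -ltnS (leq_trans (lt_size_deriv s0)).
  have h1 := size_polyMleq (P 0%N) q^`(); have h2 := size_polyMleq (P 0%N)^`() q.
  have h3 := sd _ (sP 0%N); have h4 := sd q sq.
  have h5 := size_polyD (P 0%N * q^`()) (- ((P 0%N)^`() * q)).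
  have h6 := sP 0%N.
  apply: leq_trans h5 _; rewrite geq_max size_polyN.
  by apply/andP; split; [apply: leq_trans h1 _|apply: leq_trans h2 _]; lia.
(* The brackets with P 0 have degree at most 2 d, whence A ^+ 2 in the constant. *)
have [c Hc] := IH (2 * d)%N Q (fun j => sV _ (sP j.+1)).
pose Y j := P j.+1 + \sum_(i < j) c j i *: P i.+1.
have QY j : combine Q c j = V (Y j).
  rewrite /combine /Y VD; congr (_ + _).
  have V0 : V 0 = 0 by rewrite /V linear0 !mulr0 subrr.
  rewrite (big_morph V VD V0); apply: eq_bigr => i _; by rewrite VZ.
have sY j : (size (Y j) <= d.+1)%N.
  rewrite /Y (leq_trans (size_polyD _ _))// geq_max sP /=.
  apply: leq_trans (size_sum _ _ _) _; apply/bigmax_leqP => i _.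
  by rewrite (leq_trans (size_scale_leq _ _)).
have [e He] := choice (fun j => HB d (P 0%N) (Y j) p0 (sP 0%N) (sY j)).
(* Each corrected member Y j loses its best multiple of P 0, which has the same
   bracket with P 0. *)
pose c' j i : K := match j with 0 => 0 | j'.+1 => if i is i'.+1 then c j' i' else - e j' end.
exists c'.
have c'S j : combine P c' j.+1 = Y j - e j *: P 0%N.
  by rewrite /combine big_ord_recl /= scaleNr /Y -[RHS]addrA; congr (_ + _); rewrite addrC.
rewrite big_ord_recl {1}/combine big_ord0 addr0.
have P0 := pnorm_gt0 p0; have P0n : 0 < pnorm (P 0%N) ^+ n by rewrite exprn_gt0.
rewrite -(ler_pM2l P0n).
have step1 : pnorm (P 0%N) ^+ n * (pnorm (P 0%N) * \prod_(i < n.+1) pnorm (combine P c' (lift ord0 i)))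
    = \prod_(i < n.+1) (pnorm (P 0%N) * pnorm (Y i - e i *: P 0%N)).
  rewrite mulrA -exprSr big_split /= prodr_const card_ord; congr (_ * _).
  by apply: eq_bigr => i _; rewrite -c'S.
rewrite step1.
have step2 : \prod_(i < n.+1) (pnorm (P 0%N) * pnorm (Y i - e i *: P 0%N)) <=
   \prod_(i < n.+1) (B ^+ d.+1 * pnorm (combine Q c i)).
  apply: ler_prod => i _; rewrite mulr_ge0 ?pnorm_ge0//= QY; exact: He.
apply: le_trans step2 _; rewrite big_split /= prodr_const card_ord.
have AB : 0 <= B ^+ d.+1 ^+ n.+1 by rewrite !exprn_ge0//; lra.
apply: le_trans (ler_wpM2l AB Hc) _.
have red : P 0%N ^+ n * pwronskian n.+2 P = pwronskian n.+1 Q.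
  by apply: (mulfI p0); rewrite mulrA -exprS wronskian_reduce.
have nW : pnorm (pwronskian n.+1 Q) <= pnorm (P 0%N) ^+ n * pnorm (pwronskian n.+2 P).
  rewrite -red; apply: le_trans (pnormM _ _) _.
  by rewrite ler_wpM2r ?pnorm_ge0// pnormX.
have A0 : 0 <= A ^+ (2 * d).+1 by rewrite exprn_ge0//; lra.
apply: le_trans (ler_wpM2l AB (ler_wpM2l A0 nW)) _.
rewrite [leLHS](_ : _ = pnorm (P 0%N) ^+ n * (B ^+ d.+1 ^+ n.+1 * A ^+ (2 * d).+1 * pnorm (pwronskian n.+2 P))); last by ring.
rewrite ler_pM2l// ler_wpM2r ?pnorm_ge0// exprMn -!exprM [(d.+1 * _)%N]mulnC ler_wpM2l//.
  by rewrite exprn_ge0//; lra.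
by rewrite ler_weXn2l//; lia.
Qed.

(** The hypothesis on the coefficients bounds the norm of each corrected member
    from below and the corrections from above, so that one factor of the product
    in [wronskian_lower] can be bounded by the Wronskian alone. *)
Lemma wronskian_dominates n : exists2 A : R, 1 <= A & forall (d : nat) P (C0 : R),
  (forall j, (size (P j) <= d.+1)%N) -> 1 <= C0 ->
  (forall (x : nat -> K) j, (j < n.+1)%N -> cabs (x j) <= C0 * pnorm (\sum_(i < n.+1) x i *: P i)) ->
  forall m, (m < n.+1)%N ->
    pnorm (P m) <= (2 * C0) ^+ n.+1 * (A ^+ d.+1 * pnorm (pwronskian n.+1 P)).
Proof.
have [A A1 HA] := wronskian_lower n; exists A => // d P C0 sP C01 HC m mn.
have [c Hc] := HA d P sP.
pose g j := combine P c j.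
pose a j := C0 * pnorm (g j).
pose xg (j i : nat) : K := if i == j then 1 else if (i < j)%N then c j i else 0.
have gE j : (j < n.+1)%N -> g j = \sum_(i < n.+1) xg j i *: P i.
  move=> jn; rewrite (bigD1 (Ordinal jn)) //= /xg eqxx scale1r; congr (_ + _).
  rewrite (big_ord_widen n.+1 (fun i => c j i *: P i)) ?(ltnW jn)//.
  rewrite [RHS](bigID (fun i : 'I_n.+1 => (i < j)%N)) /= [X in _ = _ + X]big1 ?addr0.
    apply: eq_big => i; first by rewrite -val_eqE /=; case: ltngtP.
    by move=> ij; rewrite ltn_eqF// ij.
  move=> i /andP[]; rewrite -val_eqE /= => /negbTE -> /negbTE ->; exact: scale0r.
have xgle j i : (j < n.+1)%N -> (i < n.+1)%N -> cabs (xg j i) <= a j.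
  by move=> jn iN; rewrite /a gE//; exact: HC.
have a1 j : (j < n.+1)%N -> 1 <= a j.
  by move=> jn; have := xgle j j jn jn; rewrite /xg eqxx cabs1.
have ga j : pnorm (g j) <= a j by rewrite /a ler_peMl// pnorm_ge0.
pose S k := 1 + \sum_(i < k) pnorm (P i).
have S0 k : 0 <= S k by rewrite addr_ge0// sumr_ge0// => i _; exact: pnorm_ge0.
have Pm k : (k < n.+1)%N -> pnorm (P k) <= a k * S k.
  move=> kn; have -> : P k = g k - \sum_(i < k) c k i *: P i by rewrite /g /combine addrK.
  apply: le_trans (pnormD _ _) _; rewrite pnormN /S mulrDr mulr1; apply: lerD; first exact: ga.
  apply: le_trans (pnorm_sum _ _ _) _; rewrite mulr_sumr; apply: ler_sum => i _.
  rewrite pnormZ ler_wpM2r ?pnorm_ge0//.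
  have ik := ltn_ord i; have := xgle k i kn (ltn_trans ik kn).
  by rewrite /xg ltn_eqF// ik.
have SS k : (k <= n.+1)%N -> S k <= \prod_(j < k) (2 * a j).
  elim: k => [|k IH] kn; first by rewrite /S !big_ord0 addr0.
  rewrite big_ord_recr /= /S big_ord_recr /= addrA -/(S k).
  have h := Pm k kn; have h1 := a1 k kn; have h2 := S0 k.
  apply: (@le_trans _ _ (S k * (2 * a k))).
    have : S k <= a k * S k by rewrite ler_peMl.
    by rewrite mulrC; lra.
  by apply: ler_wpM2r; [lra|exact: IH (ltnW kn)].
have PS : pnorm (P m) <= S n.+1.
  rewrite /S (bigD1 (Ordinal mn)) //=.
  have : 0 <= \sum_(i < n.+1 | i != Ordinal mn) pnorm (P i) by apply: sumr_ge0 => i _; exact: pnorm_ge0.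
  by lra.
apply: le_trans PS _; apply: le_trans (SS n.+1 (leqnn _)) _.
have -> : \prod_(j < n.+1) (2 * a j) = (2 * C0) ^+ n.+1 * \prod_(j < n.+1) pnorm (combine P c j).
  rewrite -[X in _ ^+ X]card_ord -prodr_const -big_split; apply: eq_bigr => j _.
  by rewrite /a mulrA.
by rewrite ler_wpM2l// exprn_ge0//; lra.
Qed.
End PolyWronskian.

(** * The characteristic as a mean over a circle *)

Section RealContinuity.
Variable R : realType.
Local Notation K := (C R).
Implicit Types (x y s b e t M A B r rho : R) (z w h c d : K) (p q : {poly K}).

Definition rc_at (g : K -> R) z := forall e, 0 < e -> exists2 dl : R, 0 < dl &
  forall w, cabs (w - z) < dl -> `|g w - g z| < e.

Lemma rc_at_comp (g : K -> R) (phi : R -> R) z : rc_at g z ->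
  {for g z, continuous phi} -> rc_at (fun w => phi (g w)) z.
Proof.
move=> cg cphi e e0; move/cvgrPdist_lt: cphi => /(_ e e0)/nbhs_ballP[d1 /= d10 H].
have [dl dl0 Hd] := cg d1 d10; exists dl => // w /Hd wz.
by rewrite distrC; apply: H; rewrite -ball_normE /= distrC.
Qed.

Lemma rc_at_cst x z : rc_at (fun=> x) z.
Proof. by move=> e e0; exists 1 => // w _; rewrite subrr normr0. Qed.

Lemma rc_atD (g1 g2 : K -> R) z : rc_at g1 z -> rc_at g2 z -> rc_at (fun w => g1 w + g2 w) z.
Proof.
move=> c1 c2 e e0; have e20 : 0 < e / 2 by rewrite divr_gt0.
have [d1 d10 H1] := c1 _ e20; have [d2 d20 H2] := c2 _ e20.
exists (Num.min d1 d2); first by rewrite lt_min d10.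
move=> w; rewrite lt_min => /andP[/H1 h1 /H2 h2].
by move: h1 h2; rewrite !ltr_norml; lra.
Qed.

Lemma rc_at_sum (I : Type) (s : seq I) (G : I -> K -> R) z : (forall i, rc_at (G i) z) ->
  rc_at (fun w => \sum_(i <- s) G i w) z.
Proof.
move=> H; elim: s => [|i s IH].
  rewrite (_ : (fun w => _) = fun=> 0); first exact: rc_at_cst.
  by apply/funext => w; rewrite big_nil.
rewrite (_ : (fun w => _) = fun w => G i w + \sum_(i <- s) G i w); first exact: rc_atD.
by apply/funext => w; rewrite big_cons.
Qed.

Lemma rc_at_cabs (f : K -> K) z d : cdiff f z d -> rc_at (fun w => cabs (f w)) z.
Proof.
move=> fd e e0; have [dl dl0 H] := cdiff_cont fd e0; exists dl => // w /H.
have h1 := cabs_subr (f w) (f z); have h2 := cabs_subr (f z) (f w).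
by rewrite cabsC in h2; rewrite ltr_norml; lra.
Qed.

Lemma rc_at_circ_cont (g : K -> R) r : (forall z, cabs z = r -> rc_at g z) -> circ_cont g r.
Proof.
by move=> H z e zr e0; have [dl dl0 Hd] := H z zr e e0; exists dl => // w _; exact: Hd.
Qed.

Lemma rc_at_circ (g : K -> R) r : 0 <= r -> (forall z, cabs z = r -> rc_at g z) ->
  rcont (fun t => g (circ r t)).
Proof.
move=> r0 H x e e0.
have [dl dl0 Hd] := H _ (cabs_circ x r0) e e0.
have [|dl' dl'0 Hd'] := @pcont_circ R id r r0 _ x dl dl0.
  by move=> w _; exists 1; exact: cdiff_id.
by exists dl' => // y /Hd'; exact: Hd.
Qed.
End RealContinuity.

Section EuclideanNorm.
Variables (R : realType) (n : nat).
Local Notation K := (C R).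
Implicit Types (v w : 'rV[K]_n.+1).
Local Notation en := (@euclidean_norm R n).

Lemma en_coord v j : cabs (v 0 j) <= en v.
Proof.
rewrite -[leLHS](ger0_norm (cabs_ge0 _)) -sqrtr_sqr ler_wsqrtr//.
by rewrite (bigD1 j) //= lerDl sumr_ge0// => i _; exact: sqr_ge0.
Qed.

Lemma en_le_sum v : en v <= \sum_j cabs (v 0 j).
Proof.
have s0 : 0 <= \sum_j cabs (v 0 j) by apply: sumr_ge0 => j _; exact: cabs_ge0.
rewrite -[leRHS](ger0_norm s0) -sqrtr_sqr ler_wsqrtr// expr2 mulr_suml.
apply: ler_sum => j _; rewrite expr2; apply: ler_wpM2l; first exact: cabs_ge0.
by rewrite (bigD1 j) //= lerDl sumr_ge0// => i _; exact: cabs_ge0.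
Qed.

Lemma en_gt0 v : v != 0 -> 0 < en v.
Proof.
move=> v0; rewrite ltNge; apply/negP => en0; move/eqP: v0; apply.
apply/rowP => j; rewrite mxE; apply/eqP; rewrite -cabs_eq0 eq_le cabs_ge0 andbT.
exact: le_trans (en_coord v j) en0.
Qed.

Lemma en_scale c v : en (c *: v) = cabs c * en v.
Proof.
rewrite /euclidean_norm -[X in X * _](ger0_norm (cabs_ge0 c)) -sqrtr_sqr -sqrtrM ?sqr_ge0//.
congr Num.sqrt; rewrite mulr_sumr; apply: eq_bigr => j _.
by rewrite mxE -/(cabs _) -/(cabs _) cabsM exprMn.
Qed.
End EuclideanNorm.

Section Characteristic.
Variables (R : realType) (n : nat) (F : C R -> 'rV[C R]_n.+1).
Local Notation K := (C R).
Local Notation en := (@euclidean_norm R n).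
Implicit Types (x y s b e t M A B r rho : R) (z w h c d : K) (p q k : {poly K}).
Hypothesis F_entire : forall j, entire (coord_fun F j).
Hypothesis F_neq0 : forall z, F z != 0.

Definition lognorm z : R := ln (en (F z)).

Lemma lognorm_cont z : rc_at lognorm z.
Proof.
have cS : rc_at (fun w => \sum_(j < n.+1) cabs (F w 0 j) ^+ 2) z.
  apply: rc_at_sum => j.
  have cj : rc_at (fun w => cabs (F w 0 j)) z.
    exact: (@rc_at_cabs R (coord_fun F j) z _ (@entire_cdiff R _ z (@F_entire j))).
  apply: (@rc_at_comp R (fun w => cabs (F w 0 j)) (fun x => x ^+ 2) z cj).
  exact: exprn_continuous.
have ce : rc_at (fun w => en (F w)) z := rc_at_comp cS (@sqrt_continuous R _).
by apply: (rc_at_comp ce); apply: continuous_ln; exact: en_gt0.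
Qed.

(** The mean of a polynomial over a circle is its value at the centre: k - k(0)
    is divisible by z and has a polynomial as antiderivative along the circle. *)
Lemma poly_path_mean k r : 0 <= r -> exists G : R -> R,
  (forall t, is_derive t 1 G (cre k.[circ r t])) /\ G pi - G (- pi) = 2 * pi * cre k.[0].
Proof.
move=> r0.
elim/poly_ind: k => [|q c _].
  exists (fun=> 0); split=> [t|]; last by rewrite horner0 subrr mulr0.
  by rewrite horner0; exact: is_derive_cst.
have [g Hg] := @primitive R (horner q) 0 (entire_ccont (entire_horner q))
  (fun z _ => ex_intro _ _ (cdiff_horner q z)).
exists (fun t => cre (- iC R * g (circ r t)) + cre c * t); split=> [t|].
  have H1 := pdiff_cre (pdiff_comp (pdiff_circ r t) (cdiffMl (- iC R) (Hg (circ r t)))).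
  have H2 : is_derive t 1 (fun t => cre c * t) (cre c).
    by have := is_deriveZ (cre c) (is_derive_id t (1 : R)); rewrite /GRing.scale /= mulr1.
  have := is_deriveD H1 H2; congr is_derive.
  rewrite hornerD hornerM hornerX hornerC creD; congr (_ + _); congr cre.
  have -> : - iC R * q.[circ r t] * (iC R * circ r t) = - (iC R * iC R) * (q.[circ r t] * circ r t) by ring.
  have -> : iC R * iC R = -1 by apply: creim_eq; rewrite !(creM, cimM) /=; ring.
  by rewrite opprK mul1r.
have -> : circ r (- pi) = circ r pi.
  by rewrite /circ /circle_point cosN sinN sinpi oppr0.
rewrite hornerD hornerM hornerX hornerC mulr0 add0r; ring.
Qed.

Lemma characteristic_antiderivative r : 0 <= r -> exists U : R -> R,
  (forall t, is_derive t 1 U (lognorm (circ r t))) /\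
  characteristic F r = (2 * pi)^-1 * (U pi - U (- pi)) - lognorm 0.
Proof.
move=> r0; have cu := rc_at_circ r0 (fun z _ => lognorm_cont z).
have [U HU] := antiderivative cu; exists U; split=> //.
rewrite /characteristic; congr (_ * _ - _).
have pi0 := pi_gt0 R.
rewrite /Rintegral (@continuous_FTC2 R (fun t => lognorm (circ r t)) U (- pi) pi) //.
- by lra.
- by apply: continuous_subspaceT => x; exact: rcont_continuous.
- have cU x : {for x, continuous U}.
    by have [dU _] := HU x; apply/differentiable_continuous/derivable1_diffP.
  split=> [x _||].
  + by have [] := HU x.
  + exact: cvg_at_right_filter (cU _).
  + exact: cvg_at_left_filter (cU _).
- by move=> x _; rewrite derive1E; have [_] := HU x.
Qed.

(** The mean of the real part of a polynomial is its value at the origin, so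
    the characteristic is bounded by any bound of log|F| - Re k on the circle. *)
Lemma characteristic_le k r B : 0 <= r -> cre k.[0] = lognorm 0 ->
  (forall z, cabs z = r -> lognorm z - cre k.[z] <= B) -> characteristic F r <= B.
Proof.
move=> r0 k0 H; have [U [HU ->]] := characteristic_antiderivative r0.
have [G [HG GE]] := poly_path_mean k r0.
have pi0 := pi_gt0 R.
have pipi : - pi <= pi :> R by lra.
have dW t : - pi <= t <= pi -> is_derive t 1 (fun t => U t - G t) (lognorm (circ r t) - cre k.[circ r t]).
  by move=> _; apply: is_deriveB.
have := mvt_le pipi dW (fun t _ => H _ (cabs_circ t r0)).
rewrite k0 in GE => h.
rewrite lerBlDr ler_pdivrMl ?mulr_gt0//; lra.
Qed.

Lemma characteristic_ge k r B : 0 <= r -> cre k.[0] = lognorm 0 ->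
  (forall z, cabs z = r -> B <= lognorm z - cre k.[z]) -> B <= characteristic F r.
Proof.
move=> r0 k0 H; have [U [HU ->]] := characteristic_antiderivative r0.
have [G [HG GE]] := poly_path_mean k r0.
have pi0 := pi_gt0 R.
have pipi : - pi <= pi :> R by lra.
have dW t : - pi <= t <= pi -> is_derive t 1 (fun t => U t - G t) (lognorm (circ r t) - cre k.[circ r t]).
  by move=> _; apply: is_deriveB.
have := mvt_ge pipi dW (fun t _ => H _ (cabs_circ t r0)).
rewrite k0 in GE => h.
rewrite lerBrDr ler_pdivlMl ?mulr_gt0//; lra.
Qed.
End Characteristic.

(** * Normalization by exponentials of polynomials *)

Section Limits.
Variable R : realType.
Local Notation K := (C R).
Implicit Types (x y s b e t M A B r rho q D : R) (z w h c d : K).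

Definition clim (u : nat -> K) (l : K) := forall e, 0 < e -> exists N, forall j, (N <= j)%N -> cabs (u j - l) < e.

(** The supremum of the lower bounds u j - E q^j is the limit. *)
Lemma geometric_cauchy_real (u : nat -> R) j0 D q : 0 <= D -> 0 <= q < 1 ->
  (forall j, (j0 <= j)%N -> `|u j - u j.+1| <= D * q ^+ j) ->
  exists l : R, forall j, (j0 <= j)%N -> `|u j - l| <= D / (1 - q) * q ^+ j.
Proof.
move=> D0 /andP[q0 q1] H.
have q1' : 0 < 1 - q by rewrite subr_gt0.
pose E := D / (1 - q).
have E0 : 0 <= E by rewrite divr_ge0// ltW.
have DE : D = E * (1 - q) by rewrite /E divfK// gt_eqF.
have step j : (j0 <= j)%N -> `|u j - u j.+1| <= E * q ^+ j - E * q ^+ j.+1.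
  by move=> /H; rewrite DE exprS; move: (q ^+ j) => P; lra.
have up j k : (j0 <= j)%N -> `|u j - u (j + k)%N| <= E * q ^+ j - E * q ^+ (j + k).
  move=> jj; elim: k => [|k IH]; first by rewrite addn0 !subrr normr0.
  have -> : u j - u (j + k.+1)%N = (u j - u (j + k)%N) + (u (j + k)%N - u (j + k).+1) by rewrite addnS; ring.
  apply: le_trans (ler_normD _ _) _.
  have := step (j + k)%N (leq_trans jj (leq_addr _ _)); rewrite addnS; lra.
have qE k : 0 <= E * q ^+ k by rewrite mulr_ge0// exprn_ge0.
pose S := [set u j - E * q ^+ j | j in [set j | (j0 <= j)%N]].
have S0 : S !=set0 by exists (u j0 - E * q ^+ j0); exists j0 => //=.
have Sub i : (j0 <= i)%N -> ubound S (u i + E * q ^+ i).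
  move=> ij _ [j /= jj <-].
  have [/subnKC ij'|/ltnW/subnKC ij'] := leqP i j.
    by have := up i (j - i)%N ij; rewrite ij' ler_norml; have := qE j; have := qE i; lra.
  by have := up j (i - j)%N jj; rewrite ij' ler_norml; have := qE j; have := qE i; lra.
exists (sup S) => j jj.
have h1 : u j - E * q ^+ j <= sup S.
  by apply: ub_le_sup; [exists (u j0 + E * q ^+ j0); exact: Sub|exists j].
have h2 : sup S <= u j + E * q ^+ j by apply: ge_sup => //; exact: Sub.
by rewrite -/E ler_norml; lra.
Qed.

Lemma geometric_cauchy (u : nat -> K) j0 D q : 0 <= D -> 0 <= q < 1 ->
  (forall j, (j0 <= j)%N -> cabs (u j - u j.+1) <= D * q ^+ j) ->
  exists l, forall j, (j0 <= j)%N -> cabs (u j - l) <= 2 * (D / (1 - q) * q ^+ j).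
Proof.
move=> D0 q01 H.
have [|l1 H1] := @geometric_cauchy_real (fun j => cre (u j)) j0 D q D0 q01.
  by move=> j /H; apply: le_trans; rewrite -creB cre_le.
have [|l2 H2] := @geometric_cauchy_real (fun j => cim (u j)) j0 D q D0 q01.
  by move=> j /H; apply: le_trans; rewrite -cimB cim_le.
exists (Complex l1 l2) => j jj; apply: le_trans (cabs_le_creim _) _.
rewrite creB cimB /= mulr_natl mulr2n; apply: lerD; [exact: H1|exact: H2].
Qed.

Lemma clim_geometric (u : nat -> K) j0 D q (l : K) : 0 <= D -> 0 <= q < 1 ->
  (forall j, (j0 <= j)%N -> cabs (u j - l) <= D * q ^+ j) -> clim u l.
Proof.
move=> D0 q01 H e e0.
have D1 : 0 < D + 1 by rewrite ltr_wpDl.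
have [N HN] := expr_small q01 (divr_gt0 e0 D1).
exists (maxn N j0) => j; rewrite geq_max => /andP[jN jj].
apply: le_lt_trans (H j jj) _; have := HN j jN; rewrite ltr_pdivlMr// => /(le_lt_trans _); apply.
by rewrite mulrC ler_wpM2l ?lerDl// exprn_ge0//; case/andP: q01.
Qed.

Lemma clim_uniq (u : nat -> K) l1 l2 : clim u l1 -> clim u l2 -> l1 = l2.
Proof.
move=> H1 H2; apply/eqP; rewrite -subr_eq0 -cabs_eq0 eq_le cabs_ge0 andbT.
apply/ler_addgt0Pl => e e0; rewrite addr0.
have e20 : 0 < e / 2 by rewrite divr_gt0.
have [N1 h1] := H1 _ e20; have [N2 h2] := H2 _ e20.
have := h1 (maxn N1 N2) (leq_maxl _ _); have := h2 (maxn N1 N2) (leq_maxr _ _).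
have -> : l1 - l2 = (u (maxn N1 N2) - l2) - (u (maxn N1 N2) - l1) by ring.
by have := cabsB (u (maxn N1 N2) - l2) (u (maxn N1 N2) - l1); lra.
Qed.

Lemma climD (u v : nat -> K) l1 l2 : clim u l1 -> clim v l2 -> clim (fun j => u j + v j) (l1 + l2).
Proof.
move=> H1 H2 e e0.
have e20 : 0 < e / 2 by rewrite divr_gt0.
have [N1 h1] := H1 _ e20; have [N2 h2] := H2 _ e20.
exists (maxn N1 N2) => j; rewrite geq_max => /andP[j1 j2].
have -> : u j + v j - (l1 + l2) = (u j - l1) + (v j - l2) by ring.
by have := h1 j j1; have := h2 j j2; have := cabsD (u j - l1) (v j - l2); lra.
Qed.

Lemma climZ (u : nat -> K) c (l : K) : clim u l -> clim (fun j => u j * c) (l * c).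
Proof.
move=> H e e0; have c0 : 0 < cabs c + 1 by rewrite ltr_wpDl// cabs_ge0.
have [N h] := H _ (divr_gt0 e0 c0); exists N => j /h; rewrite ltr_pdivlMr// => /(le_lt_trans _); apply.
by rewrite -mulrBl cabsM ler_wpM2l ?cabs_ge0// lerDl.
Qed.

Lemma clim_cst c : clim (fun=> c) c.
Proof. by move=> e e0; exists 0%N => j _; rewrite subrr cabs0. Qed.

Lemma clim_sum (I : Type) (s : seq I) (u : I -> nat -> K) (l : I -> K) :
  (forall i, clim (u i) (l i)) -> clim (fun j => \sum_(i <- s) u i j) (\sum_(i <- s) l i).
Proof.
move=> H; elim: s => [|i s IH].
  rewrite big_nil (_ : (fun j => _) = fun=> 0); first exact: clim_cst.
  by apply/funext => j; rewrite big_nil.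
rewrite big_cons (_ : (fun j => _) = fun j => u i j + \sum_(i <- s) u i j); first exact: climD.
by apply/funext => j; rewrite big_cons.
Qed.

Lemma clim_comp (u : nat -> K) f (l : K) : ccont f -> clim u l -> clim (fun j => f (u j)) (f l).
Proof.
move=> cf H e e0; have [dl dl0 Hd] := cf l e e0; have [N h] := H dl dl0.
by exists N => j /h; exact: Hd.
Qed.

(** The coefficients are recovered from the values at roots of unity, so they
    converge when the values do. *)
Lemma poly_pointwise_limit (p : nat -> {poly K}) (g : K -> K) m :
  (forall j, (size (p j) <= m.+1)%N) -> (forall z, clim (fun j => (p j).[z]) (g z)) ->
  exists2 q : {poly K}, (size q <= m.+1)%N & forall z, g z = q.[z].
Proof.
move=> sp pg; pose om := unity_root_of R m.+1.
pose cf (h : K -> K) (l : nat) := (m.+1%:R)^-1 * \sum_(k < m.+1) h (om ^+ k) * (om ^+ k) ^- l.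
have pE j z : (p j).[z] = \sum_(l < m.+1) cf (horner (p j)) l * z ^+ l.
  rewrite (horner_coef_wide _ (sp j)); apply: eq_bigr => l _; congr (_ * _).
  by rewrite /cf (dft_coef (sp j) (ltn_ord l)) mulKf// pnatr_eq0.
exists (\poly_(l < m.+1) cf g l); first exact: size_poly.
move=> z; rewrite horner_poly; apply: clim_uniq (pg z) _.
rewrite (_ : (fun j => _) = fun j => \sum_(l < m.+1) cf (horner (p j)) l * z ^+ l); last first.
  by apply/funext => j; exact: pE.
apply: clim_sum => l; apply: climZ.
rewrite /cf; have := @climZ (fun j => \sum_(k < m.+1) (p j).[om ^+ k] * (om ^+ k) ^- l) (m.+1%:R)^-1
  (\sum_(k < m.+1) g (om ^+ k) * (om ^+ k) ^- l).
rewrite mulrC => H; rewrite (_ : (fun j => _) = fun j => (\sum_(k < m.+1) (p j).[om ^+ k] * (om ^+ k) ^- l) * (m.+1%:R)^-1).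
  by apply: H; apply: clim_sum => k; apply: climZ; exact: pg.
by apply/funext => j; rewrite mulrC.
Qed.
End Limits.

Section Normalization.
Variables (R : realType) (n : nat) (F : C R -> 'rV[C R]_n.+1).
Local Notation K := (C R).
Local Notation en := (@euclidean_norm R n).
Implicit Types (x y s b e t M A B r rho : R) (z w h c d : K) (p q k : {poly K}).
Hypothesis F_entire : forall j, entire (coord_fun F j).
Hypothesis F_neq0 : forall z, F z != 0.
Local Notation T r := (characteristic F r).

Lemma normalizer_exists r : 0 < r -> exists k,
  k.[0] = toC (lognorm F 0) /\ forall z, cabs z = r -> T r - 2 <= lognorm F z - cre k.[z] <= T r + 2.
Proof.
move=> r0; have cu : circ_cont (lognorm F) r.
  by apply: rc_at_circ_cont => z _; exact: lognorm_cont F_entire F_neq0 z.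
have [p Hp] := circle_approx r0 cu.
pose k := p + (toC (lognorm F 0) - p.[0])%:P.
have k0 : k.[0] = toC (lognorm F 0) by rewrite hornerD hornerC addrC subrK.
have k0' : cre k.[0] = lognorm F 0 by rewrite k0.
pose c := cre p.[0] - lognorm F 0.
have kz z : cabs z = r -> c - 1 <= lognorm F z - cre k.[z] <= c + 1.
  by move=> /Hp; rewrite ler_norml hornerD hornerC creD creB /c /=; lra.
have h1 := characteristic_le F_entire F_neq0 (ltW r0) k0' (fun z zr => proj2 (andP (kz z zr))).
have h2 := characteristic_ge F_entire F_neq0 (ltW r0) k0' (fun z zr => proj1 (andP (kz z zr))).
by exists k; split=> // z /kz; lra.
Qed.

Variable kap : nat -> {poly K}.
Hypothesis kap0 : forall j, (kap j).[0] = toC (lognorm F 0).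
Hypothesis kap_circle : forall j z, cabs z = 2 ^+ j ->
  T (2 ^+ j) - 2 <= lognorm F z - cre (kap j).[z] <= T (2 ^+ j) + 2.

(** Dividing by exp(k_j) keeps the line spanned by the coordinates and makes the
    norm nearly constant on |z| = 2^j. *)
Definition normalized j (i : 'I_n.+1) z : K := expC (- (kap j).[z]) * F z 0 i.

Lemma normalized_entire j i : entire (normalized j i).
Proof.
apply: entireM (@F_entire i).
exact: entire_comp (@entire_expC R) (entireN (entire_horner (kap j))).
Qed.

Lemma lognorm_en z : en (F z) = expR (lognorm F z).
Proof. by rewrite /lognorm lnK// posrE en_gt0. Qed.

Lemma normalized_en j z : en (\row_i normalized j i z) = expR (lognorm F z - cre (kap j).[z]).
Proof.
rewrite (_ : \row_i _ = expC (- (kap j).[z]) *: F z); last by apply/rowP => i; rewrite !mxE.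
by rewrite en_scale lognorm_en cabs_expC creN -expRD addrC.
Qed.

Lemma normalized_circle j i z : cabs z = 2 ^+ j -> cabs (normalized j i z) <= expR (T (2 ^+ j) + 2).
Proof.
move=> zj; have := en_coord (\row_i normalized j i z) i; rewrite mxE normalized_en => /le_trans; apply.
by rewrite ler_expR; case/andP: (kap_circle zj).
Qed.

Lemma normalized_disc j i z : cabs z <= 2 ^+ j / 2 -> cabs (normalized j i z) <= 4 * expR (T (2 ^+ j) + 2).
Proof.
move=> zj; have p0 : 0 < 2 ^+ j :> R by rewrite exprn_gt0.
have [_ H] := taylorP p0 (@normalized_entire j i) (@normalized_circle j i).
have := H 0%N z zj; rewrite /psum big_ord0 subr0 expr0 mulr1 mulrA -natrM; exact.
Qed.

(** The loss in passing from the circle |z| = 2^j to the disc of half the radius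
    with the Taylor estimate instead of the maximum principle. *)
Definition disc_loss : R := 2 + ln (4 * n.+1%:R).

Lemma disc_loss_ge2 : 2 <= disc_loss.
Proof. by rewrite /disc_loss lerDl ln_ge0// -natrM ler1n. Qed.

Lemma disc_loss_ge0 : 0 <= disc_loss.
Proof. by rewrite /disc_loss addr_ge0// ln_ge0// -natrM ler1n. Qed.

Lemma disc_loss_exp x : expR (x + disc_loss) = n.+1%:R * (4 * expR (x + 2)).
Proof.
rewrite /disc_loss addrA [LHS]expRD lnK ?posrE ?mulr_gt0//; ring.
Qed.

Lemma lognorm_disc j z : cabs z <= 2 ^+ j / 2 ->
  lognorm F z - cre (kap j).[z] <= T (2 ^+ j) + disc_loss.
Proof.
move=> zj; rewrite -ler_expR -normalized_en disc_loss_exp.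
apply: le_trans (en_le_sum _) _.
rewrite mulr_natl -[n.+1 in leRHS]card_ord -sumr_const; apply: ler_sum => i _.
by rewrite mxE normalized_disc.
Qed.

Local Opaque characteristic lognorm disc_loss.

Lemma characteristic_lower j : - disc_loss <= T (2 ^+ j).
Proof.
have h : cabs (0 : K) <= 2 ^+ j / 2 by rewrite cabs0 divr_ge0// exprn_ge0.
by have := lognorm_disc h; rewrite kap0 /=; lra.
Qed.

Lemma characteristic_attained j r : 0 <= r -> exists2 z, cabs z = r &
  T r - 1 < lognorm F z - cre (kap j).[z].
Proof.
move=> r0; apply: contrapT => H.
have k0 : cre (kap j).[0] = lognorm F 0 by rewrite kap0.
have : T r <= T r - 1.
  apply: (characteristic_le F_entire F_neq0 r0 k0) => z zr.
  by rewrite leNgt; apply/negP => h; apply: H; exists z.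
by lra.
Qed.

(** A substitute for monotonicity of T: the value of log |F| - Re k_j is at least
    T(2^i) - 1 somewhere on the smaller circle, and bounded on the disc. *)
Lemma characteristic_mono i j : (i < j)%N -> T (2 ^+ i) <= T (2 ^+ j) + disc_loss + 1.
Proof.
move=> ij; have [|z zi h] := @characteristic_attained j (2 ^+ i); first by rewrite exprn_ge0.
have zj : cabs z <= 2 ^+ j / 2.
  by rewrite ler_pdivlMr// zi -exprSr ler_eXn2l ?ltr1n.
have := lognorm_disc zj; move: h; move: (T _) (T _) (lognorm F z) (cre _) disc_loss => *; lra.
Qed.

(** On |z| = 2^j the real part of k_j - k_(j+1) is bounded above by the increment
    of T up to a constant, and Borel-Caratheodory bounds the difference, which vanishes at 0. *)
Lemma normalizer_step j z : cabs z <= 2 ^+ j / 2 ->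
  cabs ((kap j).[z] - (kap j.+1).[z]) <=
    4 * (T (2 ^+ j.+1) + disc_loss - T (2 ^+ j) + 2) * (cabs z / 2 ^+ j).
Proof.
move=> zj; have p0 : 0 < 2 ^+ j :> R by rewrite exprn_gt0.
pose q := kap j - kap j.+1.
have q0 : q.[0] = 0 by rewrite hornerD hornerN !kap0 subrr.
set B := T (2 ^+ j.+1) + disc_loss - T (2 ^+ j) + 2.
have qB w : cabs w = 2 ^+ j -> cre q.[w] <= B.
  move=> wj; rewrite hornerD hornerN creB.
  have /andP[h1 h2] := kap_circle wj.
  have wj' : cabs w <= 2 ^+ j.+1 / 2 by rewrite wj exprSr mulfK.
  have := lognorm_disc wj'; rewrite /B; move: h1 h2; move: (T _) (T _) (lognorm F w) (cre _) (cre _) disc_loss => *; lra.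
have := horner_le_coef p0 q0 (borel_caratheodory p0 q0 qB) zj.
rewrite hornerD hornerN => /le_trans; apply.
by rewrite !mulrA -[2 * 2]natrM.
Qed.

Hypothesis slow : exists j0 : nat, exists2 c : R, 0 <= c & forall j, (j0 <= j)%N -> T (2 ^+ j) <= c * (3 / 2) ^+ j.

(** T(2^j) is O((3/2)^j) while |z|/2^j is halved at each stage, whence the
    ratio 3/4. *)
Lemma normalizer_cauchy z : exists j0 : nat, exists2 D : R, 0 <= D &
  forall j, (j0 <= j)%N -> cabs ((kap j).[z] - (kap j.+1).[z]) <= D * (3 / 4) ^+ j.
Proof.
have [j0 [c c0 Hc]] := slow.
have [N HN] : exists N, forall j, (N <= j)%N -> 2^-1 ^+ j < 1 / (2 * cabs z + 1).
  by apply: expr_small; [lra|rewrite divr_gt0//; have := cabs_ge0 z; lra].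
have dl0 := disc_loss_ge0.
exists (maxn j0 N); exists (4 * (3 / 2 * c + 2 * disc_loss + 2) * cabs z).
  by rewrite !mulr_ge0 ?cabs_ge0//; lra.
move=> j; rewrite geq_max => /andP[jj jN].
have z0 := cabs_ge0 z.
have zj : cabs z <= 2 ^+ j / 2.
  have := HN j jN; rewrite exprVn ltr_pdivlMr; last by lra.
  rewrite mulrC ltr_pdivrMr ?exprn_gt0//; lra.
apply: le_trans (normalizer_step zj) _.
have -> : (3 / 4) ^+ j = (3 / 2) ^+ j / 2 ^+ j :> R.
  by rewrite -expr_div_n; congr (_ ^+ _); field.
have h1 := Hc j.+1 (leqW jj); have h2 := characteristic_lower j.
rewrite [leRHS](_ : _ = 4 * ((3 / 2 * c + 2 * disc_loss + 2) * (3 / 2) ^+ j) * (cabs z / 2 ^+ j)); last first.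
  by move: (2 ^+ j)^-1 ((3 / 2) ^+ j) disc_loss (cabs z) => a1 a2 a3 a4; ring.
apply: ler_wpM2r; first by rewrite divr_ge0// exprn_ge0.
have p1 : 1 <= (3 / 2) ^+ j :> R by rewrite exprn_ege1// ler_pdivlMr// mul1r ler_nat.
rewrite ler_wpM2l//; move: h1; rewrite [(3 / 2) ^+ j.+1]exprS.
move: ((3 / 2) ^+ j) p1 => P p1.
have dP : 0 <= (2 * disc_loss + 2) * (P - 1) by rewrite mulr_ge0 ?subr_ge0// addr_ge0// mulr_ge0.
move: (T _) (T _) disc_loss dP h2 => t1 t2 dl dP h2 h1.
have -> : (3 / 2 * c + 2 * dl + 2) * P = c * (3 / 2 * P) + (2 * dl + 2) * (P - 1) + (2 * dl + 2) by ring.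
lra.
Qed.

Lemma normalizer_bounded z : exists2 B : R, 0 <= B & forall j, cabs (kap j).[z] <= B.
Proof.
have [j0 [D D0 H]] := normalizer_cauchy z.
have q01 : 0 <= (3 / 4 : R) < 1 by apply/andP; split; [rewrite divr_ge0|rewrite ltr_pdivrMr// mul1r ltr_nat].
have [l Hl] := @geometric_cauchy _ (fun j => (kap j).[z]) j0 D _ D0 q01 H.
exists (\sum_(i < j0) cabs (kap i).[z] + (cabs l + 2 * (D / (1 - 3 / 4)))).
  rewrite addr_ge0 ?sumr_ge0// => [i _|]; first exact: cabs_ge0.
  by rewrite addr_ge0 ?cabs_ge0// mulr_ge0// divr_ge0//; lra.
move=> j.
have l0 : 0 <= cabs l + 2 * (D / (1 - 3 / 4)).
  by rewrite addr_ge0 ?cabs_ge0// mulr_ge0// divr_ge0//; lra.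
have [jj|jj] := leqP j0 j; last first.
  rewrite (bigD1 (Ordinal jj)) //= -addrA lerDl addr_ge0// sumr_ge0// => i _; exact: cabs_ge0.
have s0 : 0 <= \sum_(i < j0) cabs (kap i).[z] by rewrite sumr_ge0// => i _; exact: cabs_ge0.
apply: (@le_trans _ _ (cabs l + 2 * (D / (1 - 3 / 4)))); last by rewrite lerDr.
rewrite -(subrK l (kap j).[z]) addrC; apply: le_trans (cabsD _ _) _; rewrite lerD2l.
apply: le_trans (Hl j jj) _; rewrite ler_wpM2l// ler_piMr//.
  by rewrite divr_ge0//; lra.
by rewrite exprn_ile1//; lra.
Qed.
End Normalization.

(** * Slow growth and rational curves *)

Local Opaque entire derive1 derive1n characteristic lognorm disc_loss.

Section Rationality.
Variables (R : realType) (n : nat).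
Local Notation K := (C R).
Implicit Types (z w c : K) (v : 'rV[K]_n.+1).

Lemma line_scale c v : c != 0 -> <[c *: v]>%VS = <[v]>%VS.
Proof.
move=> c0; apply/eqP; rewrite eqEsubv -!memvE memvZ ?memv_line//=.
by rewrite -[v in v \in _](scalerK c0) memvZ ?memv_line.
Qed.

Lemma expC_cts : ccont (fun w => expC (- w)).
Proof. exact: entire_ccont (entire_comp (@entire_expC R) (entireN (@entire_id R))). Qed.

(** The point at infinity of a curve with polynomial coordinates P_i is reached
    through the reversed polynomials w^D P_i(1/w). *)
Lemma rational_of_poly (f : K -> projective_space R n) (P : 'I_n.+1 -> {poly K}) :
  holomorphic_curve f -> (forall z, (\row_i (P i).[z]) != 0) ->
  (forall z, val (f z) = <[\row_i (P i).[z]]>%VS) -> rational_curve f.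
Proof.
move=> fh P0 fP; split=> //.
pose D := (\max_(i < n.+1) size (P i)).-1.
have sP i : (size (P i) <= D.+1)%N.
  by rewrite /D; apply: leq_trans (leqSpred _); exact: (@leq_bigmax _ (fun i => size (P i)) i).
have [i0 i0D] : exists i, (P i)`_D != 0.
  have card0 : (0 < #|'I_n.+1|)%N by rewrite card_ord.
  have [i0 hi0] := @bigop.eq_bigmax 'I_n.+1 (fun i => size (P i)) card0.
  exists i0; rewrite /D hi0 -/(lead_coef (P i0)) lead_coef_eq0.
  apply/negP => /eqP Pi0; move: (P0 0); apply/negP; rewrite negbK; apply/eqP/rowP => i; rewrite !mxE.
  have : (size (P i) <= size (P i0))%N by rewrite -hi0; exact: (@leq_bigmax _ (fun i => size (P i)) i).
  by rewrite Pi0 size_poly0 leqn0 size_poly_eq0 => /eqP ->; rewrite horner0.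
pose Q i := \poly_(l < D.+1) (P i)`_(D - l).
have QP i w : w != 0 -> (Q i).[w] = w ^+ D * (P i).[w^-1].
  move=> w0; rewrite horner_poly (horner_coef_wide _ (sP i)) mulr_sumr.
  rewrite (reindex_inj rev_ord_inj) /=; apply: eq_bigr => l _.
  have lD : (l <= D)%N by rewrite -ltnS.
  rewrite subSS subKn// mulrCA; congr (_ * _).
  by rewrite exprVn expfB_cond ?(negbTE w0).
pose G w := \row_i (Q i).[w].
have GP w : w != 0 -> G w = w ^+ D *: \row_i (P i).[w^-1].
  by move=> w0; apply/rowP => i; rewrite !mxE QP.
have G0 w : G w != 0.
  have [->|w0] := eqVneq w 0; last by rewrite GP// scaler_eq0 negb_or expf_neq0//= P0.
  apply/negP => /eqP/rowP/(_ i0); rewrite !mxE horner_coef0 coef_poly /= subn0.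
  exact/eqP.
exists (fun w => insubd (f 0) <[G w]>%VS); split.
  exists G; apply: (@nearW K (nbhs (0 : K)) _ (nbhs_filter (0 : K))) => w; split=> //; last by rewrite val_insubd dim_vline G0.
  move=> i; have -> : coord_fun G i = horner (Q i) by apply/funext => x; rewrite /coord_fun mxE.
  exact: entire_horner.
move=> w w0; apply: val_inj; rewrite val_insubd dim_vline G0 fP GP// line_scale//.
by rewrite expf_neq0.
Qed.
End Rationality.

Section SlowGrowth.
Variables (R : realType) (n : nat) (F : C R -> 'rV[C R]_n.+1).
Local Notation K := (C R).
Implicit Types (z w : K) (c : R).
Hypothesis F_entire : forall j, entire (coord_fun F j).
Hypothesis F_neq0 : forall z, F z != 0.
Local Notation T r := (characteristic F r).
Variable kap : nat -> {poly K}.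
Hypothesis kap0 : forall j, (kap j).[0] = toC (lognorm F 0).
Hypothesis kap_circle : forall j z, cabs z = 2 ^+ j ->
  T (2 ^+ j) - 2 <= lognorm F z - cre (kap j).[z] <= T (2 ^+ j) + 2.
Hypothesis slow : exists j0 : nat, exists2 c : R, 0 <= c & forall j, (j0 <= j)%N -> T (2 ^+ j) <= c * (3 / 2) ^+ j.

Lemma normalizer_limit z : exists l : K, clim (fun j => (kap j).[z]) l.
Proof.
have [j0 [D D0 H]] := normalizer_cauchy F_entire F_neq0 kap0 kap_circle slow z.
have q01 : 0 <= (3 / 4 : R) < 1 by apply/andP; split; [rewrite divr_ge0|rewrite ltr_pdivrMr// mul1r ltr_nat].
have [l Hl] := @geometric_cauchy _ (fun j => (kap j).[z]) j0 D _ D0 q01 H.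
exists l; apply: (@clim_geometric _ _ j0 (2 * (D / (1 - 3 / 4))) (3 / 4)) => //.
  by rewrite mulr_ge0// divr_ge0//; case/andP: q01 => _ /ltW; rewrite subr_ge0.
by move=> j /Hl; rewrite mulrA.
Qed.

(** If exp T grows at most polynomially, Taylor remainders beyond a fixed degree
    tend to 0 and the normalized coordinates converge to polynomials, which span
    the same line as F. *)
Lemma rational_of_slow_growth (f : K -> projective_space R n) m c J :
  holomorphic_curve f -> (forall z, val (f z) = <[F z]>%VS) ->
  (forall j, (J <= j)%N -> expR (T (2 ^+ j)) <= c * (2 ^+ j) ^+ m) -> rational_curve f.
Proof.
move=> fh fF Tm.
have [l Hl] := choice normalizer_limit.
pose G i z := expC (- l z) * F z 0 i.
have nG i z : clim (fun j => normalized F kap j i z) (G i z).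
  by apply: (climZ (F z 0 i)); exact: (@clim_comp _ (fun j => (kap j).[z]) (fun w => expC (- w)) _ (@expC_cts R) (Hl z)).
pose p i j := \poly_(a < m.+1) taylor (normalized F kap j i) a.
have pE i j z : (p i j).[z] = psum (taylor (normalized F kap j i)) m.+1 z.
  by rewrite horner_poly.
have pG i z : clim (fun j => (p i j).[z]) (G i z).
  rewrite (_ : (fun j => _) = fun j => normalized F kap j i z + ((p i j).[z] - normalized F kap j i z)); last first.
    by apply/funext => j; rewrite addrC subrK.
  rewrite -[G i z]addr0; apply: climD (nG i z) _.
  have half : 0 <= (2^-1 : R) < 1 by apply/andP; split; [rewrite invr_ge0 ler0n|rewrite invf_lt1 ?ltr1n].
  have [N HN] : exists N, forall j, (N <= j)%N -> 2^-1 ^+ j < 1 / (2 * cabs z + 1).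
    by apply: expr_small half _; rewrite divr_gt0// ltr_wpDl// mulr_ge0// cabs_ge0.
  pose D := 4 * (c * expR 2) * cabs z ^+ m.+1.
  have est j : (maxn N J <= j)%N -> cabs ((p i j).[z] - normalized F kap j i z - 0) <= D * 2^-1 ^+ j.
    rewrite geq_max => /andP[jN jJ]; rewrite subr0 cabsC pE.
    have p0 : 0 < 2 ^+ j :> R by rewrite exprn_gt0.
    have zj : cabs z <= 2 ^+ j / 2.
      have := HN j jN; rewrite exprVn ltr_pdivlMr ?ltr_wpDl ?mulr_ge0 ?cabs_ge0//.
      rewrite mulrC ltr_pdivrMr// mul1r ler_pdivlMr// => /ltW; apply: le_trans.
      by rewrite mulrC lerDl.
    have [_ H] := taylorP p0 (@normalized_entire _ _ _ F_entire kap j i) (@normalized_circle _ _ _ F_neq0 kap kap_circle j i).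
    apply: le_trans (H m.+1 z zj) _.
    rewrite /D expRD expr_div_n exprVn.
    have := Tm j jJ; move: (expR (T _)) (expR 2) (expR_ge0 (2 : R)) => t e e0 ht.
    have -> : 2 * (2 * (t * e)) * (cabs z ^+ m.+1 / (2 ^+ j) ^+ m.+1) = (4 * e * cabs z ^+ m.+1 / (2 ^+ j) ^+ m.+1) * t by ring.
    have -> : 4 * (c * e) * cabs z ^+ m.+1 / 2 ^+ j = (4 * e * cabs z ^+ m.+1 / (2 ^+ j) ^+ m.+1) * (c * (2 ^+ j) ^+ m).
      rewrite [(2 ^+ j) ^+ m.+1]exprS; field; have p0' : 2 ^+ j != 0 :> R by rewrite gt_eqF.
      by rewrite p0' expf_neq0.
    by apply: ler_wpM2l => //; rewrite divr_ge0 ?exprn_ge0// !mulr_ge0 ?exprn_ge0 ?cabs_ge0.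
  have [c0|c0] := lerP 0 c.
    apply: (clim_geometric _ half est); rewrite !mulr_ge0 ?exprn_ge0 ?cabs_ge0 ?expR_ge0//.
  exfalso; have := Tm J (leqnn _); apply/negP; rewrite -ltNge.
  apply: lt_trans (expR_gt0 _); rewrite pmulr_llt0// !exprn_gt0//.
have sp i j : (size (p i j) <= m.+1)%N by exact: size_poly.
have GP i : exists q : {poly K}, forall z, G i z = q.[z].
  by have [q _ hq] := poly_pointwise_limit (sp i) (pG i); exists q.
have [P HP] := choice GP.
have GF z : \row_i (P i).[z] = expC (- l z) *: F z by apply/rowP => i; rewrite !mxE -HP.
apply: (rational_of_poly (P := P)) fh _ _ => z; rewrite GF.
  by rewrite scaler_eq0 negb_or expC_neq0//= F_neq0.
by rewrite line_scale ?expC_neq0.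
Qed.
End SlowGrowth.

(** * Order zero and non-degeneracy *)

Section Growth.
Variable R : realType.
Implicit Types (t : nat -> R) (a M e : R) (b j k J m : nat).

Lemma limf_esup_lt (g : R -> R) a : (limf_esup (fun r => (g r)%:E) (pinfty_nbhs R) < a%:E)%E ->
  exists M, forall r, M < r -> g r < a.
Proof.
move=> /ereal_inf_lt[_ [/= A [M [_ AM]] <-]] h; exists M => r Mr.
rewrite -lte_fin; apply: le_lt_trans h; apply: ereal_sup_ubound; exists r => //; exact: AM.
Qed.

(** If every late j with t j >= M j had its value doubled b steps later, then from
    one high peak, where t j >= M (b+1) j, iteration would give exponential
    growth along j + b k; the peak is high enough for the lower bound to
    persist. *)
Lemma doubling_pause t b J0 M : (0 < b)%N -> 0 < M ->
  (forall e, 0 < e -> exists j0, forall j, (j0 <= j)%N -> t j <= expR (e * j%:R)) ->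
  (forall m J, exists2 j, (J <= j)%N & m%:R * j%:R < t j) ->
  exists j, [/\ (J0 <= j)%N, t (j + b)%N <= 2 * t j & M * j%:R <= t j].
Proof.
move=> b0 M0 slow fast; apply: contrapT => none.
have dbl j : (J0 <= j)%N -> M * j%:R <= t j -> 2 * t j < t (j + b)%N.
  by move=> jJ jM; rewrite ltNge; apply/negP => h; apply: none; exists j.
pose m := (Num.truncn (M * b.+1%:R)).+1.
have Mm : M * b.+1%:R <= m%:R by apply/ltW; exact: truncnS_gt.
have [j0 jJ0 j0t] := fast m (maxn J0 1).
move: jJ0; rewrite geq_max => /andP[jJ0 j01].
have tj0 : M * b.+1%:R * j0%:R <= t j0.
  by apply: le_trans (ltW j0t); rewrite ler_wpM2r.
have tj0_gt0 : 0 < t j0 by apply: lt_le_trans tj0; rewrite !mulr_gt0 ?ltr0n.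
have up k : 2 ^+ k * t j0 <= t (j0 + b * k)%N.
  elim: k => [|k IH]; first by rewrite muln0 addn0 expr0 mul1r.
  have kM : M * (j0 + b * k)%:R <= t (j0 + b * k)%N.
    apply: le_trans IH; apply: (@le_trans _ _ (2 ^+ k * (M * b.+1%:R * j0%:R))).
      rewrite -!mulrA [leRHS]mulrCA ler_wpM2l ?(ltW M0)// -natrX -!natrM ler_nat.
      have h1 : (k < 2 ^ k)%N by exact: ltn_expl.
      apply: (@leq_trans (k.+1 * (b.+1 * j0))); last by rewrite leq_mul2r h1 orbT.
      by nia.
    by rewrite ler_wpM2l ?exprn_ge0.
  have := dbl _ (leq_trans jJ0 (leq_addr _ _)) kM.
  rewrite -addnA -[(b * k + b)%N]addnC -mulnS exprS -mulrA => /ltW; apply: le_trans.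
  by rewrite ler_wpM2l.
(* With this exponent the upper bound grows like 2^(k/2) along j0 + b k. *)
pose e := ln 2 / (2 * b%:R) : R.
have ln2 : 0 < ln 2 :> R by rewrite ln_gt0// ltr1n.
have e0 : 0 < e by rewrite divr_gt0// mulr_gt0// ltr0n.
have [j1 Hj1] := slow e e0.
pose q := expR (- (ln 2 / 2)) : R.
have q01 : 0 <= q < 1 by rewrite expR_ge0 /q expR_lt1 oppr_lt0 divr_gt0.
have qE k : expR (e * (j0 + b * k)%:R) = expR (e * j0%:R) * (2 ^+ k * q ^+ k).
  have -> : e * (j0 + b * k)%:R = e * j0%:R + (ln 2 - ln 2 / 2) * k%:R.
    rewrite natrD natrM mulrDr; congr (_ + _).
    by rewrite /e; field; rewrite pnatr_eq0 -lt0n.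
  by rewrite expRD; congr (_ * _); rewrite -exprMn expRM_natr expRD lnK// posrE.
have [k0 Hk0] := expr_small q01 (divr_gt0 tj0_gt0 (expR_gt0 (e * j0%:R))).
pose k := maxn k0 j1.
have h1 := Hk0 k (leq_maxl _ _).
have jk : (j1 <= j0 + b * k)%N.
  by apply: leq_trans (leq_maxr k0 j1) _; apply: leq_trans (leq_addl _ _); rewrite leq_pmull.
have := le_trans (up k) (Hj1 _ jk); rewrite qE; apply/negP; rewrite -ltNge.
move: h1; rewrite ltr_pdivlMr ?expR_gt0// => h1.
rewrite mulrCA ltr_pM2l ?exprn_gt0//; by rewrite mulrC.
Qed.
End Growth.

Section OrderZero.
Variables (R : realType) (n : nat) (F : C R -> 'rV[C R]_n.+1).
Local Notation T r := (characteristic F r).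
Hypothesis order0 : curve_order F = 0%E.

Lemma order_zero_subexponential (e : R) : 0 < e ->
  exists j0 : nat, forall j, (j0 <= j)%N -> T (2 ^+ j) <= expR (e * j%:R).
Proof.
move=> e0; have [|M HM] := @limf_esup_lt R (fun r => ln (T r) / ln r) e.
  by move: order0; rewrite /curve_order => ->; rewrite lte_fin.
pose N := (Num.truncn `|M|).+1.
exists N => j jN.
have j0 : (0 < j)%N by exact: leq_trans jN.
have Mj : M < 2 ^+ j.
  apply: le_lt_trans (ler_norm _) _; apply: lt_le_trans (truncnS_gt _) _.
  by rewrite -natrX ler_nat; apply: leq_trans jN _; apply: ltnW; exact: ltn_expl.
have [T0|T0] := lerP (T (2 ^+ j)) 0; first by apply: le_trans T0 (expR_ge0 _).
have ln2 : 0 < ln 2 :> R by rewrite ln_gt0// ltr1n.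
have := HM _ Mj; rewrite lnXn// ltr_pdivrMr ?pmulrn_rgt0// => h.
rewrite -[leLHS](lnK (_ : _ \is Num.pos)) ?posrE// ler_expR; apply: le_trans (ltW h) _.
rewrite ler_wpM2l ?(ltW e0)// -[ln 2 *+ j]mulr_natr ler_piMl//.
by have -> : 2 = 1 + 1 :> R by []; apply: le_ln1Dx; rewrite (lt_trans _ ltr01)// ltrN10.
Qed.

Lemma order_zero_slow :
  exists j0 : nat, exists2 c : R, 0 <= c & forall j, (j0 <= j)%N -> T (2 ^+ j) <= c * (3 / 2) ^+ j.
Proof.
have e0 : 0 < ln (3 / 2) :> R by rewrite ln_gt0// ltr_pdivlMr// mul1r ltr_nat.
have [j0 H] := order_zero_subexponential e0; exists j0; exists 1 => // j /H.
by rewrite mul1r expRM_natr lnK// posrE divr_gt0.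
Qed.
End OrderZero.

Section Nondegeneracy.
Variables (R : realType) (n : nat) (F : C R -> 'rV[C R]_n.+1).
Local Notation K := (C R).
Implicit Types (zs : seq K) (x : 'I_n.+1 -> K) (B : R).
Hypothesis F_nondeg : linearly_nondegenerate F.

Definition value_matrix zs : 'M[K]_(size zs, n.+1) := \matrix_(i < size zs) F (nth 0 zs i).

Lemma value_sub zs z : z \in zs -> (F z <= value_matrix zs)%MS.
Proof.
move=> zs_z; have iz : (index z zs < size zs)%N by rewrite index_mem.
by rewrite -[z](nth_index 0 zs_z) -(rowK (fun i : 'I_(size zs) => F (nth 0 zs i)) (Ordinal iz)) row_sub.
Qed.

(** If the values span a proper subspace, a linear form vanishes on them; by
    non-degeneracy it does not vanish at some further point, whose value enlarges
    the span. *)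
Lemma value_rank k : (k <= n.+1)%N -> exists zs, (k <= \rank (value_matrix zs))%N.
Proof.
elim: k => [|k IH] kn; first by exists [::].
have [zs Hzs] := IH (ltnW kn).
have [kr|rk] := ltnP k (\rank (value_matrix zs)); first by exists zs.
have co : cokermx (value_matrix zs) != 0.
  by rewrite -mxrank_eq0 mxrank_coker subn_eq0 -ltnNge; exact: leq_ltn_trans rk kn.
have [z Hz] : exists z, ~~ (F z <= value_matrix zs)%MS.
  apply: contrapT => none; move/negP: co; apply; apply/eqP/matrixP => i j; rewrite [RHS]mxE.
  apply: (F_nondeg (c := fun i => cokermx (value_matrix zs) i j)) => z.
  have : (F z <= value_matrix zs)%MS by apply: contrapT => /negP h; apply: none; exists z.
  rewrite submxE => /eqP/matrixP/(_ 0 j); rewrite !mxE => h.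
  by rewrite -[RHS]h; apply: eq_bigr => l _; rewrite mulrC.
exists (z :: zs); apply: leq_ltn_trans Hzs _; rewrite ltnNge; apply/negP => h.
have sub : (value_matrix zs <= value_matrix (z :: zs))%MS.
  apply/row_subP => i; rewrite rowK; apply: value_sub; rewrite in_cons mem_nth ?orbT//.
have := mxrank_leqif_sup sub => -[_ e].
have : (value_matrix (z :: zs) <= value_matrix zs)%MS.
  by rewrite -e eqn_leq h andbT mxrankS.
by apply/negP; apply: contra Hz; apply: submx_trans; apply: value_sub; rewrite mem_head.
Qed.

(** Finitely many values of F span the whole space, and then the values of a
    linear combination of the coordinates at these points determine its
    coefficients linearly. *)
Lemma nondegenerate_points : exists zs, exists2 c : R, 1 <= c & forall x B,
  (forall z, z \in zs -> cabs (\sum_i x i * F z 0 i) <= B) -> forall i, cabs (x i) <= c * B.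
Proof.
have [zs Hzs] := value_rank (leqnn _).
have [L0 HL0] : exists L0, L0 *m value_matrix zs = 1%:M.
  by apply/row_fullP; rewrite -col_leq_rank.
exists zs; exists (1 + \sum_i \sum_j cabs (L0 i j)).
  by rewrite lerDl; apply: sumr_ge0 => i _; apply: sumr_ge0 => j _; exact: cabs_ge0.
move=> x B HB i.
pose X := \col_i x i.
have XE : X = L0 *m (value_matrix zs *m X) by rewrite mulmxA HL0 mul1mx.
have -> : x i = \sum_j L0 i j * (\sum_l x l * F (nth 0 zs j) 0 l).
  transitivity (X i 0); first by rewrite mxE.
  rewrite {1}XE mxE; apply: eq_bigr => j _; congr (_ * _).
  by rewrite mxE; apply: eq_bigr => l _; rewrite !mxE mulrC.
have [zs0|zs0] := eqVneq (size zs) 0%N.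
  have := Hzs; rewrite leqNgt => /negP[]; apply: leq_ltn_trans (rank_leq_row _) _; by rewrite zs0.
have B_ge0 : 0 <= B.
  apply: le_trans (HB (nth 0 zs 0) _); first exact: cabs_ge0.
  by rewrite mem_nth// lt0n.
apply: le_trans (cabs_sum _ _ _) _.
apply: (@le_trans _ _ ((\sum_j cabs (L0 i j)) * B)).
  rewrite mulr_suml; apply: ler_sum => j _; rewrite cabsM ler_wpM2l ?cabs_ge0//.
  by apply: HB; rewrite mem_nth.
rewrite ler_wpM2r// (bigD1 i)//= addrCA lerDl addr_ge0//.
by apply: sumr_ge0 => l _; apply: sumr_ge0 => j _; exact: cabs_ge0.
Qed.
End Nondegeneracy.

(** * Lower bounds for the Wronskian: polynomials *)

Section Determinants.
Variable R : realType.
Local Notation K := (C R).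
Implicit Types (H e r M B : R) (z w c : K) (p : {poly K}).

Lemma prod_le_pow m (a : 'I_m -> K) H : 0 <= H -> (forall i, cabs (a i) <= H) ->
  cabs (\prod_i a i) <= H ^+ m.
Proof.
move=> H0 aH; rewrite cabs_prod -[m in leRHS]card_ord -prodr_const.
by apply: ler_prod => i _; rewrite cabs_ge0 aH.
Qed.

Lemma prod_perturb m (a b : 'I_m -> K) H e : 1 <= H -> 0 <= e ->
  (forall i, cabs (a i) <= H) -> (forall i, cabs (b i) <= H) ->
  (forall i, cabs (a i - b i) <= e) -> cabs (\prod_i a i - \prod_i b i) <= m%:R * e * H ^+ m.
Proof.
move=> H1 e0; have H0 : 0 <= H by exact: le_trans ler01 H1.
elim: m a b => [|m IH] a b aH bH ab; first by rewrite !big_ord0 subrr cabs0 !mul0r.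
rewrite !big_ord_recl.
set pa := \prod_(i < m) _; set pb := \prod_(i < m) _.
have -> : a ord0 * pa - b ord0 * pb = a ord0 * (pa - pb) + (a ord0 - b ord0) * pb by ring.
apply: le_trans (cabsD _ _) _; rewrite !cabsM.
have h1 : cabs (a ord0) * cabs (pa - pb) <= H * (m%:R * e * H ^+ m).
  by apply: ler_pM; rewrite ?cabs_ge0//; apply: IH.
have h2 : cabs (a ord0 - b ord0) * cabs pb <= e * H ^+ m.+1.
  apply: ler_pM; rewrite ?cabs_ge0//; apply: le_trans (prod_le_pow H0 _) _ => //.
  by rewrite exprS ler_peMl// exprn_ge0.
apply: le_trans (lerD h1 h2) _; rewrite exprS -natr1.
by move: (H ^+ m) (m%:R) => u v; rewrite le_eqVlt; apply/orP; left; apply/eqP; ring.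
Qed.

Lemma cabs_sign (b : bool) : cabs ((-1) ^+ b : K) = 1.
Proof. by case: b; rewrite ?expr1 ?expr0 ?cabsN cabs1. Qed.

Lemma det_le m (a : 'M[K]_m) H : 0 <= H -> (forall i j, cabs (a i j) <= H) ->
  cabs (\det a) <= m`!%:R * H ^+ m.
Proof.
move=> H0 aH; rewrite /determinant; apply: le_trans (cabs_sum _ _ _) _.
rewrite mulr_natl -perm.card_Sn -sumr_const big_mkcond [leRHS]big_mkcond /=.
apply: ler_sum => s _; rewrite cabsM cabs_sign mul1r.
by apply: prod_le_pow.
Qed.

Lemma det_perturb m (a b : 'M[K]_m) H e : 1 <= H -> 0 <= e ->
  (forall i j, cabs (a i j) <= H) -> (forall i j, cabs (b i j) <= H) ->
  (forall i j, cabs (a i j - b i j) <= e) ->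
  cabs (\det a - \det b) <= m`!%:R * (m%:R * e * H ^+ m).
Proof.
move=> H1 e0 aH bH ab; rewrite /determinant -sumrB; apply: le_trans (cabs_sum _ _ _) _.
rewrite mulr_natl -perm.card_Sn -sumr_const big_mkcond [leRHS]big_mkcond /=.
apply: ler_sum => s _; rewrite -mulrBr cabsM cabs_sign mul1r.
exact: prod_perturb.
Qed.

Lemma size_det m d (a : 'M[{poly K}]_m) : (forall i j, (size (a i j) <= d)%N) ->
  (size (\det a) <= (m * d).+1)%N.
Proof.
move=> ad; rewrite /determinant; apply: leq_trans (size_sum _ _ _) _.
apply/bigmax_leqP => s _; rewrite size_Msign.
apply: leq_trans (size_poly_prod_leq _ _) _; apply: leq_trans (leq_subr _ _) _; rewrite ltnS.
apply: (@leq_trans (\sum_(i < m) d)); first by apply: leq_sum => i _.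
by rewrite sum_nat_const card_ord.
Qed.

Lemma size_derivn_le p i : (size (derivn i p) <= size p)%N.
Proof.
elim: i => [|i IH]; first by rewrite derivn0.
rewrite derivnS; apply: leq_trans IH; set q := derivn i p.
by have [->|q0] := eqVneq q 0; [rewrite deriv0|apply/ltnW/lt_size_deriv].
Qed.

Lemma derivn_scale c p i : derivn i (p \Po (c *: 'X)) = c ^+ i *: (derivn i p \Po (c *: 'X)).
Proof.
elim: i => [|i IH]; first by rewrite !derivn0 expr0 scale1r.
rewrite !derivnS IH derivZ deriv_comp derivZ derivX -scalerAr mulr1 scalerA.
by rewrite exprSr.
Qed.
End Determinants.

Section PolynomialLowerBound.
Variables (R : realType) (n : nat).
Local Notation K := (C R).
Implicit Types (H e r M B : R) (z w c : K) (p : 'I_n.+1 -> {poly K}) (x : 'I_n.+1 -> K).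

Definition poly_wronskian p z : K := \det (\matrix_(i < n.+1, j < n.+1) (derivn i (p j)).[z]).

Lemma pwronskian_scale p r w : (pwronskian n.+1 (fun j => p (inord j) \Po (toC r *: 'X))).[w] =
  \prod_(i < n.+1) toC r ^+ i * poly_wronskian p (toC r * w).
Proof.
rewrite /pwronskian /poly_wronskian -[LHS]/(horner_eval w _) -det_map_mx.
pose D : 'rV[K]_n.+1 := \row_i toC r ^+ i.
rewrite (_ : map_mx _ _ = diag_mx D *m \matrix_(i, j) (derivn i (p j)).[toC r * w]); last first.
  apply/matrixP => i j; rewrite mul_diag_mx !mxE /horner_eval inord_val.
  by rewrite derivn_scale -[LHS]/((_ *: _).[w]) hornerZ horner_scale.
by rewrite det_mulmx det_diag; congr (_ * _); apply: eq_bigr => i _; rewrite mxE.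
Qed.

(** After scaling the disc to unit size, the domination by the Wronskian bounds
    a whole system of polynomials by its Wronskian on the circle |z| = r. *)
Lemma poly_wronskian_bound : exists2 A : R, 1 <= A & forall d p (C0 r M : R),
  1 <= r -> 1 <= C0 -> 0 <= M -> (forall i, (size (p i) <= d.+1)%N) ->
  (forall x B, (forall z, cabs z <= r -> cabs (\sum_i x i * (p i).[z]) <= B) ->
     forall i, cabs (x i) <= C0 * B) ->
  (forall z, cabs z = r -> cabs (poly_wronskian p z) <= M) ->
  forall i z, cabs z <= r ->
    cabs (p i).[z] <= (2 * C0) ^+ n.+1 * (A ^+ d.+1 * (r ^+ (n * n.+1) * M)).
Proof.
have [A A1 HA] := wronskian_dominates R n.
have A0 : 0 <= A by exact: le_trans ler01 A1.
exists (A * (2 * (2 * n.+1%:R))).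
  by rewrite mulr_ege1// -!natrM ler1n.
move=> d p C0 r M r1 C01 M0 sp Hx HM i z zr.
have r0 : 0 < r by exact: lt_le_trans ltr01 r1.
pose P j := p (inord j) \Po (toC r *: 'X).
have rC : toC r != 0 by rewrite -cabs_eq0 cabs_toC normr_eq0 gt_eqF.
have sP j : (size (P j) <= d.+1)%N.
  apply/leq_sizeP => l dl; rewrite coef_scale.
  by have /leq_sizeP/(_ _ dl) -> := sp (inord j); rewrite mulr0.
have PE j w : cabs w <= r -> (p j).[w] = (P j).[w / toC r].
  by move=> _; rewrite horner_scale inord_val mulrC divfK.
have wr w : cabs w <= r -> cabs (w / toC r) <= 1.
  by move=> h; rewrite cabs_div cabs_toC ger0_norm ?(ltW r0)// ler_pdivrMr// mul1r.
have dom (x : nat -> K) (j : nat) : (j < n.+1)%N ->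
    cabs (x j) <= C0 * pnorm (\sum_(i < n.+1) x i *: P i).
  move=> jn; apply: (Hx (fun i => x i) _ _ (Ordinal jn)) => w hw.
  apply: le_trans (horner_le_pnorm1 _ (wr w hw)); rewrite horner_sum.
  by under [X in _ <= cabs X]eq_bigr => l _ do rewrite hornerZ -PE//.
rewrite PE//; apply: le_trans (horner_le_pnorm1 _ (wr z zr)) _.
apply: le_trans (HA d P C0 sP C01 dom i (ltn_ord i)) _.
have C00 : 0 <= 2 * C0 by rewrite mulr_ge0// (le_trans ler01).
rewrite ler_wpM2l ?exprn_ge0//.
set X := r ^+ (n * n.+1) * M.
have X0 : 0 <= X by rewrite mulr_ge0// exprn_ge0// ltW.
have sW : (size (pwronskian n.+1 P) <= (n.+1 * d.+1).+1)%N.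
  by apply: size_det => a b; rewrite mxE; apply: leq_trans (size_derivn_le _ _) (sP _).
have cW l : cabs (pwronskian n.+1 P)`_l <= X.
  apply: coef_le_circle => w w1; rewrite pwronskian_scale cabsM; apply: ler_pM; rewrite ?cabs_ge0//.
    rewrite cabs_prod exprM -[n.+1 in leRHS]card_ord -prodr_const.
    apply: ler_prod => l' _; rewrite cabs_ge0 cabsX cabs_toC ger0_norm ?(ltW r0)//=.
    by rewrite ler_weXn2l// -ltnS.
  by apply: HM; rewrite cabsM w1 mulr1 cabs_toC ger0_norm// ltW.
rewrite exprMn -mulrA ler_wpM2l ?exprn_ge0//.
apply: le_trans (pnorm_le sW cW) _; rewrite ler_wpM2r//.
rewrite -!natrM -natrX ler_nat expnMn.
have h1 : (d.+1 < 2 ^ d.+1)%N by exact: ltn_expl.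
have h2 : (2 * n.+1 <= (2 * n.+1) ^ d.+1)%N by rewrite -[X in (X <= _)%N]expn1 leq_pexp2l.
by apply: leq_trans (leq_mul (ltnW h1) h2); nia.
Qed.
End PolynomialLowerBound.

(** * Lower bounds for the Wronskian: entire functions *)

Section EntireLowerBound.
Variables (R : realType) (n : nat).
Local Notation K := (C R).
Implicit Types (H e r M B : R) (z w c : K) (G : K -> 'rV[K]_n.+1) (x : 'I_n.+1 -> K).

Lemma derive1n_disc_bound (g : K -> K) r rho B i : (i <= n)%N -> 1 <= r -> 2 ^+ n * r <= rho / 2 -> 0 <= B ->
  entire g -> (forall w, cabs w = rho -> cabs (g w) <= B) ->
  forall w, cabs w <= r -> cabs (derive1n i g w) <= 2 ^+ n * (4 * B).
Proof.
move=> i_n r1 rrho B0 eg gB w wr.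
have rho0 : 0 < rho.
  have : 0 < rho / 2 by apply: lt_le_trans rrho; rewrite mulr_gt0 ?exprn_gt0// (lt_le_trans ltr01).
  by rewrite pmulr_lgt0// invr_gt0.
have r0 : 0 <= r by exact: le_trans ler01 r1.
have [_ Hg] := taylorP rho0 eg gB.
have gd z : cabs z <= 2 ^+ i * r -> cabs (g z) <= 4 * B.
  move=> zi; have zr : cabs z <= rho / 2.
    by apply: le_trans zi (le_trans _ rrho); rewrite ler_wpM2r// ler_weXn2l// ler1n.
  by have := Hg 0%N z zr; rewrite /psum big_ord0 subr0 expr0 mulr1 mulrA -[2 * 2]natrM.
apply: le_trans (derive1n_bound r1 eg gd wr) _.
by rewrite ler_wpM2r ?mulr_ge0// ler_weXn2l// ler1n.
Qed.

Lemma absorb_half_error (N s e c b : R) : s <= N * (c * (b + s * e)) -> s * (2 * (N * c * e)) <= s * 1 ->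
  s <= 2 * (N * c * b).
Proof.
have -> : N * (c * (b + s * e)) = N * c * b + s * (2 * (N * c * e)) / 2 by field.
move: (N * c * b) (s * _) => u v; lra.
Qed.

(** The polynomial estimate passes to entire functions through their Taylor
    polynomials once the truncation error is small compared with everything else:
    with the control c of the coefficients, and with the perturbation of the
    determinant.  One inequality, the last hypothesis, ensures both. *)
Lemma wronskian_lower_bound : exists2 A : R, 1 <= A & forall G d (r rho B c M : R),
  1 <= r -> 2 ^+ n * r <= rho / 2 -> 1 <= B -> 1 <= c -> 0 <= M ->
  (forall i, entire (coord_fun G i)) ->
  (forall i w, cabs w = rho -> cabs (coord_fun G i w) <= B) ->
  (forall x b, (forall z, cabs z <= r -> cabs (\sum_i x i * coord_fun G i z) <= b) ->
     forall i, cabs (x i) <= c * b) ->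
  (forall z, cabs z = r -> cabs (wronskian G z) <= M) ->
  2 * (n.+1`!%:R * n.+1%:R) * c * (2 ^+ n * (4 * B * (2 ^+ n * r / rho) ^+ d.+1)) *
    (2 * (2 ^+ n * (4 * B))) ^+ n.+1 <= 1 ->
  forall i z, cabs z <= r -> cabs (coord_fun G i z) <=
    (2 * (2 * n.+1%:R * c)) ^+ n.+1 * (A ^+ d.+1 * (r ^+ (n * n.+1) * (M + 1))) + 1.
Proof.
have [A A1 HA] := poly_wronskian_bound R n.
exists A => // G d r rho B c M r1 rrho B1 c1 M0 eG GB Gx WM.
have r0 : 0 <= r by exact: le_trans ler01 r1.
have rho0 : 0 < rho.
  have : 0 < rho / 2 by apply: lt_le_trans rrho; rewrite mulr_gt0 ?exprn_gt0// (lt_le_trans ltr01).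
  by rewrite pmulr_lgt0// invr_gt0.
have B0 : 0 <= B by exact: le_trans ler01 B1.
set e := 2 ^+ n * (4 * B * _); set H1 := 2 ^+ n * (4 * B); set H := 2 * H1 => small.
have q0 : 0 <= 2 ^+ n * r / rho by rewrite divr_ge0 ?mulr_ge0 ?exprn_ge0// ltW.
have e0 : 0 <= e by rewrite !mulr_ge0// exprn_ge0.
have H1_ge1 : 1 <= H1 by rewrite mulr_ege1// ?exprn_ege1 ?ler1n// mulr_ege1// ler1n.
have H1_ge0 := le_trans ler01 H1_ge1.
have H_ge1 : 1 <= H by rewrite mulr_ege1// ler1n.
have H_ge0 := le_trans ler01 H_ge1.
have eH : e <= H1.
  rewrite /e /H1 ler_wpM2l ?exprn_ge0// ler_piMr ?mulr_ge0// exprn_ile1//.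
  by rewrite ler_pdivrMr// mul1r; apply: le_trans rrho _; rewrite ler_pdivrMr// ler_peMr ?(ltW rho0)// ler1n.
have eE : e = 2 ^+ n * (4 * B * (2 ^+ n * r / rho) ^+ d.+1) by [].
clearbody e.
have fn1 : 1 <= (n.+1`!%:R * n.+1%:R : R) by rewrite -natrM ler1n muln_gt0 fact_gt0.
have c0 := le_trans ler01 c1.
have He_ge1 : 1 <= H ^+ n.+1 by rewrite exprn_ege1.
have small1 : 2 * (n.+1%:R * c * e) <= 1.
  apply: le_trans small.
  have -> : 2 * (n.+1`!%:R * n.+1%:R) * c * e * H ^+ n.+1 = (n.+1`!%:R * H ^+ n.+1) * (2 * (n.+1%:R * c * e)).
    by move: (n.+1`!%:R : R) (H ^+ _) (n.+1%:R : R) => u v w; ring.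
  apply: ler_peMl; first by rewrite !mulr_ge0.
  by apply: mulr_ege1 => //; rewrite ler1n fact_gt0.
have e1 : e <= 1.
  apply: le_trans small1; have -> : 2 * (n.+1%:R * c * e) = 2 * n.+1%:R * c * e by ring.
  apply: ler_peMl => //; apply: mulr_ege1 => //; by rewrite -natrM ler1n.
have small2 : n.+1`!%:R * (n.+1%:R * e * H ^+ n.+1) <= 1.
  apply: le_trans small; have -> : 2 * (n.+1`!%:R * n.+1%:R) * c * e * H ^+ n.+1 = (2 * c) * (n.+1`!%:R * (n.+1%:R * e * H ^+ n.+1)).
    by move: (n.+1`!%:R : R) (H ^+ _) (n.+1%:R : R) => u v w; ring.
  apply: ler_peMl; first by rewrite !mulr_ge0// exprn_ge0.
  by apply: mulr_ege1 => //; rewrite ler1n.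
have tp i : exists q : {poly K}, (size q <= d.+1)%N /\
    forall k w, (k <= n)%N -> cabs w <= r -> cabs (derive1n k (coord_fun G i) w - (derivn k q).[w]) <= e.
  have [q sq Hq] := taylor_poly d.+1 r1 rrho (@eG i) (GB i).
  by exists q; split=> //; rewrite eE.
have [p Hp] := choice tp.
have Gp i z : cabs z <= r -> cabs (coord_fun G i z - (p i).[z]) <= e.
  by move=> zr; have [_ h] := Hp i; have := h 0%N z (leq0n n) zr; rewrite derive1n0 derivn0.
have px x b : (forall z, cabs z <= r -> cabs (\sum_i x i * (p i).[z]) <= b) ->
    forall i, cabs (x i) <= (2 * n.+1%:R * c) * b.
  move=> pb; pose s := \sum_i cabs (x i).
  have s0 : 0 <= s by apply: sumr_ge0 => i _; exact: cabs_ge0.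
  have Gb z : cabs z <= r -> cabs (\sum_i x i * coord_fun G i z) <= b + s * e.
    move=> zr; have -> : \sum_i x i * coord_fun G i z =
        \sum_i x i * (p i).[z] + \sum_i x i * (coord_fun G i z - (p i).[z]).
      by rewrite -big_split /=; apply: eq_bigr => i _; rewrite -mulrDr addrC subrK.
    apply: le_trans (cabsD _ _) _; apply: lerD (pb z zr) _.
    apply: le_trans (cabs_sum _ _ _) _; rewrite mulr_suml; apply: ler_sum => i _.
    by rewrite cabsM ler_wpM2l ?cabs_ge0// Gp.
  have xs := Gx x _ Gb.
  have ss : s <= n.+1%:R * (c * (b + s * e)).
    rewrite mulr_natl -[n.+1 in leRHS]card_ord -sumr_const; apply: ler_sum => i _; exact: xs.
  have ss2 : s <= 2 * (n.+1%:R * c * b).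
    have h : s * (2 * (n.+1%:R * c * e)) <= s * 1 by rewrite ler_wpM2l.
    exact: absorb_half_error ss h.
  move=> i; apply: (@le_trans _ _ s).
    by rewrite /s (bigD1 i)//= lerDl; apply: sumr_ge0 => j _; exact: cabs_ge0.
  by rewrite -!mulrA; move: ss2; rewrite -!mulrA.
have C1 : 1 <= 2 * n.+1%:R * c by apply: mulr_ege1 => //; rewrite -natrM ler1n.
have pW z : cabs z = r -> cabs (poly_wronskian p z) <= M + 1.
  move=> zr; have zr' : cabs z <= r by rewrite zr.
  have -> : poly_wronskian p z = wronskian G z - (wronskian G z - poly_wronskian p z) by ring.
  apply: le_trans (cabsB _ _) _; apply: lerD (WM z zr) _; apply: le_trans small2.
  have dG i j : (i <= n)%N -> cabs (derive1n i (coord_fun G j) z) <= H1.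
    by move=> i_n; exact: (derive1n_disc_bound i_n r1 rrho B0 (@eG j) (GB j)).
  apply: det_perturb => // i j; rewrite !mxE; have i_n : (i <= n)%N by rewrite -ltnS.
  - by apply: le_trans (dG i j i_n) _; rewrite /H ler_peMl// ler1n.
  - have [_ /(_ i z i_n zr') h] := Hp j.
    have -> : (derivn i (p j)).[z] = derive1n i (coord_fun G j) z - (derive1n i (coord_fun G j) z - (derivn i (p j)).[z]).
      by move: (derive1n _ _ _) (_.[z]) => u v; ring.
    apply: le_trans (cabsB _ _) _; apply: le_trans (lerD (dG i j i_n) h) _.
    by rewrite /H mulr_natl mulr2n lerD2l.
  - by have [_ /(_ i z i_n zr')] := Hp j.
move=> i z zr.
have -> : coord_fun G i z = (p i).[z] + (coord_fun G i z - (p i).[z]) by rewrite addrC subrK.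
apply: le_trans (cabsD _ _) _; apply: lerD; last by apply: le_trans e1; exact: Gp.
apply: (HA d p _ r (M + 1)) => //; first by rewrite addr_ge0.
by move=> j; case: (Hp j).
Qed.
End EntireLowerBound.

(** * The Wronskian under scaling *)

Section WronskianScaling.
Variables (R : realType) (n : nat).
Local Notation K := (C R).
Implicit Types (f g : K -> K) (z : K) (F : K -> 'rV[K]_n.+1).

(** The coefficient of f^(k) in the i-th derivative of g f. *)
Fixpoint leibniz_coef g (i k : nat) : K -> K :=
  match i with
  | 0 => if k is 0 then g else fun=> 0
  | i'.+1 => fun z => derive1 (leibniz_coef g i' k) z + (if k is k'.+1 then leibniz_coef g i' k' z else 0)
  end.

Lemma leibniz_coef_entire g i k : entire g -> entire (leibniz_coef g i k).
Proof.
move=> eg; elim: i k => [|i IH] [|k] /=; [exact: eg|exact: entire_cst| |].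
  exact: entireD (entire_derive1 (IH 0%N)) (entire_cst 0).
exact: entireD (entire_derive1 (IH k.+1)) (IH k).
Qed.

Lemma derive1_cst0 : derive1 (fun=> 0 : K) = fun=> 0 :> K.
Proof.
have := @derive1B R (fun=> 0) (fun=> 0) (entire_cst 0) (entire_cst 0).
rewrite (_ : (fun w : K => 0 - 0) = fun=> 0); last by apply/funext => w; rewrite subrr.
by move=> ->; apply/funext => w; rewrite subrr.
Qed.

Lemma leibniz_coef_gt g i k : (i < k)%N -> leibniz_coef g i k = fun=> 0.
Proof.
elim: i k => [|i IH] [|k]//= ik.
by rewrite (IH k.+1 (ltnW ik)) (IH k ik) derive1_cst0; apply/funext => z; rewrite addr0.
Qed.

Lemma leibniz_coef_diag g i : leibniz_coef g i i = g.
Proof.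
elim: i => [|i IH]//=; rewrite IH (leibniz_coef_gt g (ltnSn i)) derive1_cst0.
by apply/funext => z; rewrite add0r.
Qed.

Lemma derive1_sum m (u : nat -> K -> K) : (forall k, entire (u k)) ->
  derive1 (fun z => \sum_(k < m) u k z) = fun z => \sum_(k < m) derive1 (u k) z.
Proof.
move=> eu; elim: m => [|m IH].
  rewrite (_ : (fun z => _) = fun=> 0) ?derive1_cst0; apply/funext => z; by rewrite big_ord0.
rewrite (_ : (fun z => _) = fun z => \sum_(k < m) u k z + u m z); last first.
  by apply/funext => z; rewrite big_ord_recr.
rewrite (derive1D (entire_sum _ _ (fun k : 'I_m => @eu k)) (@eu m)) IH.
by apply/funext => z; rewrite big_ord_recr.
Qed.

Lemma leibniz_coefS0 g i z : leibniz_coef g i.+1 0 z = derive1 (leibniz_coef g i 0) z.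
Proof. exact: addr0. Qed.

Lemma leibniz g f m i : entire g -> entire f -> (i < m)%N ->
  derive1n i (fun z => g z * f z) = fun z => \sum_(k < m) leibniz_coef g i k z * derive1n k f z.
Proof.
move=> eg ef; elim: i m => [|i IH] [|m] im //.
  rewrite derive1n0; apply/funext => z; rewrite big_ord_recl /= derive1n0 big1 ?addr0// => k _.
  by rewrite mul0r.
have eL k : entire (leibniz_coef g i k) by exact: leibniz_coef_entire.
have eM k : entire (fun z => leibniz_coef g i k z * derive1n k f z).
  exact: entireM (@eL k) (entire_derive1n k ef).
rewrite derive1nS (IH m.+1 (ltnW im)) (@derive1_sum m.+1 _ (@eM)); apply/funext => z.
rewrite (eq_bigr (fun k : 'I_m.+1 => derive1 (leibniz_coef g i k) z * derive1n k f z + leibniz_coef g i k z * derive1n k.+1 f z)); last first.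
  by move=> k _; rewrite (derive1M (@eL k) (entire_derive1n k ef)) derive1nS.
rewrite [RHS]big_ord_recl leibniz_coefS0 big_split /= [X in _ + X]big_ord_recr /= (leibniz_coef_gt g (im : (i < m)%N)) mul0r addr0.
rewrite [in LHS]big_ord_recl -addrA; congr (_ + _).
by rewrite -big_split /=; apply: eq_bigr => k _; rewrite -mulrDl.
Qed.

(** By Leibniz' rule the matrix of derivatives of g F is the product of a
    triangular matrix with diagonal g and the matrix of derivatives of F. *)
Lemma wronskian_scale g F : entire g -> (forall j, entire (coord_fun F j)) ->
  forall z, wronskian (fun w => g w *: F w) z = g z ^+ n.+1 * wronskian F z.
Proof.
move=> eg eF z; rewrite /wronskian.
pose L : 'M[K]_n.+1 := \matrix_(i, k) leibniz_coef g i k z.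
have -> : \matrix_(i < n.+1, j < n.+1) derive1n i (coord_fun (fun w => g w *: F w) j) z =
    L *m \matrix_(i, j) derive1n i (coord_fun F j) z.
  apply/matrixP => i j; rewrite !mxE.
  have -> : coord_fun (fun w => g w *: F w) j = fun w => g w * coord_fun F j w.
    by apply/funext => w; rewrite /coord_fun mxE.
  rewrite (leibniz eg (@eF j) (ltn_ord i)); apply: eq_bigr => k _; by rewrite !mxE.
rewrite det_mulmx det_trig; last first.
  by apply/is_trig_mxP => i k ik; rewrite mxE leibniz_coef_gt.
congr (_ * _); rewrite -[n.+1 in RHS]card_ord -prodr_const.
by apply: eq_bigr => i _; rewrite mxE leibniz_coef_diag.
Qed.

Lemma wronskian_entire F : (forall j, entire (coord_fun F j)) -> entire (wronskian F).
Proof.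
move=> eF; rewrite (_ : wronskian F = fun z => \sum_(s : {perm 'I_n.+1})
    ((-1) ^+ s * \prod_(i < n.+1) derive1n i (coord_fun F (s i)) z)).
  apply: entire_sum => s; apply: entireM (entire_cst _) _.
  by apply: entire_prod => i; exact: entire_derive1n (@eF _).
apply/funext => z; rewrite /wronskian /determinant; apply: eq_bigr => s _.
by congr (_ * _); apply: eq_bigr => i _; rewrite mxE.
Qed.
End WronskianScaling.

Section CharacteristicUpper.
Variables (R : realType) (n : nat) (F : C R -> 'rV[C R]_n.+1).
Local Notation K := (C R).
Implicit Types (z w : K).
Hypothesis F_entire : forall j, entire (coord_fun F j).
Hypothesis F_neq0 : forall z, F z != 0.
Hypothesis F_nondeg : linearly_nondegenerate F.
Local Notation T r := (characteristic F r).
Variable kap : nat -> {poly K}.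
Hypothesis kap0 : forall j, (kap j).[0] = toC (lognorm F 0).
Hypothesis kap_circle : forall j z, cabs z = 2 ^+ j ->
  T (2 ^+ j) - 2 <= lognorm F z - cre (kap j).[z] <= T (2 ^+ j) + 2.
Hypothesis slow : exists j0 : nat, exists2 c : R, 0 <= c & forall j, (j0 <= j)%N -> T (2 ^+ j) <= c * (3 / 2) ^+ j.

Definition normal j z := expC (- (kap j).[z]) *: F z.

Lemma normal_coord j i : coord_fun (normal j) i = normalized F kap j i.
Proof. by apply/funext => z; rewrite /coord_fun mxE. Qed.

Lemma normal_entire j i : entire (coord_fun (normal j) i).
Proof. by rewrite normal_coord; exact: (@normalized_entire _ _ _ (@F_entire) kap j i). Qed.

Lemma normal_circle j i z : cabs z = 2 ^+ j ->
  cabs (coord_fun (normal j) i z) <= expR (T (2 ^+ j) + disc_loss R n).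
Proof.
move=> zj; rewrite normal_coord; apply: le_trans (normalized_circle F_neq0 kap_circle i zj) _.
by rewrite ler_expR lerD2l disc_loss_ge2.
Qed.

(** The constant does not depend on J because the values k_J(z) at finitely many
    points z are bounded. *)
Lemma normal_coefs : exists j1 : nat, exists2 c : R, 1 <= c & forall J r x b, 2 ^+ j1 <= r ->
  (forall z, cabs z <= r -> cabs (\sum_i x i * coord_fun (normal J) i z) <= b) ->
  forall i : 'I_n.+1, cabs (x i) <= c * b.
Proof.
have [zs [c c1 Hc]] := nondegenerate_points F_nondeg.
have [Bk Bk0 HBk] : exists2 Bk, 0 <= Bk & forall z, z \in zs -> forall J, cabs (kap J).[z] <= Bk.
  elim: zs {Hc} => [|z zs [B B0 HB]]; first by exists 0.
  have [B' B'0 HB'] := normalizer_bounded F_entire F_neq0 kap0 kap_circle slow z.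
  exists (B + B'); first by rewrite addr_ge0.
  move=> w; rewrite in_cons => /orP[/eqP ->|wz] J.
    by apply: le_trans (HB' J) _; rewrite lerDr.
  by apply: le_trans (HB w wz J) _; rewrite lerDl.
have [j1 Hj1] : exists j1 : nat, forall z, z \in zs -> cabs z <= 2 ^+ j1.
  elim: zs {Hc HBk} => [|z zs [j Hj]]; first by exists 0%N.
  exists (maxn j (Num.truncn (cabs z)).+1) => w; rewrite in_cons => /orP[/eqP ->|wz].
    apply: le_trans (ltW (truncnS_gt _)) _; rewrite -natrX ler_nat.
    by apply: leq_trans (ltnW (ltn_expl _ (ltnSn 1))) _; rewrite leq_exp2l// leq_maxr.
  by apply: le_trans (Hj w wz) _; rewrite ler_weXn2l ?ler1n// leq_maxl.
exists j1; exists (c * expR Bk); first by rewrite mulr_ege1// -expR0 ler_expR.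
move=> J r x b r1 xb i; rewrite -mulrA; apply: Hc => z zz.
have zr : cabs z <= r by exact: le_trans (Hj1 z zz) r1.
have := xb z zr.
have -> : \sum_i x i * coord_fun (normal J) i z = expC (- (kap J).[z]) * \sum_i x i * F z 0 i.
  by rewrite mulr_sumr; apply: eq_bigr => l _; rewrite /coord_fun mxE mulrCA.
rewrite cabsM cabs_expC creN => h.
have h2 : cre (kap J).[z] <= Bk by apply: le_trans (HBk z zz J); apply: le_trans (ler_norm _) (cre_le _).
rewrite -ler_pdivrMl ?expR_gt0// -expRN; apply: le_trans h.
by rewrite ler_wpM2r ?cabs_ge0// ler_expR lerN2.
Qed.
End CharacteristicUpper.

(** * The characteristic is bounded by the normalized Wronskian *)

Section CharacteristicUpper.
Variables (R : realType) (n : nat) (F : C R -> 'rV[C R]_n.+1).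
Local Notation K := (C R).
Implicit Types (z w : K).
Hypothesis F_entire : forall j, entire (coord_fun F j).
Hypothesis F_neq0 : forall z, F z != 0.
Hypothesis F_nondeg : linearly_nondegenerate F.
Local Notation T r := (characteristic F r).
Variable kap : nat -> {poly K}.
Hypothesis kap0 : forall j, (kap j).[0] = toC (lognorm F 0).
Hypothesis kap_circle : forall j z, cabs z = 2 ^+ j ->
  T (2 ^+ j) - 2 <= lognorm F z - cre (kap j).[z] <= T (2 ^+ j) + 2.
Hypothesis slow : exists j0 : nat, exists2 c : R, 0 <= c & forall j, (j0 <= j)%N -> T (2 ^+ j) <= c * (3 / 2) ^+ j.
Local Notation dl := (disc_loss R n).
Local Notation normal := (normal F kap).

(** The smallest number of terms that makes the truncation error harmless. *)
Lemma trunc_degree (Y s : R) : 0 <= Y -> 0 < s -> exists d : nat, Y <= d.+1%:R * s /\ d%:R <= Y / s.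
Proof.
move=> Y0 s0; exists (Num.truncn (Y / s)); split.
  by rewrite -ler_pdivrMr// ltW// truncnS_gt.
by rewrite truncn_le divr_ge0// ltW.
Qed.

Lemma radius_ratio j b : 2 ^+ n * 2 ^+ j / 2 ^+ (j + n + b) = (2 ^+ b)^-1 :> R.
Proof.
rewrite !exprD; have h m : 2 ^+ m != 0 :> R by rewrite expf_neq0// pnatr_eq0.
by rewrite -[j in 2 ^+ j]addn0 in h *; field; rewrite !h.
Qed.

Lemma truncation_cost_shape (a1 a2 a3 a4 B q : R) m d :
  2 * (a1 * a2) * a3 * (a4 * (4 * B * q ^+ d)) * (2 * (a4 * (4 * B))) ^+ m =
  2 * (a1 * a2) * a3 * (a4 * 4) * (2 * (a4 * 4)) ^+ m * B ^+ m.+1 * q ^+ d.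
Proof.
have -> : 2 * (a4 * (4 * B)) = 2 * (a4 * 4) * B by ring.
by rewrite exprMn exprS; move: (_ ^+ m) (B ^+ m) (q ^+ d) => u v w; ring.
Qed.

Lemma characteristic_bound_arith (t tJ L0 lA l2 lK m b d N j M : R) :
  0 <= t -> tJ <= 2 * t -> 0 <= L0 -> 0 <= lA -> 0 < l2 -> 0 <= lK -> 0 <= m -> 0 < b -> 0 <= N -> 0 <= j -> 0 <= dl ->
  d <= (lK + m * (tJ + dl)) / (b * l2) ->
  t - 1 <= L0 + (d + 1) * lA + N * j * l2 + M ->
  t <= (1 + L0 + lA + lA / l2 * (lK + m * dl + 2 * m) + N * l2) * ((t + 1) / b) +
       (1 + L0 + lA + lA / l2 * (lK + m * dl + 2 * m) + N * l2) * (j + 1) + M.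
Proof.
move: dl => dl t0 tJt L00 lA0 l20 lK0 m0 b0 N0 j0 dl0 dY tM.
set c2 := lA / l2 * (lK + m * dl + 2 * m).
have c20 : 0 <= c2 by rewrite /c2 mulr_ge0 ?divr_ge0 ?(ltW l20)// !addr_ge0// !mulr_ge0.
have h1 : d * lA <= c2 * ((t + 1) / b).
  have -> : c2 * ((t + 1) / b) = ((lK + m * dl + 2 * m) * (t + 1) / (b * l2)) * lA.
    by rewrite /c2; field; rewrite !gt_eqF.
  rewrite ler_wpM2r//; apply: le_trans dY _; rewrite ler_wpM2r//.
    by rewrite invr_ge0 mulr_ge0// ltW.
  have e1 : 0 <= (lK + m * dl) * t by rewrite mulr_ge0// addr_ge0// mulr_ge0.
  have e2 : m * tJ <= m * (2 * t) by rewrite ler_wpM2l.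
  by nra.
have tb : 0 <= (t + 1) / b by rewrite divr_ge0 ?addr_ge0// ltW.
have h2 : 0 <= (1 + L0 + lA + N * l2) * ((t + 1) / b).
  by rewrite mulr_ge0// !addr_ge0// mulr_ge0// ltW.
have h3 : 0 <= (1 + L0 + lA + c2) * j by rewrite mulr_ge0// !addr_ge0.
have h4 : 0 <= N * l2 by rewrite mulr_ge0// ltW.
clearbody c2; move: ((t + 1) / b) tb h1 h2 => u tb h1 h2; lra.
Qed.

(** At a radius r followed by slow growth of T, the degree of truncation is a
    small multiple of T(r).  The constant raised to this degree, the power of r
    from the scaling, and the maximum of the normalized Wronskian on |z| = r
    account for the three terms. *)
Lemma characteristic_upper : exists2 c : R, 0 <= c & exists j1 : nat, forall j b (M : R),
  (j1 <= j)%N -> (0 < b)%N -> 0 <= T (2 ^+ j) -> T (2 ^+ (j + n + b)) <= 2 * T (2 ^+ j) -> 0 <= M ->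
  (forall z, cabs z = 2 ^+ j -> cabs (wronskian (normal (j + n + b)) z) <= M) ->
  T (2 ^+ j) <= c * ((T (2 ^+ j) + 1) / b%:R) + c * (j%:R + 1) + ln (M + 1).
Proof.
have [A A1 HA] := wronskian_lower_bound R n.
have [j1 [c1 c11 Hc1]] := normal_coefs F_entire F_neq0 F_nondeg kap0 kap_circle slow.
have dl0 : 0 <= dl := disc_loss_ge0 R n.
have l20 : 0 < ln 2 :> R by rewrite ln_gt0// ltr1n.
pose K1 : R := 2 * (n.+1`!%:R * n.+1%:R) * c1 * (2 ^+ n * 4) * (2 * (2 ^+ n * 4)) ^+ n.+1.
have p2n : 1 <= 2 ^+ n * 4 :> R by rewrite mulr_ege1 ?exprn_ege1 ?ler1n.
have K11 : 1 <= K1.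
  by rewrite /K1; repeat (apply: mulr_ege1 || apply: exprn_ege1); rewrite ?ler1n ?fact_gt0.
have K10 := lt_le_trans ltr01 K11.
pose P1 : R := (2 * (2 * n.+1%:R * c1)) ^+ n.+1.
have P11 : 1 <= P1 by rewrite /P1; repeat (apply: mulr_ege1 || apply: exprn_ege1); rewrite ?ler1n.
have A0 := lt_le_trans ltr01 A1.
pose L0 : R := ln (2 * n.+1%:R * P1).
have L01 : 1 <= 2 * n.+1%:R * P1 by rewrite mulr_ege1// -natrM ler1n.
have L00 : 0 <= L0 by rewrite ln_ge0.
pose m : R := n.+2%:R; pose N : R := (n * n.+1)%:R.
exists (1 + L0 + ln A + ln A / ln 2 * (ln K1 + m * dl + 2 * m) + N * ln 2).
  have lA0 : 0 <= ln A by rewrite ln_ge0.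
  have lK0 : 0 <= ln K1 by rewrite ln_ge0.
  have l20' := ltW l20.
  by rewrite !addr_ge0// ?mulr_ge0// ?divr_ge0// ?invr_ge0// !addr_ge0// mulr_ge0.
exists j1 => j b M j1j b0 t0 tJt M0 HM.
set J := (j + n + b)%N in tJt HM *.
have tJ : - dl <= T (2 ^+ J) := characteristic_lower F_entire F_neq0 kap0 kap_circle J.
have tJ0 : 0 <= T (2 ^+ J) + dl by move: tJ; rewrite -subr_ge0 opprK.
have Y0 : 0 <= ln K1 + m * (T (2 ^+ J) + dl).
  by apply: addr_ge0; [exact: ln_ge0|exact: mulr_ge0].
have b0' : 0 < b%:R :> R by rewrite ltr0n.
have [d [dY1 dY2]] := trunc_degree Y0 (mulr_gt0 b0' l20).
have r1 : 1 <= 2 ^+ j :> R by rewrite exprn_ege1// ler1n.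
have rrho : 2 ^+ n * 2 ^+ j <= 2 ^+ J / 2 :> R.
  by rewrite ler_pdivlMr// -exprD -exprSr ler_weXn2l ?ler1n// -addn1 [(n + j)%N]addnC leq_add2l.
have B1 : 1 <= expR (T (2 ^+ J) + dl) by apply: le_trans (expR_ge1Dx _); rewrite lerDl.
have rj1 : 2 ^+ j1 <= 2 ^+ j :> R by rewrite ler_weXn2l ?ler1n.
have cond : 2 * (n.+1`!%:R * n.+1%:R) * c1 * (2 ^+ n * (4 * expR (T (2 ^+ J) + dl) * (2 ^+ n * 2 ^+ j / 2 ^+ J) ^+ d.+1)) *
    (2 * (2 ^+ n * (4 * expR (T (2 ^+ J) + dl)))) ^+ n.+1 <= 1.
  rewrite radius_ratio truncation_cost_shape -/K1 exprVn ler_pdivrMr ?exprn_gt0// mul1r.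
  rewrite -[K1]lnK ?posrE// -expRM_natl -expRD -[2 in leRHS]lnK ?posrE//.
  rewrite -!expRM_natl ler_expR.
  by move: dY1; rewrite -/m mulrA.
have G := HA (normal J) d _ _ _ c1 M r1 rrho B1 c11 M0 (@normal_entire _ _ _ F_entire kap J)
  (@normal_circle _ _ _ F_neq0 kap kap_circle J) (fun x b' => @Hc1 J _ x b' rj1) HM cond.
have rj0 : 0 <= 2 ^+ j :> R by exact: le_trans ler01 r1.
have [z zj Hz] := characteristic_attained F_entire F_neq0 kap0 J rj0.
set X := P1 * (A ^+ d.+1 * ((2 ^+ j) ^+ (n * n.+1) * (M + 1))).
have M1 : 1 <= M + 1 by rewrite lerDr.
have X1 : 1 <= X by rewrite /X; repeat (apply: mulr_ege1 || apply: exprn_ege1); rewrite ?ler1n.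
have enX : expR (T (2 ^+ j) - 1) <= 2 * n.+1%:R * X.
  apply: ltW; apply: lt_le_trans (_ : expR (lognorm F z - cre (kap J).[z]) <= _); first by rewrite ltr_expR.
  rewrite -(@normalized_en _ _ _ F_neq0); apply: le_trans (en_le_sum _) _.
  apply: (@le_trans _ _ (n.+1%:R * (X + 1))).
    rewrite mulr_natl -[n.+1 in leRHS]card_ord -sumr_const; apply: ler_sum => i _.
    by rewrite mxE -normal_coord; apply: G; rewrite zj.
  by rewrite [2 * _]mulrC -mulrA ler_wpM2l// mulr_natl mulr2n lerD2l.
have fin : T (2 ^+ j) - 1 <= L0 + (d%:R + 1) * ln A + N * j%:R * ln 2 + ln (M + 1).
  rewrite -ler_expR; apply: le_trans enX _.
  have M10 : 0 < M + 1 by exact: lt_le_trans ltr01 M1.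
  have -> : N * j%:R = (j * (n * n.+1))%:R by rewrite natrM mulrC.
  rewrite natr1 !expRD lnK ?posrE// !expRM_natl !lnK ?posrE//; last by exact: lt_le_trans ltr01 L01.
  by rewrite exprM /X !mulrA.
by apply: characteristic_bound_arith tJt _ _ _ _ _ _ _ _ _ dY2 fin; rewrite ?ln_ge0.
Qed.
End CharacteristicUpper.

(** * The integrated zero count *)

Section Jensen.
Variable R : realType.
Local Notation K := (C R).
Local Notation mu := (@lebesgue_measure R).
Implicit Types (c r s t : R) (z w : K) (zs : seq K) (W g : K -> K).

Lemma inv_within c r : 0 < c -> {within `[c, r], continuous (fun t : R => t^-1)}.
Proof.
move=> c0; apply: continuous_in_subspaceT => t; rewrite inE /= in_itv /= => /andP[ct _].
by apply: inv_continuous; rewrite gt_eqF// (lt_le_trans c0).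
Qed.

Lemma inv_integral c r : 0 < c -> c <= r -> (\int[mu]_(t in `[c, r]) (t^-1)%:E)%E = (ln (r / c))%:E.
Proof.
move=> c0; rewrite le_eqVlt => /orP[/eqP <-|cr].
  by rewrite set_itv1 integral_set1 divff ?gt_eqF// ln1.
have r0 := lt_trans c0 cr.
rewrite (@continuous_FTC2 R (fun t => t^-1) (@ln R) c r) //.
- by rewrite ln_div ?posrE.
- exact: inv_within.
- split=> [t|| ].
  + rewrite in_itv /= => /andP[ct _].
    by have [] := is_derive1_ln (lt_trans c0 ct).
  + by apply: cvg_at_right_filter; exact: (continuous_ln c0).
  + by apply: cvg_at_left_filter; exact: (continuous_ln r0).
- move=> t; rewrite in_itv /= => /andP[ct _].
  by rewrite derive1E; have [] := is_derive1_ln (lt_trans c0 ct).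
Qed.

(** In the disc |z| <= s the multiplicities of the zeros of W are the
    multiplicities in the list zs. *)
Lemma zero_count_seq W zs g s t : entire g ->
  (forall w, W w = (\prod_(z <- zs) (w - z)) * g w) -> (forall w, cabs w <= s -> g w != 0) -> t <= s ->
  zero_count W t = (count (fun z => cabs z <= t) zs)%:R.
Proof.
move=> eg WE gn ts; rewrite /zero_count.
have mult z : cabs z <= s -> zero_multiplicity W z = count_mem z zs.
  by move=> zs'; exact: zero_multiplicity_count eg (gn z zs') WE.
pose u := undup [seq z <- zs | cabs z <= t].
have uP z : (z \in u) = (cabs z <= t) && (z \in zs) by rewrite mem_undup mem_filter.
rewrite (@fsbigE R 0 +%R K _ u) ?undup_uniq//; first last.
- move=> z /= zt; rewrite uP zt /= => nz.
  by rewrite mult ?(le_trans zt)// (count_memPn nz).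
- by move=> z /=; rewrite uP => /andP[].
rewrite big_seq_cond (eq_bigr (fun z => (count_mem z [seq z <- zs | cabs z <= t])%:R)); last first.
  move=> z /andP[]; rewrite uP => /andP[zt zz] _; rewrite mult ?(le_trans zt)//.
  by rewrite count_filter; congr (_%:R); apply: eq_count => y /=; case: eqP => // ->; rewrite zt.
rewrite (eq_bigl (mem u)); last first.
  move=> z /=; case: (boolP (z \in u)) => //= zu; move: (zu); rewrite uP => /andP[zt _].
  by apply/mem_set.
rewrite -big_seq -natr_sum; congr (_%:R).
rewrite -size_filter -(perm_size (perm_count_undup _)) size_flatten sumnE /shape -map_comp big_map.
by apply: eq_bigr => z _; rewrite /= size_nseq.
Qed.

Lemma sum_if_count zs (a : pred K) (x : R) :
  \sum_(z <- zs) (if a z then x else 0) = (count a zs)%:R * x.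
Proof. by rewrite -big_mkcond big_const_seq iter_addr_0 mulr_natl. Qed.

Lemma count_split zs (a b : pred K) : (forall z, b z -> a z) ->
  count a zs = (count b zs + count (fun z => ~~ b z && a z) zs)%N.
Proof.
move=> ba; elim: zs => //= z zs ->.
by case: (boolP (b z)) => [/ba ->|_] /=; lia.
Qed.

(** Each zero z different from 0 contributes to the integrand 1/t from t = |z|
    on, hence log(r/|z|) to the integral. *)
Lemma integrated_zero_countE W zs g s r : entire g ->
  (forall w, W w = (\prod_(z <- zs) (w - z)) * g w) -> (forall w, cabs w <= s -> g w != 0) -> 0 < r <= s ->
  integrated_zero_count W r =
    \sum_(z <- zs | (z != 0) && (cabs z <= r)) ln (r / cabs z) + (count_mem 0 zs)%:R * ln r.
Proof.
move=> eg WE gn /andP[r0 rs]; rewrite /integrated_zero_count.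
have s0 : 0 <= s by rewrite ltW// (lt_le_trans r0).
have ZC t : t <= s -> zero_count W t = (count (fun z => cabs z <= t) zs)%:R := zero_count_seq eg WE gn.
have Z0 : zero_count W 0 = (count_mem 0 zs)%:R.
  rewrite ZC//; congr (_%:R); apply: eq_count => z /=.
  by rewrite -[z == 0]cabs_eq0 [RHS]eq_le cabs_ge0 andbT.
rewrite Z0; congr (_ + _).
pose v := [seq z <- zs | (z != 0) && (cabs z <= r)].
rewrite -big_filter -/v.
pose h z : R -> \bar R := (fun t => (t^-1)%:E) \_ `[cabs z, r].
have hE t : `[0, r]%classic t -> ((zero_count W t - (count_mem 0 zs)%:R) / t)%:E = (\sum_(z <- v) h z t)%E.
  rewrite /= in_itv /= => /andP[t0 tr]; rewrite ZC ?(le_trans tr)// /h.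
  rewrite (eq_bigr (fun z => (if cabs z <= t then t^-1 else 0)%:E)); last first.
    move=> z _; rewrite patchE; case: ifPn.
      by rewrite inE /= in_itv /= => /andP[->].
    rewrite notin_setE /= in_itv /= tr andbT => /negP; by case: ifP.
  rewrite sumEFin sum_if_count; congr (_ * _)%:E.
  rewrite (@count_split zs _ (pred1 0)); last by move=> z /eqP ->; rewrite cabs0.
  rewrite natrD addrC addKr /v count_filter; congr (_%:R); apply: eq_count => z /=.
  by case: eqP => //= _; case: (boolP (cabs z <= t)) => //= zt; rewrite (le_trans zt tr).
have cpos z : z \in v -> 0 < cabs z <= r.
  by rewrite mem_filter => /andP[/andP[z0 zr] _]; rewrite cabs_gt0 z0.
have mh z : z \in v -> measurable_fun `[0, r]%classic (h z).
  move=> /cpos/andP[z0 zr]; apply/measurable_restrict; [exact: measurable_itv|exact: measurable_itv|].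
  rewrite (_ : _ `&` _ = `[cabs z, r]%classic); last first.
    apply/seteqP; split=> t /=; rewrite !in_itv /=; first by case.
    by move=> /andP[zt ->]; rewrite zt (le_trans (ltW z0) zt).
  apply/measurable_EFinP; apply: subspace_continuous_measurable_fun; first exact: measurable_itv.
  exact: inv_within.
rewrite /Rintegral.
have -> : (\int[mu]_(t in `[0%R, r]) ((zero_count W t - (count_mem 0 zs)%:R) / t)%:E =
    \int[mu]_(t in `[0%R, r]) (\sum_(z <- v) (if z \in v then h z t else 0)))%E.
  apply: eq_integral => t; rewrite inE => /hE ->; rewrite [LHS]big_seq [RHS]big_seq.
  by apply: eq_bigr => z ->.
pose h' z t := if z \in v then h z t else 0%E.
have Hm z : measurable_fun `[0, r]%classic (h' z).
  by rewrite /h'; case: (boolP (z \in v)) => zv; [exact: mh|exact: measurable_cst].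
have H0 z t : `[0, r]%classic t -> (0 <= h' z t)%E.
  rewrite /= in_itv /= => /andP[t0 _]; rewrite /h'; case: ifPn => // zv; rewrite /h patchE.
  by case: ifP => // _; rewrite lee_fin invr_ge0.
rewrite (ge0_integral_sum mu (measurable_itv `[0, r]) Hm H0) /h' /=.
rewrite (eq_big_seq (fun z => (ln (r / cabs z))%:E)); first by rewrite sumEFin.
move=> z zv; rewrite zv; have /andP[z0 zr] := cpos z zv.
rewrite -inv_integral// /h -integral_mkcondr; congr (integral _ _ _).
apply/seteqP; split=> t /=; rewrite !in_itv /=; first by case.
by move=> /andP[zt ->]; rewrite zt (le_trans (ltW z0) zt).
Qed.
End Jensen.

(** * The modulus of a function in terms of its zeros *)

Section ZeroFree.
Variable R : realType.
Local Notation K := (C R).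
Implicit Types (r s B : R) (z w : K) (H : K -> K).

Lemma ln4_le3 : ln 4 <= 3 :> R.
Proof.
have -> : 4 = 1 + 3 :> R by rewrite nat1r.
by apply: le_ln1Dx; apply: lt_trans (_ : 0 < _); rewrite ?ltrN10.
Qed.

(** Borel-Caratheodory for log H: a real-part approximation of log |H| on the
    circle by a polynomial stands in for a branch of the logarithm. *)
Lemma zerofree_growth H s B w : 0 < s -> entire H -> (forall w, cabs w <= s -> H w != 0) ->
  (forall w, cabs w = s -> cabs (H w) <= expR B) -> cabs w <= s / 2 ->
  ln (cabs (H w)) <= ln (cabs (H 0)) + 5 + 4 * (B + 5 - ln (cabs (H 0))) * (cabs w / s).
Proof.
move=> s0 eH Hn HB ws.
have ws' : cabs w <= s by apply: le_trans ws _; rewrite ler_pdivrMr// ler_peMr ?(ltW s0)// ler1n.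
have zs' : cabs (0 : K) <= s / 2 by rewrite cabs0 divr_ge0// ltW.
have H0 z : cabs z <= s -> 0 < cabs (H z) by move=> zz; rewrite cabs_gt0 Hn.
have cu : circ_cont (fun z => ln (cabs (H z))) s.
  apply: rc_at_circ_cont => z zs; apply: rc_at_comp (rc_at_cabs (entire_cdiff z eH)) _.
  by apply: continuous_ln; rewrite H0// zs.
have [p Hp] := circle_approx s0 cu.
pose Q z := H z * expC (- p.[z]).
have eQ : entire Q.
  exact: entireM eH (entire_comp (@entire_expC R) (entireN (entire_horner p))).
have Q_abs z : cabs (Q z) = cabs (H z) * expR (- cre p.[z]) by rewrite cabsM cabs_expC creN.
have lnQ z : cabs z <= s -> cabs (Q z) = expR (ln (cabs (H z)) - cre p.[z]).
  by move=> zz; rewrite Q_abs expRD lnK// posrE H0.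
have Q_le z : cabs z = s -> cabs (Q z) <= expR 1.
  move=> zs; rewrite lnQ ?zs// ler_expR; have := Hp z zs; rewrite ler_norml => /andP[]; lra.
have Q_ge z : cabs z = s -> expR (- 1) <= cabs (Q z).
  move=> zs; rewrite lnQ ?zs// ler_expR; have := Hp z zs; rewrite ler_norml => /andP[]; lra.
have Qn z : cabs z <= s -> Q z != 0 by move=> zz; rewrite mulf_neq0 ?expC_neq0 ?Hn.
have h1 : cre p.[0] <= ln (cabs (H 0)) + 1.
  have := minimum_principle (ltW s0) eQ Qn Q_ge; rewrite lnQ ?cabs0 ?(ltW s0)// ler_expR; lra.
have Q4 z : cabs z <= s / 2 -> ln (cabs (H z)) <= cre p.[z] + 4.
  move=> zz; have [_ T] := taylorP s0 eQ Q_le; have := T 0%N z zz.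
  have zz' : cabs z <= s by apply: le_trans zz _; rewrite ler_pdivrMr// ler_peMr ?(ltW s0)// ler1n.
  have -> : 2 * (2 * expR 1) * (cabs z / s) ^+ 0 = expR (ln 4 + 1) :> R.
    by rewrite expr0 mulr1 expRD lnK ?posrE// mulrA -natrM.
  rewrite /psum big_ord0 subr0 lnQ// ler_expR.
  move: (ln4_le3) (ln (cabs (H z))) (cre _); move: (ln 4) => l4 l4_3 a1 a2; lra.
pose q := p - p.[0]%:P.
have q0 : q.[0] = 0 by rewrite hornerD hornerN hornerC subrr.
have qB z : cabs z = s -> cre q.[z] <= B + 1 - cre p.[0].
  move=> zs; rewrite hornerD hornerN hornerC creB.
  have lB : ln (cabs (H z)) <= B by rewrite -ler_expR lnK ?posrE ?H0 ?zs// HB.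
  have := Hp z zs; rewrite ler_norml => /andP[]; lra.
have := horner_le_coef s0 q0 (borel_caratheodory s0 q0 qB) ws.
have E : cre p.[w] - cre p.[0] <= cabs q.[w].
  have <- : p.[w] - p.[0] = q.[w] by rewrite hornerD hornerN hornerC.
  by rewrite -creB; apply: le_trans (ler_norm _) (cre_le _).
have h2 := Q4 w ws; have h3 : ln (cabs (H 0)) <= cre p.[0] + 4 := Q4 0 zs'.
have u0 : 0 <= cabs w / s by rewrite divr_ge0 ?cabs_ge0// ltW.
move: E h1 h2 h3 => E h1 h2 h3 h4.
have h5 : (B + 1 - cre p.[0]) * (cabs w / s) <= (B + 5 - ln (cabs (H 0))) * (cabs w / s).
  rewrite ler_wpM2r//; move: h3; move: (ln _) (cre _) => a1 a2; lra.
move: (cabs w / s) (cre p.[0]) (cre p.[w]) (cabs q.[w]) (ln (cabs (H 0))) (ln (cabs (H w))) E h1 h2 h3 h4 h5 => u a1 a2 a3 a4 a5; lra.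
Qed.
End ZeroFree.

Section WronskianGrowth.
Variable R : realType.
Local Notation K := (C R).
Implicit Types (r s B S : R) (z w : K) (W V g : K -> K) (zs : seq K) (q : {poly K}).

(** A factor is at most 1 + r/|z|, hence at most 2 r/|z| for |z| <= r and 2 for
    the other zeros. *)
Lemma zero_product_le zs r s w : 0 < r -> (forall z, z \in zs -> z != 0) -> cabs w = r -> r <= s ->
  cabs (\prod_(z <- zs | cabs z <= s) (1 - w / z)) <=
  expR (\sum_(z <- zs | (z != 0) && (cabs z <= r)) ln (r / cabs z) + (count (fun z => cabs z <= s) zs)%:R * ln 2).
Proof.
move=> r0 zn wr rs; elim: zs zn => [|z zs IH] zn.
  by rewrite !big_nil mul0r addr0 expR0 cabs1.
have z0 : z != 0 by apply: zn; rewrite mem_head.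
have {}IH := IH (fun u uz => zn u (mem_behead (s := z :: zs) uz)).
have zp : 0 < cabs z by rewrite cabs_gt0.
rewrite !big_cons z0 /=.
have le1 : cabs (1 - w / z) <= 1 + r / cabs z.
  by apply: le_trans (cabsB _ _) _; rewrite cabs1 cabs_div wr.
have grow (x : R) : 0 < x -> cabs (1 - w / z) <= x * 2 ->
    cabs ((1 - w / z) * \prod_(j <- zs | cabs j <= s) (1 - w / j)) <=
    expR (ln x + \sum_(z0 <- zs | (z0 != 0) && (cabs z0 <= r)) ln (r / cabs z0) +
      (1 + count (fun z1 => cabs z1 <= s) zs)%:R * ln 2).
  move=> x0 xle; rewrite natrD [(1 + _) * ln 2]mulrDl mul1r addrACA expRD.
  rewrite cabsM; apply: ler_pM; rewrite ?cabs_ge0//.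
  by apply: le_trans xle _; rewrite expRD !lnK ?posrE.
case: (lerP (cabs z) s) => zs'; last first.
  by rewrite [cabs z <= r]leNgt (le_lt_trans rs zs') /= add0n.
case: (lerP (cabs z) r) => zr.
  have h : 1 <= r / cabs z by rewrite ler_pdivlMr// mul1r.
  by apply: grow; [exact: lt_le_trans ltr01 h|apply: le_trans le1 _; lra].
have h : r / cabs z <= 1 by rewrite ler_pdivrMr// mul1r ltW.
by have := @grow 1 ltr01; rewrite ln1 add0r; apply; apply: le_trans le1 _; lra.
Qed.

(** On the circle |w| = r the zeros in the disc |z| <= s contribute N_1(r), up
    to a bounded amount each, and the zero-free factor varies little when r/s
    is small. *)
Lemma wronskian_growth W V g zs q m S s r B w : 1 <= r -> r <= s / 2 -> s <= S ->
  entire V -> V 0 != 0 -> (forall w, W w = w ^+ m * V w) ->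
  entire g -> (forall w, V w = (\prod_(z <- zs) (w - z)) * g w) -> (forall w, cabs w <= S -> g w != 0) ->
  (forall w, cabs w = 2 * s -> cabs (W w * expC q.[w]) <= expR B) -> cabs w = r ->
  cabs (W w * expC q.[w]) <= expR (integrated_zero_count W r +
    (count (fun z => cabs z <= s) zs)%:R * ln 2 + (ln (cabs (V 0)) + cre q.[0]) + 5 +
    4 * (B + 8 - (ln (cabs (V 0)) + cre q.[0])) * (r / s)).
Proof.
move=> r1 rs sS eV V0 WV eg VE gn HB wr.
have r0 : 0 < r by exact: lt_le_trans ltr01 r1.
have s2 : 2 <= s by move: rs; rewrite ler_pdivlMr// => h; apply: le_trans h; rewrite ler_peMl// mulr_ege1// ler1n.
have s0 : 0 < s by exact: lt_le_trans s2.
have rs' : r <= s by apply: le_trans rs _; rewrite ler_pdivrMr// ler_peMr ?(ltW s0)// ler1n.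
have zn z : z \in zs -> z != 0.
  move=> zz; apply: contraNneq V0 => z0; rewrite VE (big_rem z)//= z0 sub0r oppr0 !mul0r//.
(* V(w) divided by the product of the factors 1 - w/z over the zeros in |z| <= s,
   times the exponential. *)
pose H w := (\prod_(z <- zs | ~~ (cabs z <= s)) (w - z)) * (\prod_(z <- zs | cabs z <= s) (- z)) * g w * expC q.[w].
have eH : entire H.
  apply: entireM; last exact: entire_comp (@entire_expC R) (entire_horner q).
  apply: entireM eg; apply: entireM (entire_cst _).
  exact: entire_prod entire_subc.
have VH w' : V w' * expC q.[w'] = (\prod_(z <- zs | cabs z <= s) (1 - w' / z)) * H w'.
  rewrite VE (bigID (fun z => cabs z <= s)) /= /H.
  rewrite (_ : \prod_(z <- zs | cabs z <= s) (w' - z) =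
    \prod_(z <- zs | cabs z <= s) (1 - w' / z) * \prod_(z <- zs | cabs z <= s) (- z)); last first.
    rewrite -big_split /= big_seq_cond [RHS]big_seq_cond; apply: eq_bigr => z /andP[zz _].
    by rewrite mulrBl mul1r mulrN opprK divfK ?zn// addrC.
  move: (\prod_(z <- zs | cabs z <= s) (1 - w' / z)) (\prod_(z <- zs | _) (- z)) (\prod_(z <- zs | _) _) (g w') (expC _) => a1 a2 a3 a4 a5; ring.
have Hn w' : cabs w' <= s -> H w' != 0.
  move=> ws; have gw : g w' != 0 by apply: gn; exact: le_trans sS.
  rewrite mulf_neq0 ?expC_neq0// mulf_neq0// mulf_neq0//.
    rewrite prodf_seq_neq0; apply/allP => z zz; apply/implyP => zs'; rewrite subr_eq0.
    by apply: contraNneq zs' => <-.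
  by rewrite prodf_seq_neq0; apply/allP => z zz; apply/implyP => _; rewrite oppr_eq0 zn.
clearbody H.
have H0 : ln (cabs (H 0)) = ln (cabs (V 0)) + cre q.[0].
  have := VH 0; rewrite big1 ?mul1r => [<-|z _]; last by rewrite mul0r subr0.
  by rewrite cabsM cabs_expC lnM ?posrE ?expR_gt0 ?cabs_gt0// expRK.
have p2 : 0 < 2 * s by rewrite mulr_gt0.
have H2s v : cabs v = 2 * s -> cabs (H v) <= expR B.
  move=> ws; apply: le_trans (HB v ws); rewrite WV -mulrA VH !cabsM mulrA ler_peMl ?cabs_ge0//.
  apply: mulr_ege1; first by rewrite cabsX ws exprn_ege1// mulr_ege1// ?ler1n// (le_trans _ s2)// ler1n.
  rewrite cabs_prod big_seq_cond; apply: (big_ind (fun x : R => 1 <= x)) => // [x y|z /andP[zz zs']].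
    exact: mulr_ege1.
  have zp : 0 < cabs z by rewrite cabs_gt0 zn.
  have h := cabs_subr (v / z) 1.
  have : 2 <= cabs (v / z) by rewrite cabs_div ws ler_pdivlMr// ler_pM2l.
  rewrite cabsC; move: h; rewrite cabs1; lra.
have Hs v : cabs v = s -> cabs (H v) <= expR (B + 3).
  move=> ws; have [_ T] := taylorP p2 eH H2s; have vs : cabs v <= 2 * s / 2 by rewrite [2 * s]mulrC mulfK// ws.
  have := T 0%N v vs.
  rewrite /psum big_ord0 subr0 expr0 mulr1 mulrA -[2 * 2]natrM => /le_trans; apply.
  rewrite addrC expRD ler_wpM2r ?expR_ge0// -[leLHS]lnK ?posrE// ler_expR; exact: ln4_le3.
have wr' : cabs w <= s / 2 by rewrite wr.
have G := zerofree_growth s0 eH Hn Hs wr'; rewrite H0 wr in G.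
rewrite WV -mulrA VH !cabsM cabsX wr.
have -> : integrated_zero_count W r = \sum_(z <- zs | (z != 0) && (cabs z <= r)) ln (r / cabs z) + m%:R * ln r.
  have WE w' : W w' = (\prod_(z <- nseq m 0 ++ zs) (w' - z)) * g w'.
    by rewrite WV VE mulrA big_cat big_nseq subr0 /= iter_mulr_1.
  have rS : 0 < r <= S by rewrite r0 (le_trans rs').
  rewrite (integrated_zero_countE eg WE gn rS) big_cat /= big1_seq ?add0r; last first.
    by move=> z /andP[/andP[z0 _]]; rewrite mem_nseq => /andP[_ /eqP zz]; move: z0; rewrite zz eqxx.
  rewrite count_cat count_nseq /= eqxx mul1n (_ : count_mem 0 zs = 0%N) ?addn0//.
  by apply/count_memPn/negP => /zn; rewrite eqxx.
have P := zero_product_le r0 zn wr rs'.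
set N := \sum_(z <- zs | _) _ in P *; set nu := (count _ _)%:R * ln 2 in P *.
set h0 := ln (cabs (V 0)) + cre q.[0] in G *.
have -> : N + m%:R * ln r + nu + h0 + 5 + 4 * (B + 8 - h0) * (r / s) =
  m%:R * ln r + ((N + nu) + (h0 + 5 + 4 * (B + 3 + 5 - h0) * (r / s))) by ring.
rewrite expRD expRM_natl lnK ?posrE// ler_wpM2l ?exprn_ge0 ?(ltW r0)//.
rewrite expRD; apply: ler_pM; rewrite ?cabs_ge0//.
by rewrite -ler_ln ?posrE ?expR_gt0 ?cabs_gt0 ?Hn ?wr// expRK.
Qed.

(** A zero in the disc |z| <= s contributes log(2^a s/|z|), at least a log 2. *)
Lemma count_le_integrated W V g zs m (a : nat) S s : 1 <= s -> 2 ^+ a * s <= S ->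
  V 0 != 0 -> (forall w, W w = w ^+ m * V w) ->
  entire g -> (forall w, V w = (\prod_(z <- zs) (w - z)) * g w) -> (forall w, cabs w <= S -> g w != 0) ->
  (count (fun z => cabs z <= s) zs)%:R * (a%:R * ln 2) <= integrated_zero_count W (2 ^+ a * s).
Proof.
move=> s1 sS V0 WV eg VE gn.
have s0 : 0 < s by exact: lt_le_trans ltr01 s1.
have p1 : 1 <= 2 ^+ a :> R by rewrite exprn_ege1// ler1n.
have zn z : z \in zs -> z != 0.
  by move=> zz; apply: contraNneq V0 => z0; rewrite VE (big_rem z)//= z0 sub0r oppr0 !mul0r.
have WE w' : W w' = (\prod_(z <- nseq m 0 ++ zs) (w' - z)) * g w'.
  by rewrite WV VE mulrA big_cat big_nseq subr0 /= iter_mulr_1.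
have rS : 0 < 2 ^+ a * s <= S by rewrite mulr_gt0 ?exprn_gt0.
rewrite (integrated_zero_countE eg WE gn rS).
apply: (@le_trans _ _ (\sum_(z <- zs | (z != 0) && (cabs z <= 2 ^+ a * s)) ln (2 ^+ a * s / cabs z))); last first.
  rewrite big_cat /= -addrA [leRHS]addrCA lerDl addr_ge0//.
    rewrite big_seq_cond; apply: sumr_ge0 => z /andP[_ /andP[z0 zz]].
    by rewrite ln_ge0// ler_pdivlMr ?cabs_gt0// mul1r.
  by rewrite mulr_ge0// ln_ge0// mulr_ege1.
elim: zs zn {VE WE} => [|z zs IH] zn; first by rewrite big_nil mul0r.
have {}IH := IH (fun u uz => zn u (mem_behead (s := z :: zs) uz)).
have z0 : z != 0 by apply: zn; rewrite mem_head.
have zp : 0 < cabs z by rewrite cabs_gt0.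
rewrite big_cons z0 /= natrD mulrDl.
case: (lerP (cabs z) s) => zs'.
  rewrite (le_trans zs') ?ler_peMl ?(ltW s0)// mul1r; apply: lerD IH.
  have -> : a%:R * ln 2 = ln (2 ^+ a) :> R by rewrite lnXn// mulr_natl.
  rewrite ler_ln ?posrE ?exprn_gt0 ?divr_gt0 ?mulr_gt0 ?exprn_gt0//.
  by rewrite ler_pdivlMr// ler_wpM2l// exprn_ge0.
rewrite mul0r add0r; case: ifP => // zz; apply: le_trans IH _; rewrite lerDr ln_ge0//.
by rewrite ler_pdivlMr// mul1r.
Qed.

End WronskianGrowth.

(** * Upper bound for the normalized Wronskian *)

Lemma radius_room (n a j : nat) : ((n + (a + j).+1).+1 <= j + n + (2 * a + 2))%N.
Proof. by lia. Qed.

Section Upper.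
Variables (R : realType) (n : nat) (F : C R -> 'rV[C R]_n.+1).
Local Notation K := (C R).
Implicit Types (z w : K).
Hypothesis F_entire : forall j, entire (coord_fun F j).
Hypothesis F_neq0 : forall z, F z != 0.
Local Notation T r := (characteristic F r).
Variable kap : nat -> {poly K}.
Hypothesis kap0 : forall j, (kap j).[0] = toC (lognorm F 0).
Hypothesis kap_circle : forall j z, cabs z = 2 ^+ j ->
  T (2 ^+ j) - 2 <= lognorm F z - cre (kap j).[z] <= T (2 ^+ j) + 2.
Local Notation dl := (disc_loss R n).
Local Notation normal := (normal F kap).

Lemma expCX z m : expC z ^+ m = expC (m%:R * z).
Proof.
elim: m => [|m IH]; first by rewrite expr0 mul0r expC0.
by rewrite exprS IH -expCD -natr1 mulrDl mul1r addrC.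
Qed.

Lemma cre_natM m z : cre (m%:R * z) = m%:R * cre z.
Proof.
elim: m => [|m IH]; first by rewrite !mul0r.
by rewrite -!natr1 !mulrDl !mul1r creD IH.
Qed.

Lemma normal_wronskian J w :
  wronskian (normal J) w = wronskian F w * expC (- (n.+1%:R *: kap J)).[w].
Proof.
have eg : entire (fun w => expC (- (kap J).[w])).
  exact: entire_comp (@entire_expC R) (entireN (entire_horner (kap J))).
rewrite (wronskian_scale eg (@F_entire)) mulrC expCX; congr (_ * expC _).
by rewrite hornerN hornerZ mulrN.
Qed.

(** The normalized coordinates are at most exp T up to a factor on the circle
    |z| = 2^J, hence so are their derivatives on smaller discs. *)
Lemma normal_wronskian_crude J r w : 1 <= r -> 2 ^+ n * r <= 2 ^+ J / 2 -> cabs w <= r ->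
  cabs (wronskian (normal J) w) <=
  expR (n.+1%:R * (T (2 ^+ J) + dl) + ln (n.+1`!%:R * (2 ^+ n * 4) ^+ n.+1)).
Proof.
move=> r1 rJ wr.
have Hd i j : (i <= n)%N -> cabs (derive1n i (coord_fun (normal J) j) w) <= 2 ^+ n * (4 * expR (T (2 ^+ J) + dl)).
  move=> i_n; apply: (derive1n_disc_bound i_n r1 rJ (expR_ge0 _) (@normal_entire _ _ _ F_entire kap J j)) => // v.
  exact: (@normal_circle _ _ _ F_neq0 kap kap_circle J).
have pos : 0 < n.+1`!%:R * (2 ^+ n * 4) ^+ n.+1 :> R.
  by rewrite mulr_gt0 ?exprn_gt0 ?mulr_gt0 ?exprn_gt0// ltr0n fact_gt0.
apply: le_trans (det_le (H := 2 ^+ n * (4 * expR (T (2 ^+ J) + dl))) _ _) _.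
- by rewrite !mulr_ge0 ?exprn_ge0 ?expR_ge0.
- by move=> i j; rewrite mxE; apply: Hd; rewrite -ltnS.
rewrite [leRHS]expRD lnK ?posrE// expRM_natl [2 ^+ n * (4 * _)]mulrA [in leLHS]exprMn [leLHS]mulrA.
by rewrite [leLHS]mulrC.
Qed.

(** Here s = 2^(a+j), and the zeros in |z| <= s are counted through N_1 at
    2^(2a+j), which stays below 2^J. *)
Lemma normalized_wronskian_upper : (exists w, wronskian F w != 0) ->
  exists2 c : R, 0 <= c & forall a j (u : R), (0 < a)%N -> 0 <= T (2 ^+ j) ->
  T (2 ^+ (j + n + (2 * a + 2))) <= 2 * T (2 ^+ j) -> N1 F (2 ^+ j) <= u ->
  N1 F (2 ^+ (a + (a + j))) <= T (2 ^+ (j + n + (2 * a + 2))) + dl + 1 ->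
  forall w, cabs w = 2 ^+ j ->
    cabs (wronskian (normal (j + n + (2 * a + 2))) w) <= expR (u + c * ((T (2 ^+ j) + 1) / a%:R) + c).
Proof.
move=> Wn; have eW := wronskian_entire F_entire.
have [zs0 [V eV [WV0 zs0z Vn]]] := zero_factorization 0 eW Wn.
have V0 : V 0 != 0 by apply: Vn; rewrite cabs0.
pose m := size zs0.
have WV w : wronskian F w = w ^+ m * V w.
  rewrite WV0 /m; congr (_ * _); elim: zs0 zs0z {WV0 m} => [|z zs IH] zsz; first by rewrite big_nil expr0.
  rewrite big_cons exprS IH => [|u uz]; last by apply: zsz; rewrite in_cons uz orbT.
  have /eqP : cabs z == 0 by rewrite eq_le cabs_ge0 zsz ?mem_head.
  by move=> /eqP; rewrite cabs_eq0 => /eqP ->; rewrite subr0.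
pose h0 : R := ln (cabs (V 0)) - n.+1%:R * lognorm F 0.
pose Cn : R := ln (n.+1`!%:R * (2 ^+ n * 4) ^+ n.+1).
have Cn0 : 0 <= Cn.
  rewrite ln_ge0//; apply: mulr_ege1; first by rewrite ler1n fact_gt0.
  by apply: exprn_ege1; apply: mulr_ege1; [apply: exprn_ege1|]; rewrite ler1n.
have dl0 : 0 <= dl := disc_loss_ge0 R n.
pose N : R := n.+1%:R; have N0 : 0 <= N by [].
pose c := 2 + dl + 1 + 4 * (N * (2 + dl) + Cn + 8 + `|h0|) + `|h0| + 5.
have c0 : 0 <= c.
  have Ndl : 0 <= N * (2 + dl) := mulr_ge0 N0 (addr_ge0 (ler0n _ 2) dl0).
  rewrite /c; move: (N * _) Ndl (`|h0|) (normr_ge0 h0) => x1 x10 x2 x20; lra.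
exists c => // a j u a0 t0.
set J := (j + n + (2 * a + 2))%N => tJt N1u N1s w wr.
have r1 : 1 <= 2 ^+ j :> R by rewrite exprn_ege1// ler1n.
have s1 : 1 <= 2 ^+ (a + j) :> R by rewrite exprn_ege1// ler1n.
have p0 m' : 0 < 2 ^+ m' :> R by rewrite exprn_gt0.
have rs : 2 ^+ j <= 2 ^+ (a + j) / 2 :> R.
  by rewrite ler_pdivlMr// -exprSr ler_weXn2l ?ler1n// -add1n leq_add2r.
have sS : 2 ^+ (a + j) <= 2 ^+ (a + (a + j)) :> R by rewrite ler_weXn2l ?ler1n// leq_addl.
have [zs [g eg [VE _ gn]]] := zero_factorization (2 ^+ (a + (a + j))) eV (ex_intro _ 0 V0).
pose q := - (n.+1%:R *: kap J).
have crude w' : cabs w' = 2 * 2 ^+ (a + j) -> cabs (wronskian F w' * expC q.[w']) <= expR (N * (T (2 ^+ J) + dl) + Cn).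
  move=> ws; rewrite -normal_wronskian; apply: (@normal_wronskian_crude J (2 * 2 ^+ (a + j))).
  - by rewrite -exprS exprn_ege1// ler1n.
  - rewrite ler_pdivlMr// -exprS -exprD -exprSr ler_weXn2l ?ler1n//.
    exact: radius_room.
  - by rewrite ws.
have G := wronskian_growth r1 rs sS eV V0 WV eg VE gn crude wr.
have NU := count_le_integrated s1 (_ : 2 ^+ a * 2 ^+ (a + j) <= 2 ^+ (a + (a + j)) :> R) V0 WV eg VE gn.
rewrite -exprD lexx in NU; have {}NU := NU isT.
rewrite normal_wronskian; apply: le_trans G _; rewrite ler_expR.
have qE : ln (cabs (V 0)) + cre q.[0] = h0.
  by rewrite hornerN hornerZ kap0 creN cre_natM.
rewrite qE; move: N1u N1s; rewrite /N1 => N1u N1s.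
set nu := (count _ _)%:R in NU *.
have a0' : 0 < a%:R :> R by rewrite ltr0n.
have l20 : 0 < ln 2 :> R by rewrite ln_gt0// ltr1n.
set t := T (2 ^+ j) in t0 tJt *; set tJ := T (2 ^+ J) in tJt N1s *.
have nu_le : nu * ln 2 <= (2 * t + dl + 1) / a%:R.
  rewrite ler_pdivlMr// -mulrA [ln 2 * _]mulrC; apply: le_trans NU _.
  by apply: le_trans N1s _; rewrite !lerD2r.
have rsE : 2 ^+ j / 2 ^+ (a + j) <= 1 / a%:R :> R.
  rewrite exprD invfM mulrCA divff ?gt_eqF// mulr1 div1r lef_pV2 ?posrE// -natrX ler_nat.
  by apply: ltnW; exact: ltn_expl.
have h0n : h0 <= `|h0| := ler_norm _.
have h0n' : - h0 <= `|h0| by rewrite -normrN ler_norm.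
have X0 : 0 <= N * (2 * t + dl) + Cn + 8 + `|h0|.
  have Ndl : 0 <= N * (2 * t + dl) := mulr_ge0 N0 (addr_ge0 (mulr_ge0 (ler0n _ 2) t0) dl0).
  move: (N * _) Ndl (`|h0|) (normr_ge0 h0) => x1 x10 x2 x20; lra.
have big : 4 * (N * (tJ + dl) + Cn + 8 - h0) * (2 ^+ j / 2 ^+ (a + j)) <=
    4 * (N * (2 * t + dl) + Cn + 8 + `|h0|) / a%:R.
  apply: (@le_trans _ _ (4 * (N * (2 * t + dl) + Cn + 8 + `|h0|) * (2 ^+ j / 2 ^+ (a + j)))).
    rewrite ler_wpM2r ?divr_ge0 ?(ltW (p0 _))// ler_pM2l//.
    have : N * (tJ + dl) <= N * (2 * t + dl) by rewrite ler_wpM2l// lerD2r.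
    by move: (N * _) (N * (tJ + _)) => x1 x2; lra.
  move: rsE; rewrite div1r => rsE; rewrite ler_wpM2l//; exact: mulr_ge0.
have fin : (2 * t + dl + 1) / a%:R + 4 * (N * (2 * t + dl) + Cn + 8 + `|h0|) / a%:R <= c * ((t + 1) / a%:R).
  rewrite -mulrDl mulrA ler_wpM2r ?invr_ge0 ?(ltW a0')// /c.
  have e1 : 0 <= (dl + 1 + 4 * (N * dl + Cn + 8 + `|h0|) + `|h0| + 5) * t.
    have Ndl : 0 <= N * dl := mulr_ge0 N0 dl0.
    apply: mulr_ge0 => //; move: (N * _) Ndl (`|h0|) (normr_ge0 h0) => x1 x10 x2 x20; lra.
  have e2 : 0 <= N * dl := mulr_ge0 N0 dl0.
  by move: (`|h0|) (normr_ge0 h0) e1 => h h_ge0 e1; lra.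
have c5 : h0 + 5 <= c.
  rewrite /c; have e2 : 0 <= N * (2 + dl) := mulr_ge0 N0 (addr_ge0 (ler0n _ 2) dl0).
  by move: (N * _) e2 (`|h0|) (normr_ge0 h0) h0n => x1 e2 x2 x3 x4; lra.
move: N1u nu_le big fin c5; move: (integrated_zero_count _ _) (nu * _) (4 * _ * (_ / _)) (_ / a%:R) (4 * _ / _) (c * _) => y1 y2 y3 y4 y5 y6; lra.
Qed.
End Upper.

(** * The contradiction *)

Section Final.
Variable R : realType.
Implicit Types (t u x : R).

Lemma ln_expR_add1 u : 0 <= u -> ln (expR u + 1) <= u + 1.
Proof.
move=> u0; rewrite -ler_expR lnK ?posrE ?addr_gt0 ?expR_gt0//.
have h : expR u * 2 <= expR (u + 1).
  by rewrite expRD ler_wpM2l ?expR_ge0//; exact: expR_ge1Dx (1 : R).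
apply: le_trans h; have : 1 <= expR u by apply: le_trans (expR_ge1Dx _); rewrite lerDl.
by move: (expR u) => e; lra.
Qed.

Lemma ereal_lt1_real (x : \bar R) : (x < 1)%E -> exists2 d : R, 0 < d <= 1 & (x < (1 - d)%:E)%E.
Proof.
case: x => [x||].
- rewrite lte_fin => x1; exists (Num.min 1 ((1 - x) / 2)).
    by rewrite ge_min lexx lt_min ltr01 divr_gt0// subr_gt0.
  rewrite lte_fin; have : Num.min 1 ((1 - x) / 2) <= (1 - x) / 2 by rewrite ge_min lexx orbT.
  by move: (Num.min _ _) => y; lra.
- by rewrite ltNge leey.
- by move=> _; exists 1; rewrite ?ltr01 ?lexx// ltNye.
Qed.

(** The choice of a absorbs the terms proportional to t, and then t is too large
    compared with j. *)
Lemma small_slope_contradiction (t d c1 c2 a b j : R) : 0 < d <= 1 -> 0 <= c1 -> 0 <= c2 -> 1 <= j -> 0 < a ->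
  a <= b -> 2 * (c1 + c2) / d <= a -> 2 / d * (3 * c1 + 2 * c2 + 2) * j <= t -> 0 <= t ->
  t <= c1 * ((t + 1) / b) + c1 * (j + 1) + ((1 - d) * t + c2 * ((t + 1) / a) + c2 + 1) -> False.
Proof.
move=> /andP[d0 d1] c10 c20 j1 a0 ab ha ht t0 H.
have b0 : 0 < b by exact: lt_le_trans ab.
have tb : (t + 1) / b <= (t + 1) / a.
  by rewrite ler_wpM2l ?addr_ge0// lef_pV2 ?posrE.
have h1 : c1 * ((t + 1) / b) <= c1 * ((t + 1) / a) by rewrite ler_wpM2l.
have h2 : (c1 + c2) * ((t + 1) / a) <= d / 2 * (t + 1).
  rewrite mulrA ler_pdivrMr//; move: ha; rewrite ler_pdivrMr// => ha.
  have : (t + 1) * (2 * (c1 + c2)) <= (t + 1) * (a * d) by rewrite ler_wpM2l// addr_ge0.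
  by lra.
have h3 : (3 * c1 + 2 * c2 + 2) * j <= d / 2 * t.
  have : d / 2 * (2 / d * (3 * c1 + 2 * c2 + 2) * j) <= d / 2 * t by rewrite ler_wpM2l// divr_ge0// ltW.
  by apply: le_trans; rewrite le_eqVlt; apply/orP; left; apply/eqP; field; rewrite gt_eqF.
have c1j : c1 * 1 <= c1 * j by rewrite ler_wpM2l.
have c2j : c2 * 1 <= c2 * j by rewrite ler_wpM2l.
by move: ((t + 1) / a) ((t + 1) / b) h1 h2 tb H => x y h1 h2 tb H; nra.
Qed.
Lemma ltr_div_le (x y c : R) : 0 < y -> x / y < c -> x <= c * y.
Proof. by move=> y0; rewrite ltr_pdivrMr// => /ltW. Qed.

Lemma pos_of_le_add (x y z : R) : x <= y + z + 1 -> z + 2 <= x -> 0 < y.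
Proof. lra. Qed.
End Final.

Theorem corollary1p3 (R : realType) (n : nat)
    (f : C R -> projective_space R n) (F : C R -> 'rV[C R]_n.+1)
    (n_ge1 : (1 <= n)%N)
    (f_hol : holomorphic_curve f)
    (f_trans : transcendental_curve f)
    (F_rep : reduced_representation F f)
    (F_nondeg : linearly_nondegenerate F)
    (F_order : curve_order F = 0%E) :
  (1 <= limf_esup (fun r : R => (N1 F r / characteristic F r)%:E)
                  (pinfty_nbhs R))%E.
Proof.
have [F_entire F_neq0 F_line] := F_rep.
rewrite leNgt; apply/negP => /ereal_lt1_real[d d01 /limf_esup_lt[r0 Hr0]].
have [kap Hkap] : exists kap : nat -> {poly C R}, forall j, (kap j).[0] = toC (lognorm F 0) /\
    forall z, cabs z = 2 ^+ j -> characteristic F (2 ^+ j) - 2 <= lognorm F z - cre (kap j).[z] <= characteristic F (2 ^+ j) + 2.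
  have H j : exists k : {poly C R}, k.[0] = toC (lognorm F 0) /\
    forall z, cabs z = 2 ^+ j -> characteristic F (2 ^+ j) - 2 <= lognorm F z - cre k.[z] <= characteristic F (2 ^+ j) + 2.
    by apply: (normalizer_exists (@F_entire) F_neq0); rewrite exprn_gt0.
  by have [kap Hk] := choice H; exists kap.
have kap0 j := proj1 (Hkap j).
have kapc j := proj2 (Hkap j).
have slow := order_zero_slow F_order.
have fast (m J : nat) : exists2 j, (J <= j)%N & m%:R * j%:R < characteristic F (2 ^+ j).
  apply: contrapT => none; apply: f_trans.
  have l20 : 0 < ln 2 :> R by rewrite ln_gt0// ltr1n.
  pose m' := (Num.truncn (m%:R / ln 2 : R)).+1.
  have mm' : m%:R <= ln 2 * m'%:R :> R.
    by rewrite mulrC -ler_pdivrMr// ltW// truncnS_gt.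
  apply: (@rational_of_slow_growth _ _ _ (@F_entire) F_neq0 kap kap0 kapc slow f m' 1 J) => // j Jj.
  rewrite mul1r -[2 in leRHS]lnK ?posrE// -!expRM_natr ler_expR.
  apply: (@le_trans _ _ (m%:R * j%:R)).
    by rewrite leNgt; apply/negP => h; apply: none; exists j.
  by rewrite mulrAC ler_wpM2r.
have [c1 c10 [j1 Hc1]] := characteristic_upper (@F_entire) F_neq0 F_nondeg kap0 kapc slow.
have dl0 := disc_loss_ge0 R n.
have [c2 c20 Hc2] : exists2 c2 : R, 0 <= c2 & forall a j (u : R), (0 < a)%N -> 0 <= u ->
    0 <= characteristic F (2 ^+ j) ->
    characteristic F (2 ^+ (j + n + (2 * a + 2))) <= 2 * characteristic F (2 ^+ j) -> N1 F (2 ^+ j) <= u ->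
    N1 F (2 ^+ (a + (a + j))) <= characteristic F (2 ^+ (j + n + (2 * a + 2))) + disc_loss R n + 1 ->
    forall w, cabs w = 2 ^+ j -> cabs (wronskian (normal F kap (j + n + (2 * a + 2))) w) <=
      expR (u + c2 * ((characteristic F (2 ^+ j) + 1) / a%:R) + c2).
  have [Wn|W0] := pselect (exists w, wronskian F w != 0).
    have [c2 c20 H] := normalized_wronskian_upper (@F_entire) F_neq0 kap0 kapc Wn.
    by exists c2 => // a j u a0 _; exact: H.
  exists 0 => // a j u a0 u0 _ _ _ _ w _; rewrite normal_wronskian//.
  rewrite (_ : wronskian F w = 0); first by rewrite mul0r cabs0 expR_ge0.
  by apply: contrapT => Ww; apply: W0; exists w; apply/eqP.
have /andP[d0 d1] := d01.
pose a := (Num.truncn (2 * (c1 + c2) / d)).+1.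
have ha : 2 * (c1 + c2) / d <= a%:R by apply: ltW; exact: truncnS_gt.
pose M := 2 / d * (3 * c1 + 2 * c2 + 2) + (disc_loss R n + 2).
have M1 : 0 <= 2 / d * (3 * c1 + 2 * c2 + 2).
  by apply: mulr_ge0; [rewrite divr_ge0// ltW|rewrite !addr_ge0// mulr_ge0].
have M0 : 0 < M by rewrite /M; lra.
pose J0 := maxn j1 (maxn 1 (Num.truncn `|r0|).+1).
have b_gt0 : (0 < n + (2 * a + 2))%N by rewrite addnA addn2.
have [j [jJ0 jt jM]] := @doubling_pause R (fun j => characteristic F (2 ^+ j)) (n + (2 * a + 2)) J0 M
  b_gt0 M0 (order_zero_subexponential F_order) fast.
move: jJ0; rewrite !geq_max => /andP[jj1 /andP[j_ge1 jr0]].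
rewrite addnA in jt.
have r0lt i : (j <= i)%N -> r0 < 2 ^+ i.
  move=> ji; apply: le_lt_trans (ler_norm _) _; apply: lt_le_trans (truncnS_gt _) _.
  by rewrite -natrX ler_nat (leq_trans jr0)// (leq_trans ji)// ltnW// ltn_expl.
have j1R : 1 <= j%:R :> R by rewrite ler1n.
have dlM : disc_loss R n + 2 <= M * j%:R.
  apply: (@le_trans _ _ M); first by rewrite /M lerDr.
  by rewrite ler_peMr// ltW.
have jM' : 2 / d * (3 * c1 + 2 * c2 + 2) * j%:R <= characteristic F (2 ^+ j).
  by apply: le_trans jM; rewrite ler_wpM2r// lerDl addr_ge0.
have tpos : disc_loss R n + 2 <= characteristic F (2 ^+ j) by exact: le_trans dlM jM.
have t0 : 0 <= characteristic F (2 ^+ j) by apply: le_trans tpos; rewrite addr_ge0.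
have N1_le i : (j <= i)%N -> 0 < characteristic F (2 ^+ i) -> N1 F (2 ^+ i) <= (1 - d) * characteristic F (2 ^+ i).
  by move=> ji Ti; exact: ltr_div_le Ti (Hr0 _ (r0lt i ji)).
have jpos : 0 < characteristic F (2 ^+ j) by apply: lt_le_trans tpos; rewrite ltr_wpDl.
have d1' : 0 <= 1 - d by rewrite subr_ge0.
have aj : (j < a + (a + j))%N by rewrite addnA -[X in (X < _)%N]add0n ltn_add2r addSn.
have ajJ : (a + (a + j) < j + n + (2 * a + 2))%N by clear; lia.
have mono1 := characteristic_mono (@F_entire) F_neq0 kap0 kapc aj.
have mono2 := characteristic_mono (@F_entire) F_neq0 kap0 kapc ajJ.
have N1s : N1 F (2 ^+ (a + (a + j))) <= characteristic F (2 ^+ (j + n + (2 * a + 2))) + disc_loss R n + 1.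
  have spos : 0 < characteristic F (2 ^+ (a + (a + j))).
    exact: pos_of_le_add mono1 tpos.
  apply: le_trans (N1_le _ (ltnW aj) spos) _; apply: le_trans mono2.
  by rewrite ler_piMl ?(ltW spos)// lerBlDr lerDl ltW.
have u0 : 0 <= (1 - d) * characteristic F (2 ^+ j) by rewrite mulr_ge0.
have WM := Hc2 a j _ isT u0 t0 jt (N1_le j (leqnn j) jpos) N1s.
have b0 : (0 < 2 * a + 2)%N by rewrite addn2.
have U := Hc1 j _ _ jj1 b0 t0 jt (expR_ge0 _) WM.
have ab : a%:R <= (2 * a + 2)%:R :> R by rewrite ler_nat; clear; lia.
have w0 : 0 <= (1 - d) * characteristic F (2 ^+ j) + c2 * ((characteristic F (2 ^+ j) + 1) / a%:R) + c2.
  by rewrite !addr_ge0// mulr_ge0// divr_ge0// addr_ge0.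
apply: (small_slope_contradiction d01 c10 c20 j1R _ ab ha jM' t0); first by rewrite ltr0n.
by apply: le_trans U _; rewrite lerD2l; exact: ln_expR_add1.
Qed.
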